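(* Given a string $S[1..n]$ over $[1..\sigma]$ and an integer $k\geq1$, a $k$-attractor $\Gamma$ of $S$ with $|\Gamma|\leq\mathcal H(k(k+1)/2)\cdot|\Gamma^*|$, where $\Gamma^*$ is a minimum $k$-attractor of $S$, can be computed in $\mathcal O(\min\{n^2,nk^2,n+\sigma^{2k-1}k^2\})$ expected time.
   Context: $\mathcal H(p)=\sum_{i=1}^p\frac1i$ is the $p$-th harmonic number. A set $\Gamma\subseteq[1..n]$ is a $k$-attractor of $S$ if every substring $S[i..j]$ with $i\leq j<i+k$ has an occurrence $S[i'..j']=S[i..j]$ with $j''\in[i'..j']$ for some $j''\in\Gamma$; a minimum $k$-attractor is one of smallest cardinality. Model: word RAM with words of $\Theta(\log n)$ bits. *)

(* Defs.v *)
From HB Require Import structures.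
From mathcomp Require Import all_boot all_order all_algebra finmap.
From mathcomp Require Import boolp classical_sets reals ereal topology.
From mathcomp Require Import normedtype sequences.

Set Implicit Arguments.
Unset Strict Implicit.
Unset Printing Implicit Defensive.

Import Order.TTheory GRing.Theory Num.Theory.

Local Open Scope nat_scope.

(* [substr S i j] is S[i..j]; positions are numbered from 1. *)
Definition substr (T : Type) (S : seq T) (i j : nat) : seq T :=
  drop i.-1 (take j S).

Definition attractor (k : nat) (S : seq nat) (G : {fset nat}) : Prop :=
  (forall x, x \in G -> 1 <= x <= size S) /\
  (forall i j, 1 <= i -> i <= j -> j <= size S -> j < i + k ->
     exists i' j',
       [/\ 1 <= i', i' <= j', j' <= size S, substr S i' j' = substr S i j
         & exists2 x, x \in G & i' <= x <= j']).

Definition min_attractor (k : nat) (S : seq nat) (G : {fset nat}) : Prop :=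
  attractor k S G /\
  (forall G' : {fset nat}, attractor k S G' -> #|` G| <= #|` G'|).

Definition harmonic_number (R : realType) (p : nat) : R :=
  (\sum_(1 <= i < p.+1) i%:R^-1)%R.

(* Randomized word RAM with w-bit words.  A word is a natural number below
   2 ^ w; addresses are words, and a program is a finite list of unit-cost
   instructions acting on registers (a program mentions only finitely many)
   and on a memory of words. *)
Inductive binop : Type :=
  | OAdd | OSub | OMul | ODiv | OMod
  | OAnd | OOr | OXor | OShl | OShr | OLt | OEq.

Inductive instr : Type :=
  | IConst of nat & nat                (* r_d := c mod 2^w *)
  | IOp of binop & nat & nat & nat     (* r_d := r_a op r_b *)
  | IRead of nat & nat                 (* r_d := memory[r_a] *)
  | IWrite of nat & nat                (* memory[r_a] := r_b *)
  | IRand of nat                       (* r_d := uniformly random word *)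
  | IJnz of nat & nat.                 (* if r_a <> 0 then goto l *)

Definition program := seq instr.

Record config := Config {
  pc : nat;
  regs : nat -> nat;
  memory : nat -> nat }.

Definition upd (f : nat -> nat) (a v : nat) : nat -> nat :=
  fun x => if x == a then v else f x.

(* Arithmetic is modulo 2 ^ w; division by 0 yields 0 and x mod 0 = x. *)
Definition binop_eval (w : nat) (o : binop) (x y : nat) : nat :=
  match o with
  | OAdd => (x + y) %% 2 ^ w
  | OSub => (x + 2 ^ w - y) %% 2 ^ w
  | OMul => (x * y) %% 2 ^ w
  | ODiv => x %/ y
  | OMod => x %% y
  | OAnd => Nat.land x y
  | OOr => Nat.lor x y
  | OXor => Nat.lxor x y
  | OShl => (x * 2 ^ y) %% 2 ^ w
  | OShr => x %/ 2 ^ y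
  | OLt => x < y
  | OEq => x == y
  end.

(* A program halts by moving the program counter past its last instruction. *)
Definition halted (P : program) (c : config) : bool := size P <= pc c.

(* One step; u is the random word of this step, ignored unless the current
   instruction is IRand.  A halted configuration does not change. *)
Definition step (w : nat) (P : program) (c : config) (u : nat) : config :=
  let: Config i r m := c in
  match onth P i with
  | None => c
  | Some (IConst d v) => Config i.+1 (upd r d (v %% 2 ^ w)) m
  | Some (IOp o d a b) => Config i.+1 (upd r d (binop_eval w o (r a) (r b))) m
  | Some (IRead d a) => Config i.+1 (upd r d (m (r a))) m
  | Some (IWrite a b) => Config i.+1 r (upd m (r a) (r b))
  | Some (IRand d) => Config i.+1 (upd r d u) m
  | Some (IJnz a l) => Config (if r a != 0 then l else i.+1) r m
  end.

Definition run (w : nat) (P : program) (c : config) (u : seq 'I_(2 ^ w)) :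
    config :=
  foldl (fun c' x => step w P c' (nat_of_ord x)) c u.

(* On the random words u_0, ..., u_(t-1), the run halts after exactly t
   steps. *)
Definition halts_at (w : nat) (P : program) (c : config) (t : nat)
    (u : t.-tuple 'I_(2 ^ w)) : bool :=
  halted P (run P c u) &&
  [forall s : 'I_t, ~~ halted P (run P c (take s u))].

(* Probability that the running time is exactly t, the random words being
   independent and uniform: that event depends on the first t words only. *)
Definition time_pmf (R : realType) (w : nat) (P : program) (c : config)
    (t : nat) : R :=
  (#|[set u : t.-tuple 'I_(2 ^ w) | halts_at P c u]|%:R
     / #|{: t.-tuple 'I_(2 ^ w)}|%:R)%R.

(* Started in c, the program halts almost surely, its expected running time
   is at most B, and the result satisfies Q whenever it halts. *)
Definition computes_in_expected_time (R : realType) (w : nat) (P : program)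
    (c : config) (Q : config -> Prop) (B : R) : Prop :=
  [/\ (\sum_(0 <= t <oo) (time_pmf R w P c t)%:E = 1)%E,
      (\sum_(0 <= t <oo) (t%:R * time_pmf R w P c t)%:E <= B%:E)%E
    & forall u : seq 'I_(2 ^ w), halted P (run P c u) -> Q (run P c u)].

(* Input layout: n, sigma, k in cells 0, 1, 2 and S[1..n] from cell 3 on;
   everything else is 0. *)
Definition input_config (n sigma k : nat) (S : seq nat) : config :=
  Config 0 (fun=> 0) (fun a => nth 0 [:: n, sigma, k & S] a).

(* Output layout: the cardinality m of G in cell 0 and the elements of G,
   without repetition and in any order, in cells 1, ..., m. *)
Definition outputs (c : config) (G : {fset nat}) : Prop :=
  perm_eq [seq memory c a | a <- iota 1 (memory c 0)] (enum_fset G).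

Definition bitlen (n : nat) : nat := (trunc_log 2 n).+1.

Definition time_bound (n sigma k : nat) : nat :=
  minn (n ^ 2) (minn (n * k ^ 2) (n + sigma ^ (2 * k - 1) * k ^ 2)).

(* Main.v *)
Require Import Defs.
From HB Require Import structures.
From mathcomp Require Import all_boot all_order all_algebra finmap.
From mathcomp Require Import boolp classical_sets reals ereal topology.
From mathcomp Require Import normedtype sequences.
From mathcomp Require Import zify.

Set Implicit Arguments.
Unset Strict Implicit.
Unset Printing Implicit Defensive.

Import Order.TTheory GRing.Theory Num.Theory.

Local Open Scope nat_scope.

(** The program is deterministic and runs the greedy algorithm for set cover on
    a reduced instance.  Let [K = min k n].

    Positions: if [sigma ^ (2K - 1) <= n], only the first occurrence of every
    window of length [2K - 1] keeps its centre as a candidate (together with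
    the centres too close to the ends); equal windows meet the same substrings
    of length at most [K], so candidates suffice, and there are
    [O(sigma ^ (2K - 1))] of them.  Otherwise all positions are candidates.

    Elements: a substring [xa] such that every occurrence of [x] is followed
    by [a] is covered as soon as [x] is.  Dropping these leaves at most [2n] classes of substrings (the
    edges of the suffix tree), and a position meets at most [K(K+1)/2] of them.

    Classes are computed length by length, the class of an occurrence being
    its first occurrence; the zero-initialised memory of size [2 ^ w] serves as
    a direct-address table.  The positions met by a class are listed without
    repetition by scanning its occurrences from left to right.  The greedy
    choice needs no priority queue: the largest number [t] of uncovered
    elements of a position only decreases, so scanning all candidates once for
    each [t] stays within the bound.

    Approximation: for a hitting set [G], every greedy choice lowers the
    potential [sum_(q in G) H (number of uncovered elements of q)] by at least
    one, and it starts below [H (k(k+1)/2) * #|G|].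

    Alphabets of size one are treated apart, the answer being [{1}]. *)

(** * A structured language over the word RAM *)

(** Without [IRand] the running time is concentrated at a single value, so a worst-case bound is a
    bound on the expectation.

    The three terms of the time bound are three ways of counting incidences. A position meets at
    most [min (K * K) (2 * n)] elements; over [n] candidates this gives [n ^ 2] and [n * k ^ 2], and
    over the filtered candidates it gives the third term. If [sigma ^ (2K - 1) > n], filtering could
    not help: [n * K ^ 2] is then already below the third term.

    The filter also keeps [2(K - 1)] positions near the ends. They are [O(sigma ^ (2K - 1))] only
    for [sigma >= 2], and this is why unary strings are separated.

    Characters range up to [2 ^ w] and cannot index a table, so they are renamed by their digits in
    base [M = 2n + 4]. The bound [w <= c1 * bitlen n] limits this to [c1] rounds, which is how the
    final constant depends on [c1]. The factor 40 in the lower bound on [w] makes room for tables of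
    [M ^ 3] and [(w + 1) * M ^ 2] cells. *)

Inductive expr : Type :=
  | EVar of nat
  | ENum of nat
  | EArr of nat & expr
  | ELow of expr
  | EOp of binop & expr & expr.

Inductive cmd : Type :=
  | CSkip
  | CSet of nat & expr
  | CArr of nat & expr & expr
  | CLow of expr & expr
  | CSeq of cmd & cmd
  | CIf of expr & cmd & cmd
  | CWhile of expr & cmd.

(* [ar] holds the arrays, [lo] the cells that contain the input and later the
   output, and [tm] counts loop iterations. *)
Record state := State {
  vr : nat -> nat;
  ar : nat -> nat -> nat;
  lo : nat -> nat;
  tm : nat }.

(** Here and in [seta], [eqn] lets [cbn] decide comparisons of literal variable and array numbers;
    array indices are symbolic and use [==]. *)
Definition setv (s : state) (x v : nat) : state :=
  State (fun y => if eqn y x then v else vr s y) (ar s) (lo s) (tm s).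

Definition seta (s : state) (r i v : nat) : state :=
  State (vr s)
    (fun r' i' => if eqn r' r then (if i' == i then v else ar s r' i')
                  else ar s r' i')
    (lo s) (tm s).

Definition setl (s : state) (i v : nat) : state :=
  State (vr s) (ar s) (fun i' => if i' == i then v else lo s i') (tm s).

Definition tick (s : state) : state := State (vr s) (ar s) (lo s) (tm s).+1.

(** Exact arithmetic on natural numbers. [op_ok] demands that word arithmetic agree with it, and
    excludes the bit operations. *)
Definition op_val (o : binop) (x y : nat) : nat :=
  match o with
  | OAdd => x + y
  | OSub => x - y
  | OMul => x * y
  | ODiv => x %/ y
  | OMod => x %% y
  | OLt => x < y
  | OEq => x == y
  | _ => 0
  end.

Fixpoint eval (s : state) (e : expr) : nat :=
  match e with
  | EVar x => vr s x
  | ENum c => c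
  | EArr r e1 => ar s r (eval s e1)
  | ELow e1 => lo s (eval s e1)
  | EOp o e1 e2 => op_val o (eval s e1) (eval s e2)
  end.

Section Language.

(* Words have [w] bits, the cells below [off] are the input cells, and entry
   [i < lim] of array [r < 16] is stored in cell [(i + off) * 16 + r]. *)
Variables w off lim : nat.

Definition op_ok (o : binop) (x y : nat) : Prop :=
  match o with
  | OAdd => x + y < 2 ^ w
  | OSub => y <= x < 2 ^ w
  | OMul => x * y < 2 ^ w
  | ODiv | OMod | OLt | OEq => True
  | _ => False
  end.

Fixpoint expr_ok (s : state) (e : expr) : Prop :=
  match e with
  | EVar _ => True
  | ENum c => c < 2 ^ w
  | EArr r e1 => [/\ expr_ok s e1, r < 16 & eval s e1 < lim]
  | ELow e1 => expr_ok s e1 /\ eval s e1 < off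
  | EOp o e1 e2 =>
      [/\ expr_ok s e1, expr_ok s e2 & op_ok o (eval s e1) (eval s e2)]
  end.

Inductive exec : cmd -> state -> state -> Prop :=
  | exec_skip s : exec CSkip s s
  | exec_set x e s : expr_ok s e -> exec (CSet x e) s (setv s x (eval s e))
  | exec_arr r e1 e2 s : expr_ok s e1 -> expr_ok s e2 -> r < 16 ->
      eval s e1 < lim -> exec (CArr r e1 e2) s (seta s r (eval s e1) (eval s e2))
  | exec_low e1 e2 s : expr_ok s e1 -> expr_ok s e2 -> eval s e1 < off ->
      exec (CLow e1 e2) s (setl s (eval s e1) (eval s e2))
  | exec_seq c1 c2 s1 s2 s3 : exec c1 s1 s2 -> exec c2 s2 s3 ->
      exec (CSeq c1 c2) s1 s3
  | exec_if e c1 c2 s s' : expr_ok s e ->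
      exec (if eval s e != 0 then c1 else c2) s s' -> exec (CIf e c1 c2) s s'
  | exec_done e c s : expr_ok s e -> eval s e = 0 -> exec (CWhile e c) s s
  | exec_loop e c s1 s2 s3 : expr_ok s1 e -> eval s1 e != 0 ->
      exec c (tick s1) s2 -> exec (CWhile e c) s2 s3 ->
      exec (CWhile e c) s1 s3.

(** Total correctness: a terminating execution without overflow exists. Its derivation is what
    [compile_run] turns into machine steps. *)
Definition wp (c : cmd) (Q : state -> Prop) (s : state) : Prop :=
  exists2 s', exec c s s' & Q s'.

Lemma wp_imp c (Q1 Q2 : state -> Prop) s :
  wp c Q1 s -> (forall s', Q1 s' -> Q2 s') -> wp c Q2 s.
Proof. by move=> [s' ? ?] imp; exists s'; last exact: imp. Qed.

Lemma wp_skip (Q : state -> Prop) s : Q s -> wp CSkip Q s.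
Proof. by move=> ?; exists s => //; exact: exec_skip. Qed.

Lemma wp_set (Q : state -> Prop) x e s :
  expr_ok s e -> Q (setv s x (eval s e)) -> wp (CSet x e) Q s.
Proof. by move=> ? ?; exists (setv s x (eval s e)) => //; exact: exec_set. Qed.

Lemma wp_arr (Q : state -> Prop) r e1 e2 s :
  expr_ok s e1 -> expr_ok s e2 -> r < 16 -> eval s e1 < lim ->
  Q (seta s r (eval s e1) (eval s e2)) -> wp (CArr r e1 e2) Q s.
Proof.
by move=> *; exists (seta s r (eval s e1) (eval s e2)) => //; exact: exec_arr.
Qed.

Lemma wp_low (Q : state -> Prop) e1 e2 s :
  expr_ok s e1 -> expr_ok s e2 -> eval s e1 < off ->
  Q (setl s (eval s e1) (eval s e2)) -> wp (CLow e1 e2) Q s.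
Proof.
by move=> *; exists (setl s (eval s e1) (eval s e2)) => //; exact: exec_low.
Qed.

Lemma wp_seq (Q : state -> Prop) c1 c2 s :
  wp c1 (wp c2 Q) s -> wp (CSeq c1 c2) Q s.
Proof. by move=> [s1 x1 [s2 x2 q]]; exists s2 => //; exact: exec_seq x1 x2. Qed.

Lemma wp_if (Q : state -> Prop) e c1 c2 s :
  expr_ok s e -> (eval s e != 0 -> wp c1 Q s) -> (eval s e = 0 -> wp c2 Q s) ->
  wp (CIf e c1 c2) Q s.
Proof.
move=> ok h1 h2; case: (eqVneq (eval s e) 0) => [e0|n0].
  have [s' x q] := h2 e0; exists s' => //; apply: exec_if => //.
  by rewrite e0 eqxx.
by have [s' x q] := h1 n0; exists s' => //; apply: exec_if => //; rewrite n0.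
Qed.

(** The invariant is indexed by a ghost value and the variant [mu] depends on that value alone, so
    termination is argued without reading the state. *)
Lemma wp_while (T : Type) (I : T -> state -> Prop) (mu : T -> nat)
    (Q : state -> Prop) e c x s :
  I x s ->
  (forall y s, I y s -> expr_ok s e /\
    (eval s e != 0 ->
       wp c (fun s' => exists2 z, I z s' & mu z < mu y) (tick s)) /\
    (eval s e = 0 -> Q s)) ->
  wp (CWhile e c) Q s.
Proof.
move=> Ix H; have [m mx] : exists m, mu x < m by exists (mu x).+1.
elim: m x s Ix mx => // m IH x s Ix mx.
have [ok [h1 h2]] := H _ _ Ix.
case: (eqVneq (eval s e) 0) => [e0|n0].
  by exists s; [exact: exec_done | exact: h2].
have [s1 x1 [y Iy my]] := h1 n0.
have [s2 x2 q] := IH y s1 Iy (leq_trans my mx).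
by exists s2 => //; exact: exec_loop ok n0 x1 x2.
Qed.

(** * Compilation *)

(** Even registers from 2 on hold variables, odd registers form the evaluation stack, and register 0
    is reserved for the offset [off]. *)
Definition rvar (x : nat) : nat := x.*2.+2.
Definition rtmp (d : nat) : nat := d.*2.+1.

Definition to_address (r d : nat) : seq instr :=
  [:: IOp OAdd (rtmp d) (rtmp d) 0; IConst (rtmp d.+1) 16;
      IOp OMul (rtmp d) (rtmp d) (rtmp d.+1); IConst (rtmp d.+1) r;
      IOp OAdd (rtmp d) (rtmp d) (rtmp d.+1)].

Arguments to_address : simpl never.

(** Copies use a bitwise or with 0: unlike an addition it does not reduce modulo [2 ^ w], so it is
    exact whatever the size of the value. *)
Fixpoint compile_expr (e : expr) (d : nat) : seq instr :=
  match e with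
  | EVar x => [:: IConst (rtmp d) 0; IOp OOr (rtmp d) (rvar x) (rtmp d)]
  | ENum c => [:: IConst (rtmp d) c]
  | EArr r e1 =>
      compile_expr e1 d ++ to_address r d ++ [:: IRead (rtmp d) (rtmp d)]
  | ELow e1 => compile_expr e1 d ++ [:: IRead (rtmp d) (rtmp d)]
  | EOp o e1 e2 => compile_expr e1 d ++ compile_expr e2 d.+1 ++
      [:: IOp o (rtmp d) (rtmp d) (rtmp d.+1)]
  end.

Definition goto (l : nat) : seq instr :=
  [:: IConst (rtmp 0) 1; IJnz (rtmp 0) l].

Fixpoint compile (b : nat) (c : cmd) : seq instr :=
  match c with
  | CSkip => [::]
  | CSet x e => compile_expr e 0 ++
      [:: IConst (rtmp 1) 0; IOp OOr (rvar x) (rtmp 0) (rtmp 1)]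
  | CArr r e1 e2 => compile_expr e1 0 ++ to_address r 0 ++
      compile_expr e2 1 ++ [:: IWrite (rtmp 0) (rtmp 1)]
  | CLow e1 e2 => compile_expr e1 0 ++
      compile_expr e2 1 ++ [:: IWrite (rtmp 0) (rtmp 1)]
  | CSeq c1 c2 =>
      let p1 := compile b c1 in p1 ++ compile (b + size p1) c2
  | CIf e c1 c2 =>
      let t := compile_expr e 0 in
      let p2 := compile (b + size t).+1 c2 in
      let b1 := (b + size t).+1 + size p2 + 2 in
      let p1 := compile b1 c1 in
      t ++ [:: IJnz (rtmp 0) b1] ++ p2 ++ goto (b1 + size p1) ++ p1
  | CWhile e c1 =>
      let t := compile_expr e 0 in
      let b1 := (b + size t) + 3 in
      let p1 := compile b1 c1 in
      t ++ [:: IJnz (rtmp 0) b1] ++ goto (b1 + size p1 + 2) ++ p1 ++ goto b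
  end.

Definition straight (i : instr) : bool :=
  match i with IRand _ | IJnz _ _ => false | _ => true end.

Definition istep (rm : (nat -> nat) * (nat -> nat)) (i : instr) :=
  let: (r, m) := rm in
  match i with
  | IConst d v => (upd r d (v %% 2 ^ w), m)
  | IOp o d a b => (upd r d (binop_eval w o (r a) (r b)), m)
  | IRead d a => (upd r d (m (r a)), m)
  | IWrite a b => (r, upd m (r a) (r b))
  | _ => rm
  end.

Definition srun (p : seq instr) rm := foldl istep rm p.

Lemma srun_cat p q rm : srun (p ++ q) rm = srun q (srun p rm).
Proof. exact: foldl_cat. Qed.

Definition code_at (P : program) (b : nat) (p : seq instr) : Prop :=
  forall j, j < size p -> onth P (b + j) = onth p j.

Lemma code_at_catl P b p q : code_at P b (p ++ q) -> code_at P b p.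
Proof.
move=> h j jp; rewrite h ?size_cat ?ltn_addr // onth_cat jp //.
Qed.

Lemma code_at_catr P b p q :
  code_at P b (p ++ q) -> code_at P (b + size p) q.
Proof.
move=> h j jp; rewrite -addnA h ?size_cat ?ltn_add2l // onth_cat.
by rewrite ltnNge leq_addr /= addKn.
Qed.

Definition dstep (P : program) (c : config) : config := step w P c 0.

Arguments dstep : simpl never.

Lemma dstep_straight P b i r m : straight i -> onth P b = Some i ->
  dstep P (Config b r m) =
  Config b.+1 (istep (r, m) i).1 (istep (r, m) i).2.
Proof. by rewrite /dstep /step => + ->; case: i. Qed.

Lemma iter_straight P p b r m : all straight p -> code_at P b p ->
  iter (size p) (dstep P) (Config b r m) =
  Config (b + size p) (srun p (r, m)).1 (srun p (r, m)).2.
Proof.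
elim: p b r m => [|i p IH] b r m /=; first by rewrite addn0.
move=> /andP[si sp] cp; rewrite -iterS iterSr.
have h0 : onth P b = Some i by rewrite -[b]addn0 cp.
rewrite (dstep_straight _ _ si h0) IH //.
  rewrite addSnnS /srun /=; congr Config.
    by rewrite -surjective_pairing.
  by rewrite -surjective_pairing.
by move=> j jp; rewrite addSnnS cp.
Qed.

Lemma straight_expr e d : all straight (compile_expr e d).
Proof.
elim: e d => //= [r e IH|e IH|o e1 IH1 e2 IH2] d; rewrite !all_cat ?IH //.
by rewrite IH1 IH2.
Qed.

(** The residue modulo 16 separates the arrays, and the shift by [off] keeps all of them above the
    input cells. *)
Definition related (s : state) (rm : (nat -> nat) * (nat -> nat)) : Prop :=
  [/\ forall x, rm.1 (rvar x) = vr s x,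
      rm.1 0 = off,
      forall i, i < off -> rm.2 i = lo s i
    & forall r i, r < 16 -> i < lim -> rm.2 ((i + off) * 16 + r) = ar s r i].

Hypothesis lim_ok : (lim + off) * 16 < 2 ^ w.

Lemma rtmp_neq d d' : (rtmp d == rtmp d') = (d == d').
Proof. rewrite /rtmp; lia. Qed.

Lemma rvar_rtmp x d : (rvar x == rtmp d) = false.
Proof. rewrite /rtmp /rvar; lia. Qed.

Lemma rvar_neq x y : (rvar x == rvar y) = (x == y).
Proof. rewrite /rvar; lia. Qed.

Lemma related_tmp s r m d v : related s (r, m) -> related s (upd r (rtmp d) v, m).
Proof.
move=> [h1 h2 h3 h4]; split => //= x; rewrite /upd.
by rewrite rvar_rtmp; exact: h1.
Qed.

Lemma op_evalE o x y : op_ok o x y -> binop_eval w o x y = op_val o x y.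
Proof.
case: o => //=.
- by move=> ?; rewrite modn_small.
- move=> /andP[yx xw]; rewrite addnC -addnBA // modnDl modn_small //.
  by rewrite (leq_ltn_trans (leq_subr _ _)).
- by move=> ?; rewrite modn_small.
Qed.

Lemma to_address_run s r i d rm :
  r < 16 -> i < lim -> related s rm -> rm.1 (rtmp d) = i ->
  let rm' := srun (to_address r d) rm in
  [/\ related s rm', rm'.1 (rtmp d) = (i + off) * 16 + r, rm'.2 = rm.2
    & forall d', d' < d -> rm'.1 (rtmp d') = rm.1 (rtmp d')].
Proof.
case: rm => reg m r16 il rel regd rm'; rewrite /= in regd.
have b1 : (i + off) * 16 + r < 2 ^ w by lia.
have off0 : reg 0 = off by case: rel.
split => //.
- by rewrite /rm' /srun /to_address /=; do 5 apply: related_tmp.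
- have t0 : (0 == rtmp d) = false by rewrite /rtmp; lia.
  have t1 : (d == d.+1) = false by lia.
  have t2 : (d.+1 == d) = false by lia.
  rewrite /rm' /srun /to_address /= /upd !(eqxx, rtmp_neq, t0, t1, t2) regd off0.
  rewrite (@modn_small (i + off)); last by lia.
  rewrite (@modn_small 16); last by lia.
  rewrite (@modn_small ((i + off) * 16)); last by lia.
  rewrite (@modn_small r); last by lia.
  by rewrite modn_small.
- move=> d' dd; rewrite /rm' /srun /to_address /= /upd /= !rtmp_neq.
  have -> : (d' == d) = false by lia.
  by have -> : (d' == d.+1) = false by lia.
Qed.

(** The last clause is the stack discipline: the second operand of an operation is evaluated at
    level [d.+1] and leaves the first one, at level [d], in place. *)
Lemma compile_expr_run e s rm d : expr_ok s e -> related s rm ->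
  let rm' := srun (compile_expr e d) rm in
  [/\ related s rm', rm'.1 (rtmp d) = eval s e, rm'.2 = rm.2
    & forall d', d' < d -> rm'.1 (rtmp d') = rm.1 (rtmp d')].
Proof.
elim: e d rm => [x|c|r e IH|e IH|o e1 IH1 e2 IH2] d rm;
  cbn [compile_expr expr_ok eval].
- case: rm => reg m _ rel; split=> //=.
  + by rewrite /srun /=; do 2 apply: related_tmp.
  + rewrite /srun /= /upd eqxx rvar_rtmp mod0n PeanoNat.Nat.lor_0_r.
    by case: rel.
  + by move=> d' dd; rewrite /srun /= /upd !rtmp_neq; case: eqP dd => //; lia.
- case: rm => reg m cw rel; split=> //=.
  + by rewrite /srun /=; apply: related_tmp.
  + by rewrite /srun /= /upd eqxx modn_small.
  + by move=> d' dd; rewrite /srun /= /upd !rtmp_neq; case: eqP dd => //; lia.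
- move=> [ok r16 il] rel; rewrite !srun_cat.
  have [rel1 v1 m1 k1] := IH d rm ok rel.
  have := to_address_run r16 il rel1 v1.
  move=> [rel2 v2 m2 k2].
  move: rel2 v2 m2 k2; case: (srun (to_address r d) _) => reg m /= rel2 v2 m2 k2.
  split=> //=.
  + by apply: related_tmp.
  + by rewrite /upd eqxx v2; case: rel2 => _ _ _; apply.
  + by rewrite m2 m1.
  + move=> d' dd; rewrite /upd rtmp_neq.
    by rewrite ifF ?k2 ?k1 //; lia.
- move=> [ok il] rel; rewrite !srun_cat.
  have := IH d rm ok rel.
  case: (srun (compile_expr e d) _) => reg m /= [rel1 v1 m1 k1].
  split=> //=.
  + by apply: related_tmp.
  + by rewrite /upd eqxx v1; case: rel1 => _ _ + _; apply.
  + by move=> d' dd; rewrite /upd rtmp_neq ifF ?k1 //; lia.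
- move=> [ok1 ok2 ok] rel; rewrite !srun_cat.
  have [rel1 v1 m1 k1] := IH1 d rm ok1 rel.
  have := IH2 d.+1 _ ok2 rel1.
  case: (srun (compile_expr e2 _) _) => reg m /= [rel2 v2 m2 k2].
  split=> //=.
  + by apply: related_tmp.
  + by rewrite /upd eqxx v2 k2 // v1 op_evalE.
  + by rewrite m2 m1.
  + by move=> d' dd; rewrite /upd rtmp_neq ifF ?k2 ?k1 //; lia.
Qed.

Lemma related_tick s rm : related s rm -> related (tick s) rm.
Proof. by []. Qed.

Lemma exec_tm c s s' : exec c s s' -> tm s <= tm s'.
Proof.
elim=> {c s s'} //=.
- by move=> c1 c2 s1 s2 s3 _ h1 _ h2; exact: leq_trans h1 h2.
- by move=> e c s1 s2 s3 _ _ _ h1 _ h2; apply: leq_trans h2; exact: ltnW.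
Qed.

Definition conf b (rm : (nat -> nat) * (nat -> nat)) := Config b rm.1 rm.2.

Lemma iter_straight_conf P p b rm : all straight p -> code_at P b p ->
  iter (size p) (dstep P) (conf b rm) = conf (b + size p) (srun p rm).
Proof. by case: rm => r m; exact: iter_straight. Qed.

Lemma dstep_jnz P b a l rm : onth P b = Some (IJnz a l) ->
  dstep P (conf b rm) = conf (if rm.1 a != 0 then l else b.+1) rm.
Proof. by move=> h; rewrite /dstep /conf /step h. Qed.

Lemma iter_goto P b l s rm : 0 < w -> code_at P b (goto l) -> related s rm ->
  exists2 rm', related s rm' & iter 2 (dstep P) (conf b rm) = conf l rm'.
Proof.
move=> w0 cp rel; exists (upd rm.1 (rtmp 0) 1, rm.2).
  by apply: related_tmp; case: (rm) rel.
have h0 : onth P b = Some (IConst (rtmp 0) 1) by rewrite -[b]addn0 cp.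
have h1 : onth P b.+1 = Some (IJnz (rtmp 0) l) by rewrite -[b]addn0 -addnS cp.
rewrite /=.
have -> : dstep P (conf b rm) = conf b.+1 (upd rm.1 (rtmp 0) 1, rm.2).
  case: (rm) => r m; rewrite (dstep_straight _ _ _ h0) //= modn_small //.
  by rewrite -{1}(expn0 2) ltn_exp2l.
by rewrite (dstep_jnz _ h1).
Qed.

(* Between two loop iterations every instruction is executed at most once. *)
Lemma compile_run P c s s' b rm : 0 < w -> exec c s s' -> related s rm ->
  code_at P b (compile b c) ->
  exists rm' t, [/\ iter t (dstep P) (conf b rm) =
                      conf (b + size (compile b c)) rm',
    related s' rm' & t <= size (compile b c) * (tm s' - tm s).+1].
Proof.
move=> w0 ex; elim: ex b rm => {c s s'};
  cbn [compile tm setv seta setl].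
- by move=> s b rm rel _; exists rm, 0; rewrite addn0.
- move=> x e s ok b rm rel cp.
  set p := _ ++ _ in cp *.
  exists (srun p rm), (size p); split.
  + by rewrite iter_straight_conf // all_cat straight_expr.
  + rewrite /p srun_cat; have := compile_expr_run 0 ok rel.
    case: (srun (compile_expr e 0) _) => reg m /= [+ v1 m1 k1] => - [/= h1 h2 h3 h4].
    split=> //= y; rewrite /upd rvar_neq rvar_rtmp h1.
    by rewrite -[eqn y x]/(y == x) v1 eqxx mod0n PeanoNat.Nat.lor_0_r.
  + by rewrite subnn muln1.
- move=> r e1 e2 s ok1 ok2 r16 il b rm rel cp.
  set p := _ ++ _ in cp *.
  exists (srun p rm), (size p); split.
  + by rewrite iter_straight_conf // !all_cat !straight_expr.
  + rewrite /p !srun_cat.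
    have [rel1 v1 m1 k1] := compile_expr_run 0 ok1 rel.
    have [rel2 v2 m2 k2] := to_address_run r16 il rel1 v1.
    have := compile_expr_run 1 ok2 rel2.
    case: (srun (compile_expr e2 1) _) => reg m /= [+ v3 m3 k3] => - [/= h1 h2 h3 h4].
    have v0 : reg (rtmp 0) = (eval s e1 + off) * 16 + r by rewrite k3 // v2.
    split=> //= [i io|r' i r'16 il']; rewrite /upd v0 v3.
      by rewrite ifF ?h3 //; lia.
    rewrite h4 // -[eqn r' r]/(r' == r).
    case: (eqVneq r' r) => [->|rr].
      by case: (eqVneq i (eval s e1)) => [->|ni]; rewrite ?eqxx // ifF //; lia.
    by rewrite ifF //; lia.
  + by rewrite subnn muln1.
- move=> e1 e2 s ok1 ok2 il b rm rel cp.
  set p := _ ++ _ in cp *.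
  exists (srun p rm), (size p); split.
  + by rewrite iter_straight_conf // !all_cat !straight_expr.
  + rewrite /p !srun_cat.
    have [rel1 v1 m1 k1] := compile_expr_run 0 ok1 rel.
    have := compile_expr_run 1 ok2 rel1.
    case: (srun (compile_expr e2 1) _) => reg m /= [+ v3 m3 k3] => - [/= h1 h2 h3 h4].
    have v0 : reg (rtmp 0) = eval s e1 by rewrite k3 // v1.
    split=> //= [i io|r' i r'16 il']; rewrite /upd v0 v3.
      by rewrite h3.
    by rewrite ifF ?h4 //; lia.
  + by rewrite subnn muln1.
- move=> c1 c2 s1 s2 s3 x1 IH1 x2 IH2 b rm rel cp.
  have [rm1 [t1 [i1 rel1 le1]]] := IH1 _ _ rel (code_at_catl cp).
  have [rm2 [t2 [i2 rel2 le2]]] := IH2 _ _ rel1 (code_at_catr cp).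
  exists rm2, (t2 + t1); rewrite iterD i1 i2 size_cat addnA; split => //.
  have := exec_tm x1; have := exec_tm x2.
  move: le1 le2; move: (size (compile (b + _) c2)) => a2.
  move: (size (compile b c1)) => a1; nia.
- move=> e c1 c2 s s' ok x IH b rm rel cp.
  have := compile_expr_run 0 ok rel.
  have i0 := iter_straight_conf rm (straight_expr e 0) (code_at_catl cp).
  move: i0 cp; set p := compile_expr e 0 => i0 cp.
  case: (srun _ _) i0 => reg m i0 [rel1 v1 m1 k1].
  move: (code_at_catr cp) => cp1; move: (code_at_catr cp1) => cp2.
  move: (code_at_catr cp2) => cp3; move: (code_at_catr cp3) => /= cp4.
  have hj := dstep_jnz (reg, m) (esym (esym (cp1 0 isT))).
  rewrite addn0 v1 in hj.
  have q1 : (size p).+1 <= size p * (tm s' - tm s).+1 + (tm s' - tm s).+1 by nia.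
  case: (eqVneq (eval s e) 0) x IH hj => [e0|ne0] x IH hj.
    rewrite addn1 in cp2 cp3.
    have [rm2 [t2 [i2 rel2 le2]]] := IH _ _ rel1 (code_at_catl cp2).
    have [rm3 rel3 i3] := iter_goto w0 (code_at_catl cp3) rel2.
    exists rm3, (2 + (t2 + (1 + size p))); split => //.
      rewrite iterD iterD iterD i0 /= hj i2 -/(iter 2 _ _) i3; congr conf.
      by rewrite !size_cat /= ?size_cat /=; lia.
    rewrite !size_cat /= ?size_cat /=.
    move: le2; move: (size (compile _ c1)) => a1.
    move: (size (compile _ c2)) => a2.
    by move: q1; move: (size p) (tm s' - tm s) => pp tt; nia.
  move: cp4; rewrite /= => cp4.
  have e1 : b + size p + 1 + size (compile (b + size p).+1 c2) + 2 =
     (b + size p).+1 + size (compile (b + size p).+1 c2) + 2 by lia.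
  rewrite e1 in cp4.
  have [rm2 [t2 [i2 rel2 le2]]] := IH _ _ rel1 cp4.
  exists rm2, (t2 + (1 + size p)); split => //.
    rewrite iterD iterD i0 /= hj i2; congr conf.
    by rewrite !size_cat /= ?size_cat /=; lia.
  rewrite !size_cat /= ?size_cat /=.
  move: le2; move: (size (compile _ c1)) => a1.
    move: (size (compile _ c2)) => a2.
  by move: q1; move: (size p) (tm s' - tm s) => pp tt; nia.
- move=> e c s ok e0 b rm rel cp.
  have := compile_expr_run 0 ok rel.
  have i0 := iter_straight_conf rm (straight_expr e 0) (code_at_catl cp).
  move: i0 cp; set p := compile_expr e 0 => i0 cp.
  case: (srun _ _) i0 => reg m i0 [rel1 v1 m1 k1].
  move: (code_at_catr cp) => cp1; move: (code_at_catr cp1) => cp2.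
  have hj := dstep_jnz (reg, m) (esym (esym (cp1 0 isT))).
  rewrite addn0 v1 e0 /= in hj.
  rewrite addn1 in cp2.
  have [rm3 rel3 i3] := iter_goto w0 (code_at_catl cp2) rel1.
  exists rm3, (2 + (1 + size p)); split => //.
    rewrite iterD iterD i0 /= hj -/(iter 2 _ _) i3; congr conf.
    by rewrite !size_cat /= ?size_cat /=; lia.
  rewrite !size_cat /= ?size_cat /=; lia.
- move=> e c s1 s2 s3 ok ne0 x1 IH1 x2 IH2 b rm rel cp.
  (* A single pass is charged without the additive one: the tick that opens it makes [tm s2 - tm s1]
     positive and pays for test, body and jump. The charges of successive passes then simply add
     up. *)
  have [rm4 [t4 [i4 rel4 le4]]] : exists rm2 t2,
      [/\ iter t2 (dstep P) (conf b rm) = conf b rm2, related s2 rm2 &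
        t2 <= size (compile b (CWhile e c)) * (tm s2 - tm s1)].
    have := compile_expr_run 0 ok rel.
    have i0 := iter_straight_conf rm (straight_expr e 0) (code_at_catl cp).
    move: i0 cp; set p := compile_expr e 0 => i0 cp.
    case: (srun _ _) i0 => reg m i0 [rel1 v1 m1 k1].
    move: (code_at_catr cp) => cp1; move: (code_at_catr cp1) => cp2.
    move: (code_at_catr cp2) => cp3; move: (code_at_catr cp3) => /= cp4.
    have hj := dstep_jnz (reg, m) (esym (esym (cp1 0 isT))).
    rewrite addn0 v1 ne0 in hj.
    have e1 : b + size p + 1 + 2 = b + size p + 3 by lia.
    rewrite /= e1 in cp3 cp4.
    have [rm2 [t2 [i2 rel2 le2]]] :=
      IH1 _ _ (related_tick rel1) (code_at_catl cp3).
    have [rm3 rel3 i3] := iter_goto w0 cp4 rel2.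
    exists rm3, (2 + (t2 + (1 + size p))); split => //.
      by rewrite iterD iterD iterD i0 /= hj i2 -/(iter 2 _ _) i3.
    have := exec_tm x1; rewrite /= => tm12.
    rewrite !size_cat /= ?size_cat /= -/p.
    have -> : tm s2 - tm s1 = (tm s2 - (tm s1).+1).+1 by lia.
    rewrite /= in le2.
    move: le2; move: (size (compile _ c)) => a1; move: (size p) => pp.
    move: (tm s2 - _) => tt.
    by nia.
  have [rm5 [t5 [i5 rel5 le5]]] := IH2 _ _ rel4 cp.
  exists rm5, (t5 + t4); split => //.
    by rewrite iterD i4 i5.
  have := exec_tm x1; have := exec_tm x2; rewrite /= => tm23 tm12.
  have -> : (tm s3 - tm s1).+1 = (tm s2 - tm s1) + (tm s3 - tm s2).+1 by lia.
  by rewrite mulnDr addnC; apply: leq_add.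
Qed.

End Language.

(** * Programs without random choices *)

Definition nonrandom (i : instr) : bool :=
  if i is IRand _ then false else true.

Lemma nonrandom_expr e d : all nonrandom (compile_expr e d).
Proof. by apply: sub_all (straight_expr e d); case. Qed.

Lemma nonrandom_compile b c : all nonrandom (compile b c).
Proof.
elim: c b => //= [x e|r e1 e2|e1 e2|c1 IH1 c2 IH2|e c1 IH1 c2 IH2|e c IH] b;
  by rewrite ?all_cat /= ?all_cat /= ?nonrandom_expr ?IH1 ?IH2 ?IH.
Qed.

Section Deterministic.

Variables (w : nat) (P : program).
Hypothesis detP : all nonrandom P.

Lemma step_nonrandom c u : step w P c u = dstep w P c.
Proof.
case: c => i r m; rewrite /dstep /step.
case e : (onth P i) => [j|] //; case: j e => // d e.
have iP : i < size P by rewrite -onthTE e.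
have /(all_nthP (IRand d)) /(_ i iP) := detP.
by rewrite (onth_nth _ _ _ _ e).
Qed.

Lemma run_nonrandom c (u : seq 'I_(2 ^ w)) :
  run P c u = iter (size u) (dstep w P) c.
Proof.
elim: u c => //= x u IH c; rewrite -iterS iterSr -IH /run /=.
by rewrite step_nonrandom.
Qed.

Lemma dstep_halted c : halted P c -> dstep w P c = c.
Proof. by case: c => i r m h; rewrite /dstep /step onth_default. Qed.

Lemma iter_halted t c : halted P c -> iter t (dstep w P) c = c.
Proof. by move=> h; elim: t => //= t ->; exact: dstep_halted. Qed.

(** The distribution of the running time is a point mass at the first halting time [T], so both
    series reduce to one term. *)
Lemma computes_nonrandom (R : realType) c (Q : config -> Prop) t (B : nat) :
  halted P (iter t (dstep w P) c) -> Q (iter t (dstep w P) c) -> t <= B ->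
  computes_in_expected_time w P c Q (B%:R : R)%R.
Proof.
move=> ht Qt tB.
have ex : exists t, halted P (iter t (dstep w P) c) by exists t.
case: (ex_minnP ex) => T hT minT.
have TB : T <= B by apply: leq_trans tB; apply: minT.
have same t' : T <= t' -> iter t' (dstep w P) c = iter T (dstep w P) c.
  by move=> Tt; rewrite -(subnK Tt) iterD iter_halted.
have halts t' : halted P (iter t' (dstep w P) c) -> T <= t' by apply: minT.
have w0 : 0 < 2 ^ w by rewrite expn_gt0.
have pmf t' : time_pmf R w P c t' = (t' == T)%:R%R.
  rewrite /time_pmf.
  have -> : #|[set u : t'.-tuple 'I_(2 ^ w) | halts_at P c u]| =
            (t' == T) * #|{: t'.-tuple 'I_(2 ^ w)}|.
    case: (eqVneq t' T) => [->|ne]; rewrite ?mul1n ?mul0n.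
      rewrite -cardsT; apply: eq_card => u; rewrite !inE /halts_at.
      rewrite run_nonrandom size_tuple hT /=; apply/forallP => s.
      rewrite run_nonrandom size_take size_tuple ltn_ord.
      by apply/negP => /halts; rewrite leqNgt ltn_ord.
    (* For [t' <> T] one conjunct of [halts_at] fails: a shorter run has not halted, a longer one
       has a halted prefix of length [T]. *)
    apply/eqP; rewrite cards_eq0; apply/eqP/setP => u; rewrite !inE.
    apply/negP; rewrite /halts_at run_nonrandom size_tuple => /andP[h1 h2].
    have Tt : T < t' by rewrite ltn_neqAle eq_sym ne halts.
    have := forallP h2 (Ordinal Tt).
    by rewrite run_nonrandom size_take size_tuple Tt /= hT.
  rewrite natrM -mulrA divff ?mulr1 // pnatr_eq0 -lt0n card_tuple card_ord.
  by rewrite expn_gt0 w0.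
have series (f : nat -> R) : (forall t, 0 <= f t)%R ->
   (\sum_(0 <= t <oo) (f t * time_pmf R w P c t)%:E = (f T)%:E)%E.
  move=> f0; rewrite (@nneseriesD1 _ _ T xpredT) //; last first.
    by move=> k _; rewrite lee_fin mulr_ge0 // pmf ler0n.
  rewrite pmf eqxx mulr1 eseries0 ?adde0 // => i _ ne.
  by rewrite pmf (negbTE ne) mulr0.
split.
- by under eq_eseriesr do rewrite -[time_pmf _ _ _ _ _]mul1r; rewrite series.
- by rewrite (series (fun t => t%:R)%R) // lee_fin ler_nat.
- by move=> u; rewrite run_nonrandom => /halts /same ->; rewrite -(same t) ?halts.
Qed.

End Deterministic.

(** * First and next positions satisfying a predicate *)

(* The least [j] with [1 <= j <= b] and [A j], or [0] if there is none. *)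
Fixpoint first_in (A : pred nat) (b : nat) : nat :=
  if b is b'.+1 then
    if first_in A b' != 0 then first_in A b' else if A b then b else 0
  else 0.

Lemma first_in0 A b :
  (first_in A b == 0) = ~~ has A (iota 1 b).
Proof.
elim: b => // b IH; rewrite -addn1 iotaD has_cat negb_or -IH addn1 /=.
rewrite add1n orbF; case: (first_in A b =P 0) => [-> /=|/eqP /negbTE //].
by case: (A b.+1).
Qed.

Lemma first_in_neq0 A b :
  first_in A b != 0 ->
  [/\ A (first_in A b), 0 < first_in A b <= b &
      forall j, 0 < j -> A j -> first_in A b <= j].
Proof.
elim: b => // b IH /=.
case: (first_in A b =P 0) => [f0 /=|/eqP f0 /=].
  case: ifP => // Ab _; split=> //; first by rewrite ltnS leqnn.
  move=> j j0 Aj; rewrite ltnNge; apply/negP => jb.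
  move/eqP: f0; rewrite first_in0 => /hasPn /(_ j).
  by rewrite mem_iota j0 add1n ltnS jb Aj => /(_ isT).
move=> _; have [h1 /andP[h2 h3] h4] := IH f0; split => //.
by rewrite h2 (leq_trans h3).
Qed.

Lemma first_in_mem (A : pred nat) b j : 0 < j <= b -> A j -> first_in A b != 0.
Proof.
move=> jb Aj; rewrite first_in0 negbK; apply/hasP; exists j => //.
by rewrite mem_iota add1n ltnS.
Qed.

(** This identifies a table entry produced by a scan up to [i] with a first occurrence defined by a
    search up to [n]. *)
Lemma first_in_stable (A : pred nat) b i : 0 < i <= b -> A i -> first_in A b = first_in A i.
Proof.
move=> /andP[i0]; elim: b => [|b IH]; first by case: i i0.
rewrite leq_eqVlt => /orP[/eqP -> //|]; rewrite ltnS => ib Ai /=.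
by rewrite (first_in_mem _ Ai) ?i0 // IH.
Qed.

Lemma first_in_skip (A : pred nat) b : ~~ A b.+1 -> first_in A b.+1 = first_in A b.
Proof. by move=> /= /negbTE ->; case: eqP => //= ->. Qed.

Lemma eq_first_in (A B : pred nat) b : A =1 B -> first_in A b = first_in B b.
Proof. by move=> AB; elim: b => //= b ->; rewrite AB. Qed.

(* The least [j >= i] with [j <= n] and [A j], or [n + 1] if there is none. *)
Definition next_in (A : pred nat) (n i : nat) : nat :=
  i + find A (iota i (n.+1 - i)).

Lemma next_in_end A n : next_in A n n.+1 = n.+1.
Proof. by rewrite /next_in subnn addn0. Qed.

Lemma next_in_step (A : pred nat) n i : i <= n ->
  next_in A n i = if A i then i else next_in A n i.+1.
Proof.
move=> ni; rewrite /next_in subSn //= subSS; case: ifP => _.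
  by rewrite addn0.
by rewrite addnS.
Qed.

Lemma next_in_ge A n i : i <= next_in A n i.
Proof. exact: leq_addr. Qed.

Lemma next_in_le A n i : i <= n.+1 -> next_in A n i <= n.+1.
Proof.
move=> ni; rewrite /next_in; have := find_size A (iota i (n.+1 - i)).
by rewrite size_iota; lia.
Qed.

Lemma next_in_mem A n i : next_in A n i <= n -> A (next_in A n i).
Proof.
rewrite /next_in => h.
have hs : find A (iota i (n.+1 - i)) < n.+1 - i.
  have := find_size A (iota i (n.+1 - i)); rewrite size_iota; lia.
have := @nth_find _ 0 A (iota i (n.+1 - i)).
by rewrite nth_iota // has_find size_iota; apply.
Qed.

Lemma next_in_min A n i j : i <= j -> j < next_in A n i -> ~~ A j.
Proof.
rewrite /next_in => ij jn.
have hs := find_size A (iota i (n.+1 - i)); rewrite size_iota in hs.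
have h : j - i < find A (iota i (n.+1 - i)) by lia.
have := @before_find _ 0 A (iota i (n.+1 - i)) _ h.
rewrite nth_iota; last by lia.
by rewrite subnKC // => ->.
Qed.

Lemma decode M l f : f < M -> ((l * M + f) %/ M = l) * ((l * M + f) %% M = f).
Proof.
by move=> fM; rewrite divnMDl ?modnMDl ?divn_small ?modn_small ?addn0 //; lia.
Qed.

(** * The reduced set cover instance *)

Section Reduction.

Variables (n K : nat) (S : seq nat) (cand : pred nat) (C : nat -> nat).

Definition sub (l i : nat) : seq nat := take l (drop i.-1 S).

(** The candidate [p] dominates [q]: it can replace [q] in any attractor. It depends on [q] alone,
    not on the substring, which makes the replacement a map on positions. *)
Definition same_context : Prop :=
  forall q, 0 < q <= n -> exists2 p, cand p &
    forall i l, 0 < i -> i + l <= n.+1 -> l <= K -> i <= q < i + l ->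
    exists i', [/\ 0 < i', i' + l <= n.+1, i' <= p < i' + l
                 & sub l i' = sub l i].

Definition start (i : nat) : bool :=
  [&& 0 < i, i <= n, next_in cand n i < i + K & next_in cand n i <= n].

Definition valid (l i : nat) : bool := start i && (i + l <= n.+1).

(* [F l i] is the first start at which the length-[l] substring at [i]
   occurs. *)
Fixpoint F (l i : nat) : nat :=
  if l is l'.+1 then
    if valid l i then
      first_in (fun j => [&& valid l j, F l' j == F l' i
                           & C (j + l') == C (i + l')]) n
    else 0
  else if start i then n.+1 else 0.

Hypothesis sizeS : size S = n.
Hypothesis cand_in : forall p, cand p -> 0 < p <= n.
Hypothesis C_char : forall i j, 0 < i <= n -> 0 < j <= n ->
  (C i == C j) = (nth 0 S i.-1 == nth 0 S j.-1).
Hypothesis cand_context : same_context.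

Lemma startP i : reflect (0 < i <= n /\ exists2 p, cand p & i <= p < i + K)
                         (start i).
Proof.
apply: (iffP and4P) => [[i0 ni h1 h2]|[/andP[i0 ni] [p cp /andP[ip pK]]]].
  split; first by rewrite i0.
  exists (next_in cand n i); first exact: next_in_mem.
  by rewrite next_in_ge.
have np : next_in cand n i <= p.
  by rewrite leqNgt; apply: contraL cp; apply: next_in_min.
split=> //; first exact: leq_ltn_trans np pK.
by apply: leq_trans np _; case/andP: (cand_in cp).
Qed.

Lemma start_in i : start i -> 0 < i <= n.
Proof. by case/startP. Qed.

Lemma sub_size l i : 0 < i -> i + l <= n.+1 -> size (sub l i) = l.
Proof. by move=> i0 il; rewrite size_take size_drop sizeS; case: ifP; lia. Qed.

Lemma subS l i : 0 < i -> i + l.+1 <= n.+1 ->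
  sub l.+1 i = rcons (sub l i) (nth 0 S (i + l).-1).
Proof.
move=> i0 il; rewrite /sub (take_nth 0) ?size_drop ?sizeS; last by lia.
by rewrite nth_drop; congr (rcons _ (nth _ _ _)); lia.
Qed.

Lemma valid_le l l' i : l' <= l -> valid l i -> valid l' i.
Proof. by rewrite /valid => ll /andP[-> /=]; lia. Qed.

(** Induction on the length: the search defining [F] compares the class of the prefix and the name
    of the last character, and together these determine the substring. *)
Lemma F_sub l i j : valid l i -> valid l j ->
  (F l i == F l j) = (sub l i == sub l j).
Proof.
elim: l i j => [|l IH] i j vi vj /=.
  by case/andP: vi => -> _; case/andP: vj => -> _; rewrite /sub !take0 !eqxx.
rewrite vi vj.
have eqv a b : valid l.+1 a -> valid l.+1 b ->
   (F l a == F l b) && (C (a + l) == C (b + l)) = (sub l.+1 a == sub l.+1 b).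
  move=> va vb.
  have va' := valid_le (leqnSn l) va; have vb' := valid_le (leqnSn l) vb.
  case/andP: va vb => sa al /andP[sb bl].
  have := start_in sa; have := start_in sb => ? ?.
  rewrite IH // C_char; [|lia|lia].
  by rewrite !subS ?eqseq_rcons //; lia.
have mem a : valid l.+1 a ->
  first_in (fun j0 => [&& valid l.+1 j0, F l j0 == F l a
     & C (j0 + l) == C (a + l)]) n != 0.
  move=> va; apply: (@first_in_mem _ _ a); last by rewrite va !eqxx.
  by case/andP: va => /start_in.
have [/and3P[v1 a1 b1] _ m1] := first_in_neq0 (mem i vi).
have [/and3P[v2 a2 b2] _ m2] := first_in_neq0 (mem j vj).
have e1 : sub l.+1 (first_in (fun j0 => [&& valid l.+1 j0, F l j0 == F l i
     & C (j0 + l) == C (i + l)]) n) = sub l.+1 i.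
  by apply/eqP; rewrite -eqv // a1 b1.
have e2 : sub l.+1 (first_in (fun j0 => [&& valid l.+1 j0, F l j0 == F l j
     & C (j0 + l) == C (j + l)]) n) = sub l.+1 j.
  by apply/eqP; rewrite -eqv // a2 b2.
apply/eqP/eqP => [e|e].
  by rewrite -e1 -e2 e.
apply: eq_first_in => a; case va: (valid l.+1 a) => //=.
by rewrite !eqv // e.
Qed.

Lemma F_spec l i : 0 < l -> valid l i ->
  [/\ valid l (F l i), sub l (F l i) = sub l i, 0 < F l i <= i
    & forall j, valid l j -> sub l j = sub l i -> F l i <= j].
Proof.
case: l => // l _ vi; have := erefl (F l.+1 i); rewrite {2}/F -/F vi.
set A := fun j => _ => Fi.
have eqv a : valid l.+1 a -> A a = (sub l.+1 a == sub l.+1 i).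
  move=> va; rewrite /A va /=.
  have va' := valid_le (leqnSn l) va; have vi' := valid_le (leqnSn l) vi.
  case/andP: (va) => sa al; case/andP: (vi) => si il.
  have := start_in sa; have := start_in si => ? ?.
  rewrite F_sub // C_char; [|lia|lia].
  by rewrite !subS ?eqseq_rcons //; lia.
have Ai : A i by rewrite /A vi !eqxx.
have iin : 0 < i <= n by case/andP: vi => /start_in.
have [h1 /andP[h2 _] h3] := first_in_neq0 (first_in_mem iin Ai).
rewrite Fi; case/and3P: (h1) => v _ _; split => //.
- by apply/eqP; rewrite -eqv.
- by rewrite h2 h3 //; case/andP: iin.
- move=> j vj e; apply: h3; last by rewrite eqv // e.
  by case/andP: vj => /start_in /andP[].
Qed.

Lemma F_neq0 l i : 0 < l -> (F l i != 0) = valid l i.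
Proof.
move=> l0; case vi: (valid l i).
  by have [_ _ + _] := F_spec l0 vi; case: (F l i).
by case: l l0 vi => // l _ /= ->.
Qed.

Lemma F_idem l i : 0 < l -> valid l i -> F l (F l i) = F l i.
Proof.
move=> l0 vi; have [v e _ _] := F_spec l0 vi.
by apply/eqP; rewrite F_sub // e.
Qed.

Lemma F_le l i : 0 < l -> F l i <= i.
Proof.
move=> l0; case vi: (valid l i).
  by have [_ _ /andP[]] := F_spec l0 vi.
by move/negbT: vi; rewrite -F_neq0 // negbK => /eqP ->.
Qed.

Lemma F_lt l i : F l i < n.+2.
Proof.
case: l => [|l]; first by rewrite /=; case: ifP.
case vi: (valid l.+1 i).
  have [_ _ /andP[_ h] _] := F_spec (isT : 0 < l.+1) vi.
  by case/andP: vi => /start_in; lia.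
by rewrite /= vi.
Qed.

Lemma sub_take l l' i : l' <= l -> sub l' i = take l' (sub l i).
Proof. by move=> ll; rewrite /sub take_takel. Qed.

Lemma F_prefix l l' i j : l' <= l -> valid l i -> valid l j ->
  F l i = F l j -> F l' i = F l' j.
Proof.
move=> ll vi vj /eqP; rewrite F_sub // => /eqP e.
by apply/eqP; rewrite F_sub ?(valid_le ll) // !(sub_take _ ll) e.
Qed.

(* At length [l] the occurrence at [i] leaves the class it shared with earlier
   starts and becomes the first of its class, or runs past the end of [S]. *)
Definition event (l i : nat) : bool :=
  [&& start i, F l.-1 i != 0, F l.-1 i != i & (F l i == 0) || (F l i == i)].

(** An event at [i] shows that the class [F l.-1 i] branches. The child that continues its first
    occurrence keeps that number, and a new child gets the number [i]. If [i] runs past the end, no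
    class of length [l] has the number [i] and the second mark is harmless. *)
Definition marked (l f : nat) : bool :=
  has (fun i => event l i && ((f == F l.-1 i) || (f == i))) (iota 1 n).

Lemma marked_event l i : event l i -> marked l (F l.-1 i) /\ marked l i.
Proof.
move=> ev; have /andP[i0 ni] : 0 < i <= n by apply: start_in; case/and4P: ev.
by split; apply/hasP; exists i; rewrite ?mem_iota ?add1n ?ltnS ?i0 ?ni //= ev eqxx ?orbT.
Qed.

(* If the class of [i] is not marked at length [l], then every occurrence of
   its prefix of length [l - 1] extends to an occurrence of the whole string:
   the least occurrence that does not extend would be an event. *)
Lemma unmarked_extends l i j : 0 < l -> valid l i -> ~~ marked l (F l i) ->
  start j -> F l.-1 j = F l.-1 i -> F l j = F l i.
Proof.
move=> l0 vi nm sj ej; have [vf ef fi minf] := F_spec l0 vi.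
have idf := F_idem l0 vi.
move: fi idf vf ef minf nm; set f := F l i => fi idf vf ef minf nm.
have pf : F l.-1 f = F l.-1 i.
  by apply: (@F_prefix l); rewrite ?leq_pred ?idf.
have h0 : F l.-1 i != 0.
  case: l l0 vi {nm ej pf f idf vf ef minf fi} => // [[|l]] _ vi /=.
    by case/andP: vi => -> _.
  by rewrite -/(F l.+1 i) F_neq0 // (valid_le _ vi).
(* The first occurrence of the whole string is also the first of its prefix; otherwise [f] itself
   would be an event and mark its class. *)
have hf : F l.-1 f = f.
  apply/eqP; apply: contraNT nm => ne.
  have /marked_event [] // : event l f.
  rewrite /event pf h0 idf eqxx orbT -pf ne.
  by case/andP: vf => ->.
have [m jm] : exists m, j < m by exists j.+1.
elim: m j jm sj ej => // m IH j jm sj ej.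
apply/eqP; apply: contraNT nm => ne.
have nej : F l.-1 j != j.
  by apply/eqP => ejj; move: ne; rewrite -{1}ejj ej -pf hf idf eqxx.
have /marked_event [] : event l j; last by rewrite ej -pf hf.
rewrite /event sj ej h0 -ej nej /=.
case vj: (valid l j); last first.
  by move/negbT: vj; rewrite -F_neq0 // negbK => ->.
have [vg eg /andP[g0 gj] ming] := F_spec l0 vj.
rewrite (negbTE (lt0n_neq0 g0)) /= eqn_leq gj /= leqNgt; apply/negP => lt.
(* If [F l j < j], this smaller start shares the prefix, so by induction it belongs to the class
   [F l i]; then so does [j], against [ne]. *)
have pg : F l.-1 (F l j) = F l.-1 i.
  by rewrite -ej; apply: (@F_prefix l); rewrite ?leq_pred ?F_idem.
have sg : start (F l j) by case/andP: vg.
have := IH (F l j) (leq_trans lt jm) sg pg.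
by rewrite F_idem // => e; rewrite e eqxx in ne.
Qed.

Definition occurs_across (l f p : nat) : bool :=
  has (fun i => [&& start i, F l i == f, i <= p & p < i + l]) (iota 1 n).

Lemma occurs_acrossP l f p :
  reflect (exists2 i, start i & [/\ F l i = f, i <= p & p < i + l])
          (occurs_across l f p).
Proof.
apply: (iffP hasP) => [[i _ /and4P[si /eqP e ip pl]]|[i si [e ip pl]]].
  by exists i.
exists i; last by rewrite si e eqxx ip.
by rewrite mem_iota add1n ltnS; exact: start_in.
Qed.

Definition element (l f : nat) : bool :=
  [&& 0 < l, l <= K, f != 0 & marked l f].

Definition incident (l f p : nat) : bool :=
  [&& element l f, cand p & occurs_across l f p].

(** It is enough to apply [same_context] to [q := i], since a nonempty substring meets its own first
    position. *)
Lemma context_start i l : 0 < i -> i + l <= n.+1 -> 0 < l <= K ->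
  exists i' p, [/\ cand p, valid l i', i' <= p < i' + l & sub l i' = sub l i].
Proof.
move=> i0 il /andP[l0 lK].
have [|p cp /(_ i l)] := cand_context (q := i); first by rewrite i0; lia.
case=> //; first by lia.
move=> i' [i'0 il' ip e]; exists i', p; split=> //.
rewrite /valid il' andbT; apply/startP; split; first by lia.
by exists p => //; lia.
Qed.

(** * Hitting the elements is equivalent to covering the substrings *)

Section Cover.

Variable G : seq nat.
Hypothesis G_hits : forall l f p, incident l f p ->
  exists2 p', p' \in G & incident l f p'.

(** Induction on the length. A marked class is hit by assumption; for an unmarked one, the
    occurrence of the prefix that is hit extends to the whole string by [unmarked_extends], and the
    same position still lies inside it. *)
Lemma cover_valid l i : 0 < l <= K -> valid l i ->
  exists p i', [/\ p \in G, start i', F l i' = F l i & i' <= p < i' + l].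
Proof.
elim: l i => // l IH i /andP[l0 lK] vi.
have [m|nm] := boolP (marked l.+1 (F l.+1 i)).
  case/andP: (vi) => si il.
  have /andP[i0 _] := start_in si.
  have [i' [p [cp vi' ip e]]] := context_start i0 il (introT andP (conj l0 lK)).
  have Fi : F l.+1 i' = F l.+1 i by apply/eqP; rewrite F_sub // e.
  have inc : incident l.+1 (F l.+1 i) p.
    rewrite /incident /element lK m cp F_neq0 // vi /=.
    by apply/occurs_acrossP; exists i'; [case/andP: vi' | case/andP: ip].
  have [p' pG /and3P[_ _ /occurs_acrossP[i2 s2 [e2 h1 h2]]]] := G_hits inc.
  by exists p', i2; split => //; rewrite h1.
(* No prefix is left at length one, but such a class is always marked: the empty string has class
   [n.+1], which differs from every start, so the first occurrence is an event. *)
case: l IH l0 lK vi nm => [|l] IH _ lK vi nm.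
  have [_ _ /andP[f0 fi] _] := F_spec (isT : 0 < 1) vi.
  have [vf _ _ _] := F_spec (isT : 0 < 1) vi.
  have idf := F_idem (isT : 0 < 1) vi.
  case/andP: (vf) => sf _; have /andP[_ fn] := start_in sf.
  have /marked_event [_ m] : event 1 (F 1 i).
    rewrite /event idf eqxx orbT sf [F 1.-1 _]/= sf /= andbT.
    by rewrite neq_ltn ltnS fn orbT.
  by rewrite m in nm.
have [||p [i' [pG si' e ip]]] := IH i; rewrite ?(ltnW lK) //.
  exact: valid_le vi.
exists p, i'; split=> //; last by lia.
exact: unmarked_extends.
Qed.

End Cover.

(** A choice function [phi] sends every position to a candidate dominating it; the image of [D],
    with duplicates removed, is a hitting set no larger than [D]. *)
Lemma hits_of_cover (D : seq nat) :
  (forall x, x \in D -> 0 < x <= n) ->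
  (forall i l, 0 < i -> i + l <= n.+1 -> 0 < l <= K -> exists i' x,
     [/\ 0 < i', i' + l <= n.+1, sub l i' = sub l i, x \in D
       & i' <= x < i' + l]) ->
  exists G : seq nat,
  [/\ uniq G, all cand G, size G <= size D
    & forall l f p, incident l f p -> exists2 p', p' \in G & incident l f p'].
Proof.
move=> Din Dcov.
have [phi phiP] : exists phi : nat -> nat, forall q, 0 < q <= n ->
    cand (phi q) /\ forall i l, 0 < i -> i + l <= n.+1 -> l <= K ->
    i <= q < i + l -> exists i', [/\ 0 < i', i' + l <= n.+1,
      i' <= phi q < i' + l & sub l i' = sub l i].
  have /boolp.choice [phi h] : forall q, exists p, 0 < q <= n ->
      cand p /\ forall i l, 0 < i -> i + l <= n.+1 -> l <= K ->
      i <= q < i + l -> exists i', [/\ 0 < i', i' + l <= n.+1,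
      i' <= p < i' + l & sub l i' = sub l i].
    move=> q; case: (boolP (0 < q <= n)) => [h|h]; last by exists 0.
    by have [p cp hp] := cand_context h; exists p.
  by exists phi.
exists (undup (map phi D)); split.
- exact: undup_uniq.
- apply/allP => p; rewrite mem_undup => /mapP[x xD ->].
  by have [] := phiP _ (Din _ xD).
- by rewrite (leq_trans (size_undup _)) // size_map.
move=> l f p /and3P[el _ /occurs_acrossP[i si [e ip pl]]].
case/and4P: (el) => l0 lK f0 m.
have vi : valid l i by rewrite -F_neq0 // e.
case/andP: (vi) => _ il; have /andP[i0 _] := start_in si.
have [i1 [x [i10 i1l e1 xD ix]]] := Dcov i l i0 il (introT andP (conj l0 lK)).
have [cp /(_ i1 l i10 i1l lK ix) [i2 [i20 i2l i2p e2]]] := phiP _ (Din _ xD).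
exists (phi x); first by rewrite mem_undup map_f.
rewrite /incident el cp /=; apply/occurs_acrossP; exists i2.
  apply/startP; split; first by lia.
  by exists (phi x) => //; lia.
split; [|lia|lia].
have v2 : valid l i2.
  rewrite /valid i2l andbT; apply/startP; split; first by lia.
  by exists (phi x) => //; lia.
by rewrite -e; apply/eqP; rewrite F_sub // e2 e1.
Qed.

(** An earlier occurrence of the longer string would contain an earlier occurrence of its prefix. So
    a start that is first of its class stays first until it runs past the end. *)
Lemma event_stays l i : 0 < l -> (F l i == 0) || (F l i == i) ->
  (F l.+1 i == 0) || (F l.+1 i == i).
Proof.
move=> l0 h; case v: (valid l.+1 i); last first.
  by move/negbT: v; rewrite -F_neq0 // negbK => ->.
have vl := valid_le (leqnSn l) v.
move: h; rewrite (negbTE (_ : F l i != 0)) ?F_neq0 //= => /eqP e.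
have [vf ef /andP[_ fi] _] := F_spec (isT : 0 < l.+1) v.
have eqF : F l (F l.+1 i) = i.
  by rewrite -[RHS]e; apply: (@F_prefix l.+1) => //; apply: F_idem.
have := F_le (F l.+1 i) l0; rewrite eqF => le.
by apply/orP; right; apply/eqP/anti_leq; rewrite fi le.
Qed.

Lemma event_uniq l l' i : 0 < l -> event l i -> l < l' -> ~~ event l' i.
Proof.
move=> l0 /and4P[_ _ _ h] ll; apply/negP => /and4P[_ n0 ni _].
have : (F l'.-1 i == 0) || (F l'.-1 i == i).
  have le : l <= l'.-1 by lia.
  move: (l'.-1) le => m; elim: m => [|m IH]; first by lia.
  rewrite leq_eqVlt => /orP[/eqP <- //|lm]; apply: event_stays; first by lia.
  exact: IH.
by rewrite (negbTE n0) (negbTE ni).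
Qed.

(** Every start is [p - d] for some candidate [p] and some [d < K]. *)
Lemma starts_bound :
  count start (iota 1 n) <= count cand (iota 1 n) * K.
Proof.
rewrite -!size_filter.
pose s := [seq p - d | p <- [seq p <- iota 1 n | cand p], d <- iota 0 K].
have <- : size s = size [seq p <- iota 1 n | cand p] * K.
  by rewrite size_allpairs size_iota.
apply: uniq_leq_size; first by rewrite filter_uniq // iota_uniq.
move=> i; rewrite mem_filter => /andP[/startP[iin [p cp ip]] _].
apply/allpairsP; exists (p, p - i); split=> /=.
- by rewrite mem_filter cp mem_iota add1n ltnS cand_in.
- by rewrite mem_iota; lia.
- by lia.
Qed.

Variable M : nat.
Hypothesis M_gt : n.+1 < M.

(** Elements are coded as single numbers [l * M + f] in order to index arrays; class numbers stay
    below [M], so the code can be decoded. *)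
Definition inc (e p : nat) : bool := incident (e %/ M) (e %% M) p.

Lemma inc_cand e p : inc e p -> cand p.
Proof. by case/and3P. Qed.

(** Each start has an event at one length at most, by [event_uniq], and an event marks two
    classes. *)
Lemma elements_bound (E : seq nat) :
  uniq E -> (forall e, e \in E -> exists p, inc e p) -> size E <= n + n.
Proof.
move=> uE hE.
(* The only length at which [i] has an event; the successor turns an index into [iota 1 K] into a
   length. *)
pose lev i := (find (fun l => event l i) (iota 1 K)).+1.
have levE l i : 0 < l <= K -> event l i -> lev i = l.
  move=> /andP[l0 lK] ev.
  have hs : has (fun l => event l i) (iota 1 K).
    by apply/hasP; exists l => //; rewrite mem_iota l0 add1n ltnS.
  have fK : find (fun l => event l i) (iota 1 K) < K.
    by move: hs; rewrite has_find size_iota.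
  have := nth_find 0 hs; rewrite nth_iota // add1n -/(lev i) => ev'.
  case: (ltngtP (lev i) l) => // lt.
    by have := event_uniq (isT : 0 < lev i) ev' lt; rewrite ev.
  by have := event_uniq l0 ev lt; rewrite ev'.
pose s := [seq lev i * M + F (lev i).-1 i | i <- iota 1 n] ++
          [seq lev i * M + i | i <- iota 1 n].
have -> : n + n = size s by rewrite size_cat !size_map size_iota.
apply: uniq_leq_size => // e /hE [p /and3P[/and4P[l0 lK f0 /hasP[i iin]]]].
move=> /andP[ev ef] _ _; rewrite mem_cat.
have le := levE _ _ (introT andP (conj l0 lK)) ev.
case/orP: ef => /eqP ef; apply/orP; [left|right];
  apply/mapP; exists i => //; rewrite le -ef; exact: divn_eq.
Qed.

(** An occurrence of length [l] across [p] begins at [p - d] with [d < l], and this fixes its class;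
    summing [l] up to [K] gives the triangular number. *)
Lemma degree_bound (E : seq nat) p :
  uniq E -> (forall e, e \in E -> inc e p) -> size E <= (K * K.+1) %/ 2.
Proof.
move=> uE hE.
pose s := [seq l * M + F l (p - d) | l <- iota 1 K, d <- iota 0 l].
have ss : size s = (K * K.+1) %/ 2.
  rewrite /s size_allpairs_dep.
  have -> : [seq size (iota 0 x) | x <- iota 1 K] = iota 1 K.
    by rewrite -[RHS]map_id; apply: eq_map => x; rewrite size_iota.
  elim: {uE hE s} K => // k IH.
  by rewrite -{1}[k.+1]addn1 iotaD sumn_cat IH /= addn0 add1n; lia.
rewrite -ss; apply: uniq_leq_size => // e /hE.
move=> /and3P[/and4P[l0 lK f0 _] _ /occurs_acrossP[i si [ef ip pl]]].
apply/allpairsPdep; exists (e %/ M), (p - i); split.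
- by rewrite mem_iota l0 add1n ltnS.
- by rewrite mem_iota /=; lia.
- by rewrite subKn // ef; exact: divn_eq.
Qed.

End Reduction.

(** * Windows, character names and the greedy potential *)

Section Windows.

Variables (n K sigma : nat) (S : seq nat).
Hypothesis sizeS : size S = n.
Hypothesis K_gt0 : 0 < K.
Hypothesis S_in : forall a, a \in S -> 1 <= a <= sigma.

(** The first [i] characters, lowered by one, as a number in base [sigma]. Its residue modulo
    [sigma ^ L] stores the last [L] of them. *)
Fixpoint prefix_code (i : nat) : nat :=
  if i is i'.+1 then prefix_code i' * sigma + (nth 0 S i').-1 else 0.

Lemma prefix_code_window L i j : L <= i <= n -> L <= j <= n ->
  prefix_code i = prefix_code j %[mod sigma ^ L] ->
  forall d, d < L -> nth 0 S (i - d.+1) = nth 0 S (j - d.+1).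
Proof.
elim: L i j => // L IH [|i] [|j] // /andP[Li il] /andP[Lj jl] e.
have /andP[i1 is_] : 1 <= nth 0 S i <= sigma.
  by apply: S_in; rewrite mem_nth // sizeS.
have /andP[j1 js] : 1 <= nth 0 S j <= sigma.
  by apply: S_in; rewrite mem_nth // sizeS.
have s0 : 0 < sigma by lia.
have e1 : (nth 0 S i).-1 = (nth 0 S j).-1.
  have h : prefix_code i.+1 = prefix_code j.+1 %[mod sigma].
    have sd : sigma %| sigma ^ L.+1 by rewrite expnS dvdn_mulr.
    by rewrite -(modn_dvdm _ sd) e modn_dvdm.
  by move: h; rewrite /= !modnMDl !modn_small //; lia.
move=> [|d] dL; first by rewrite !subn1 /=; lia.
rewrite !subSS; apply: IH => //; [lia|lia|].
move/eqP: e; rewrite /= e1 eqn_modDr expnSr -!muln_modl.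
by rewrite eqn_pmul2r // => /eqP.
Qed.

Definition window_end (p : nat) : nat := p + K - 1.

(* Position [p] is redundant if the window of radius [K - 1] around it occurs
   further to the left. *)
Definition redundant (p : nat) : bool :=
  [&& K <= p, window_end p <= n &
   has (fun j => prefix_code j %% sigma ^ (K + K - 1) ==
                 prefix_code (window_end p) %% sigma ^ (K + K - 1))
       (iota (K + K - 1) (window_end p - (K + K - 1)))].

Definition window_cand (p : nat) : bool := [&& 0 < p, p <= n & ~~ redundant p].

(** Substrings of length at most [K] across [q] lie in the window of radius [K - 1] around it. A
    redundant [q] can be moved to the centre of an earlier equal window, and repeated moves to the
    left end at a candidate. *)
Lemma window_cand_context : same_context n K S window_cand.
Proof.
move=> q; elim/ltn_ind: q => q IH qn.
have [rq|nrq] := boolP (redundant q); last first.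
  exists q; first by rewrite /window_cand nrq; case/andP: qn => -> ->.
  by move=> i l i0 il lK iq; exists i.
case/and3P: rq => Kq wn /hasP[j]; rewrite mem_iota => jr /eqP e.
rewrite /window_end in jr wn e.
have h d : d < K + K - 1 -> nth 0 S (j - d.+1) = nth 0 S (q + K - 1 - d.+1).
  by apply: prefix_code_window e _; clear -jr Kq wn; lia.
clear e.
have jlt : j - K + 1 < q by lia.
have jn : 0 < j - K + 1 <= n by lia.
have [p cp hp] := IH _ jlt jn.
exists p => // i l i0 il lK iq.
(* The earlier window ends at [j], so its centre is [j - K + 1]; the substring at [i] is translated
   along with [q]. *)
have [||||i' [h1 h2 h3 h4]] := hp (i + (j - K + 1) - q) l.
- by lia.
- by lia.
- by [].
- by lia.
exists i'; split=> //; rewrite h4.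
apply: (@eq_from_nth _ 0).
  by rewrite !(sub_size sizeS) //; lia.
move=> a; rewrite (sub_size sizeS); [|lia|lia] => al.
rewrite /sub !nth_take // !nth_drop.
have := h (q + K - 1 - (i.-1 + a).+1).
have -> : q + K - 1 - (q + K - 1 - (i.-1 + a).+1).+1 = i.-1 + a by lia.
move=> <-; last by lia.
by congr nth; lia.
Qed.

Lemma window_cand_count :
  count window_cand (iota 1 n) <= sigma ^ (K + K - 1) + (K.-1 + K.-1).
Proof.
have [s0|s0] := posnP sigma.
  have n0 : n = 0.
    rewrite -sizeS; case: (S) S_in => // a s /(_ a); rewrite inE eqxx s0.
    by move=> /(_ isT); case: a.
  by rewrite n0.
pose mid p := (K <= p) && (window_end p <= n).
pose x := sigma ^ (K + K - 1).
have x0 : 0 < x by rewrite expn_gt0 s0.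
(* Candidates with a complete window have pairwise distinct codes below [x]; the others are among
   the first or the last [K - 1] positions. *)
rewrite -size_filter -(count_predC mid) -!size_filter; apply: leq_add.
  set s := [seq p <- _ | mid p].
  pose f p := prefix_code (window_end p) %% x.
  have us : uniq s by rewrite !filter_uniq // iota_uniq.
  have inj : {in s &, injective f}.
    have aux p p' : p \in s -> p' \in s -> f p = f p' -> ~~ (p < p').
      rewrite !mem_filter => /and3P[/andP[m1 m2] _ _].
      case/and3P=> /andP[m3 m4] /and3P[_ _ nr] _ e; apply/negP => lt.
      move: nr; rewrite /redundant m3 m4 /= => /hasPn /(_ (window_end p)).
      rewrite mem_iota -/x -[_ %% x]/(f p) -[X in _ == X]/(f p') e eqxx.
      have inr : K + K - 1 <= window_end p <
          K + K - 1 + (window_end p' - (K + K - 1)).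
        by move: m1 m2 m3 m4 lt; rewrite /window_end; lia.
      by move=> /(_ inr).
    move=> p p' ps ps' e; have := aux _ _ ps ps' e.
    by have := aux _ _ ps' ps (esym e); lia.
  rewrite -(size_map f) -/x -[X in _ <= X](size_iota 0).
  apply: uniq_leq_size; first by rewrite map_inj_in_uniq.
  by move=> y /mapP[p _ ->]; rewrite mem_iota /= add0n ltn_mod.
have -> : K.-1 + K.-1 = size (iota 1 K.-1 ++ iota (n + 2 - K) K.-1).
  by rewrite size_cat !size_iota.
apply: uniq_leq_size; first by rewrite !filter_uniq // iota_uniq.
move=> p; rewrite !mem_filter mem_cat !mem_iota /= /mid /window_end.
by move=> /and3P[h1 _ h2]; apply/orP; move: h1 h2; case: leqP => /=; lia.
Qed.

End Windows.

(** * Renaming characters digit by digit *)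

Section Names.

Variables (n M : nat) (S : seq nat).

Definition digit (r i : nat) : nat := (nth 0 S i.-1 %/ M ^ r) %% M.

(** The first position whose character agrees with that of [i] in the [r] lowest base-[M] digits.
    Refining by one digit at a time keeps every table key small even for huge characters. *)
Fixpoint name (r i : nat) : nat :=
  if r is r'.+1 then
    first_in (fun j => (name r' j == name r' i) && (digit r' j == digit r' i)) n
  else 0.

Hypothesis M_gt0 : 0 < M.

Lemma name_neq0 r i : 0 < i <= n -> name r.+1 i != 0.
Proof. by move=> iin; apply: (first_in_mem iin); rewrite !eqxx. Qed.

Lemma name_le r i : name r i <= n.
Proof.
case: r => // r.
case: (eqVneq (name r.+1 i) 0) => [-> //|h].
by case: (first_in_neq0 h) => _ /andP[].
Qed.

Lemma name_self r i : 0 < i <= n ->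
  (name r (name r.+1 i) == name r i) && (digit r (name r.+1 i) == digit r i).
Proof. by move=> iin; have [h _ _] := first_in_neq0 (name_neq0 r iin). Qed.

Lemma nameP r i j : 0 < i <= n -> 0 < j <= n ->
  (name r i == name r j) = (nth 0 S i.-1 %% M ^ r == nth 0 S j.-1 %% M ^ r).
Proof.
elim: r i j => [|r IH] i j iin jin; first by rewrite expn0 !modn1 !eqxx.
have eqv a b : 0 < a <= n -> 0 < b <= n ->
   (name r a == name r b) && (digit r a == digit r b) =
   (nth 0 S a.-1 %% M ^ r.+1 == nth 0 S b.-1 %% M ^ r.+1).
  move=> ain bin; rewrite IH // /digit.
  have split x : x %% M ^ r.+1 = (x %/ M ^ r) %% M * M ^ r + x %% M ^ r.
    have p0 : 0 < M ^ r by rewrite expn_gt0 M_gt0.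
    rewrite {1}(divn_eq x (M ^ r)) {1}(divn_eq (x %/ M ^ r) M) mulnDl.
    rewrite -mulnA -expnS -addnA modnMDl modn_small // expnS.
    have := ltn_pmod (x %/ M ^ r) M_gt0; have := ltn_pmod x p0.
    move: (_ %% M) (_ %% M ^ r) => a' b'; nia.
  rewrite !split; apply/andP/eqP => [[/eqP -> /eqP ->] //|e].
  have p0 : 0 < M ^ r by rewrite expn_gt0 M_gt0.
  have h := ltn_pmod _ p0.
  have := h (nth 0 S a.-1); have := h (nth 0 S b.-1).
  move: e; move: (_ %% M) => a1; move: (_ %% M) => b1.
  move: (nth 0 S a.-1 %% _) => a0; move: (nth 0 S b.-1 %% _) => b0 e l0 l1.
  have e0 : a0 = b0.
    by have := congr1 (modn^~ (M ^ r)) e; rewrite /= !modnMDl !modn_small.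
  rewrite e0 eqxx; split=> //; move/eqP: e; rewrite e0 eqn_add2r.
  by rewrite eqn_pmul2r.
rewrite -eqv //.
have /andP[/eqP a1 /eqP b1] := name_self r iin.
have /andP[/eqP a2 /eqP b2] := name_self r jin.
apply/eqP/andP => [e|[/eqP h1 /eqP h2]].
  by rewrite -a1 -b1 -a2 -b2 e !eqxx.
by rewrite /= h1 h2.
Qed.

End Names.

(** * The harmonic potential of a greedy choice *)

Section Greedy.

Variable R : realType.
Local Notation H := (harmonic_number R).
Local Open Scope ring_scope.

Lemma harmonicS a : H a.+1 = H a + a.+1%:R^-1.
Proof. by rewrite /harmonic_number big_nat_recr. Qed.

Lemma harmonic_mono a b : (a <= b)%N -> H a <= H b.
Proof.
elim: b => [|b IH]; first by rewrite leqn0 => /eqP ->.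
rewrite leq_eqVlt => /orP[/eqP -> //|ab]; rewrite harmonicS.
by apply: (le_trans (IH ab)); rewrite lerDl invr_ge0 ler0n.
Qed.

Lemma harmonic_ge0 a : 0 <= H a.
Proof.
by rewrite /harmonic_number; apply: sumr_ge0 => i _; rewrite invr_ge0 ler0n.
Qed.

(** Each of the [a - b] reciprocals separating the two harmonic numbers has a denominator of at most
    [t]. *)
Lemma harmonic_diff a b t : (b <= a)%N -> (a <= t)%N ->
  H b + (a - b)%:R / t%:R <= H a.
Proof.
move=> ba; rewrite -(subnKC ba); move: (a - b)%N => c {a ba}.
rewrite addKn; elim: c => [|c IH] ct; first by rewrite mul0r addr0 addn0.
rewrite addnS harmonicS -addn1 natrD mulrDl addrA lerD //.
  by apply: IH; rewrite (leq_trans _ ct) // addnS.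
have t0 : 0 < t%:R :> R by rewrite ltr0n (leq_trans _ ct) // addnS.
have le : (b + c).+1%:R <= t%:R :> R by rewrite ler_nat -addnS.
by rewrite mul1r lef_pV2 // posrE ltr0n.
Qed.

Variables (adj : nat -> seq nat) (cov : pred nat) (G : seq nat) (p t : nat).

Definition uncovered (cov : pred nat) (q : nat) : nat :=
  count (predC cov) (adj q).

Lemma uncovered_add (c c' : pred nat) e q : uniq (adj q) -> ~~ c e ->
  (forall e', c' e' = c e' || (e' == e)) ->
  uncovered c q = (uncovered c' q + (e \in adj q))%N.
Proof.
rewrite /uncovered => + ce ec; elim: (adj q) => //= a s IH /andP[na us].
rewrite IH // inE ec eq_sym; case: (eqVneq a e) => [ae|_] /=.
  by rewrite ae in na *; rewrite (negbTE ce) (negbTE na) /=; lia.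
by case: (c a) => /=; lia.
Qed.

Hypothesis adj_uniq : uniq (adj p).
Hypothesis G_hits : forall e, e \in adj p -> exists2 q, q \in G & e \in adj q.
Hypothesis p_t : uncovered cov p = t.
Hypothesis t_gt0 : (0 < t)%N.
Hypothesis G_le : forall q, q \in G -> (uncovered cov q <= t)%N.

Lemma uncovered_cover q :
  (uncovered (fun e => cov e || (e \in adj p)) q +
   count (fun e => ~~ cov e && (e \in adj p)) (adj q) = uncovered cov q)%N.
Proof.
rewrite /uncovered; elim: (adj q) => //= e s IH; rewrite -IH /=.
by case: (cov e) => /=; case: (e \in adj p) => /=; lia.
Qed.

(* Covering the [t] new elements of [adj p] lowers the potential by at least
   one: each of them lies in some [adj q] with [q] in [G], where it accounts
   for a decrease of at least [1 / t]. *)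
Lemma greedy_potential :
  1 + \sum_(q <- G) H (uncovered (fun e => cov e || (e \in adj p)) q) <=
  \sum_(q <- G) H (uncovered cov q).
Proof.
pose cov' e := cov e || (e \in adj p); rewrite -/cov'.
pose d q := count (fun e => ~~ cov e && (e \in adj p)) (adj q).
have tn0 : t%:R != 0 :> R by rewrite pnatr_eq0 -lt0n.
(* Every new element is met by some member of [G]; those met by several are counted repeatedly,
   which only helps. *)
have le_t : (t <= \sum_(q <- G) d q)%N.
  rewrite -p_t /uncovered -size_filter.
  pose s := flatten
    [seq [seq e <- adj q | ~~ cov e && (e \in adj p)] | q <- G].
  have -> : (\sum_(q <- G) d q = size s)%N.
    rewrite size_flatten /shape -map_comp sumnE big_map.
    by apply: eq_bigr => q _; rewrite /= size_filter.
  apply: uniq_leq_size; first by rewrite filter_uniq.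
  move=> e; rewrite mem_filter /= => /andP[ce ep].
  have [q qG eq] := G_hits ep.
  apply/flattenP; exists [seq e <- adj q | ~~ cov e && (e \in adj p)].
    by apply/mapP; exists q.
  by rewrite mem_filter ce ep.
apply: (@le_trans _ _ (\sum_(q <- G) ((d q)%:R / t%:R + H (uncovered cov' q)))).
  rewrite big_split /= lerD2r -mulr_suml -natr_sum ler_pdivlMr ?ltr0n //.
  by rewrite mul1r ler_nat.
rewrite big_seq [X in _ <= X]big_seq; apply: ler_sum => q qG.
have e := uncovered_cover q; rewrite -/cov' -/(d q) in e.
rewrite addrC.
have -> : d q = (uncovered cov q - uncovered cov' q)%N by lia.
by apply: harmonic_diff; [lia | exact: G_le].
Qed.

End Greedy.

(** * The program *)

Section ConditionRules.

Variables w off lim : nat.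

Lemma wp_if_lt (Q : state -> Prop) e1 e2 c1 c2 s :
  expr_ok w off lim s e1 -> expr_ok w off lim s e2 ->
  (eval s e1 < eval s e2 -> wp w off lim c1 Q s) ->
  (eval s e2 <= eval s e1 -> wp w off lim c2 Q s) ->
  wp w off lim (CIf (EOp OLt e1 e2) c1 c2) Q s.
Proof.
move=> ok1 ok2 h1 h2; apply: wp_if => //=.
  by rewrite eqb0 negbK.
by move/eqP; rewrite eqb0 -leqNgt.
Qed.

Lemma wp_if_eq (Q : state -> Prop) e1 e2 c1 c2 s :
  expr_ok w off lim s e1 -> expr_ok w off lim s e2 ->
  (eval s e1 = eval s e2 -> wp w off lim c1 Q s) ->
  (eval s e1 <> eval s e2 -> wp w off lim c2 Q s) ->
  wp w off lim (CIf (EOp OEq e1 e2) c1 c2) Q s.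
Proof.
move=> ok1 ok2 h1 h2; apply: wp_if => //=.
  by rewrite eqb0 negbK => /eqP.
by move/eqP; rewrite eqb0 => /eqP.
Qed.

Lemma wp_while_lt (T : Type) (I : T -> state -> Prop) (mu : T -> nat)
    (Q : state -> Prop) e1 e2 c x s :
  I x s ->
  (forall y s, I y s ->
    [/\ expr_ok w off lim s e1, expr_ok w off lim s e2,
      eval s e1 < eval s e2 ->
        wp w off lim c (fun s' => exists2 z, I z s' & mu z < mu y) (tick s)
    & eval s e2 <= eval s e1 -> Q s]) ->
  wp w off lim (CWhile (EOp OLt e1 e2) c) Q s.
Proof.
move=> Ix H; apply: (wp_while (mu := mu) Ix) => y s' Iy.
have [ok1 ok2 h1 h2] := H y s' Iy; do !split => //=.
  by rewrite eqb0 negbK.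
by move/eqP; rewrite eqb0 -leqNgt.
Qed.

End ConditionRules.

Local Notation "c1 ;; c2" := (CSeq c1 c2) (at level 90, right associativity).
Local Notation eAdd := (EOp OAdd).
Local Notation eSub := (EOp OSub).
Local Notation eMul := (EOp OMul).
Local Notation eDiv := (EOp ODiv).
Local Notation eMod := (EOp OMod).
Local Notation eLt := (EOp OLt).
Local Notation eEq := (EOp OEq).

Local Notation vN := 0.
Local Notation vSg := 1.
Local Notation vK0 := 2.
Local Notation vN1 := 3.
Local Notation vM := 4.
Local Notation vK := 5.
Local Notation vX := 6.
Local Notation vJ := 7.
Local Notation vT := 8.
Local Notation vC := 9.
Local Notation vI := 10.
Local Notation vS := 11.
Local Notation vR := 12.
Local Notation vKey := 13.
Local Notation vL := 14.
Local Notation vF := 15.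
Local Notation vG := 16.
Local Notation vE := 17.
Local Notation vQ := 18.
Local Notation vD := 19.
Local Notation vO := 20.
Local Notation vP := 21.
Local Notation vH := 22.

(* [aTab]: window codes already seen; [aRem]: redundant positions; [aNx], [aNs]:
   next candidate and next start; [aF]: class of each start at the current
   length; [aT1], [aC]: table and result of the renaming of characters; [aT2]:
   table of classes; [aMk]: marked classes; [aRR]: end of the last occurrence of
   a class scanned so far; [aEP], [aEC]: positions met by an element and their
   number; [aPE], [aPC]: elements met by a position and their number; [aCN]:
   number of uncovered elements of a position; [aCV]: covered elements. *)
Local Notation aTab := 0.
Local Notation aRem := 1.
Local Notation aNx := 2.
Local Notation aNs := 3.
Local Notation aF := 4.
Local Notation aT1 := 5.
Local Notation aC := 6.
Local Notation aT2 := 7.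
Local Notation aMk := 8.
Local Notation aRR := 9.
Local Notation aEP := 10.
Local Notation aEC := 11.
Local Notation aPE := 12.
Local Notation aPC := 13.
Local Notation aCN := 14.
Local Notation aCV := 15.

Definition incr x := CSet x (eAdd (EVar x) (ENum 1)).

(** [M = 2n + 4] exceeds all class numbers (at most [n + 1]), all lengths and all list lengths (at
    most [n] positions per element, [2n] elements per position), so one base serves every
    encoding. *)
Definition prog_init :=
  CSet vN (ELow (ENum 0)) ;;
  CSet vSg (ELow (ENum 1)) ;;
  CSet vK0 (ELow (ENum 2)) ;;
  CSet vN1 (eAdd (EVar vN) (ENum 1)) ;;
  CSet vM (eAdd (eAdd (EVar vN) (EVar vN)) (ENum 4)) ;;
  CIf (eLt (EVar vK0) (EVar vN1)) (CSet vK (EVar vK0)) (CSet vK (EVar vN)).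

(** Multiplication stops once the value exceeds [n]. As [sigma <= n] here, the value never exceeds
    [n ^ 2] and fits in a word, yet it still decides whether [sigma ^ (2K - 1) <= n]. *)
Definition prog_power :=
  CSet vX (ENum 1) ;;
  CSet vJ (ENum 0) ;;
  CSet vT (eSub (eAdd (EVar vK) (EVar vK)) (ENum 1)) ;;
  CWhile (eLt (EVar vJ) (EVar vT))
    (CIf (eLt (EVar vX) (EVar vN1)) (CSet vX (eMul (EVar vX) (EVar vSg))) CSkip ;;
     incr vJ).

Definition prog_windows :=
  CSet vC (ENum 0) ;;
  CSet vI (ENum 1) ;;
  CWhile (eLt (EVar vI) (EVar vN1))
    (CSet vC (eMod (eAdd (eMul (EVar vC) (EVar vSg))
        (eSub (ELow (eAdd (EVar vI) (ENum 2))) (ENum 1))) (EVar vX)) ;;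
     CIf (eLt (EVar vI) (EVar vT)) CSkip
       (CIf (eEq (EArr aTab (EVar vC)) (ENum 0))
          (CArr aTab (EVar vC) (ENum 1))
          (CArr aRem (eSub (eAdd (EVar vI) (ENum 1)) (EVar vK)) (ENum 1))) ;;
     incr vI).

(** For [sigma > n] the power exceeds [n] at once. When no windows are scanned, [aRem] stays zero
    and every position is a candidate. *)
Definition prog_cands :=
  CIf (eLt (EVar vSg) (EVar vN1))
    (prog_power ;; CIf (eLt (EVar vX) (EVar vN1)) prog_windows CSkip)
    CSkip.

Definition prog_next :=
  CArr aNx (EVar vN1) (EVar vN1) ;;
  CArr aNs (EVar vN1) (EVar vN1) ;;
  CSet vI (EVar vN) ;;
  CWhile (eLt (ENum 0) (EVar vI))
    (CIf (eEq (EArr aRem (EVar vI)) (ENum 0))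
       (CArr aNx (EVar vI) (EVar vI))
       (CArr aNx (EVar vI) (EArr aNx (eAdd (EVar vI) (ENum 1)))) ;;
     CArr aF (EVar vI) (EVar vN1) ;;
     CArr aNs (EVar vI) (EArr aNs (eAdd (EVar vI) (ENum 1))) ;;
     CIf (eLt (EArr aNx (EVar vI)) (eAdd (EVar vI) (EVar vK)))
       (CIf (eLt (EArr aNx (EVar vI)) (EVar vN1))
          (CArr aNs (EVar vI) (EVar vI)) CSkip)
       CSkip ;;
     CSet vI (eSub (EVar vI) (ENum 1))).

(** Characters are divided by [M] in place, so each round finds its digit as a remainder. The round
    number in the key selects fresh table rows, so nothing has to be cleared. *)
Definition prog_names_round :=
  CSet vI (ENum 1) ;;
  CWhile (eLt (EVar vI) (EVar vN1))
    (CSet vKey (eAdd (eMul (eAdd (eMul (EVar vR) (EVar vM)) (EArr aC (EVar vI)))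
         (EVar vM)) (eMod (ELow (eAdd (EVar vI) (ENum 2))) (EVar vM))) ;;
     CIf (eEq (EArr aT1 (EVar vKey)) (ENum 0))
       (CArr aT1 (EVar vKey) (EVar vI)) CSkip ;;
     CArr aC (EVar vI) (EArr aT1 (EVar vKey)) ;;
     CLow (eAdd (EVar vI) (ENum 2))
       (eDiv (ELow (eAdd (EVar vI) (ENum 2))) (EVar vM)) ;;
     incr vI).

Definition prog_names :=
  CSet vS (EVar vSg) ;;
  CSet vR (ENum 0) ;;
  CWhile (eLt (ENum 0) (EVar vS))
    (prog_names_round ;;
     CSet vS (eDiv (EVar vS) (EVar vM)) ;;
     incr vR).

Definition cell l f := eAdd (eMul l (EVar vM)) f.

Definition prog_class :=
  CSet vF (EArr aF (EVar vI)) ;;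
  CIf (eEq (EVar vF) (ENum 0)) CSkip
    (CIf (eLt (eAdd (EVar vI) (EVar vL)) (eAdd (EVar vN1) (ENum 1)))
       (CSet vKey (cell (cell (EVar vL) (EVar vF))
          (EArr aC (eSub (eAdd (EVar vI) (EVar vL)) (ENum 1)))) ;;
        CIf (eEq (EArr aT2 (EVar vKey)) (ENum 0))
          (CArr aT2 (EVar vKey) (EVar vI)) CSkip ;;
        CSet vG (EArr aT2 (EVar vKey)))
       (CSet vG (ENum 0)) ;;
     CSet vE (eAdd (eEq (EVar vG) (ENum 0)) (eEq (EVar vG) (EVar vI))) ;;
     CIf (eEq (EVar vF) (EVar vI)) CSkip
       (CIf (eEq (EVar vE) (ENum 0)) CSkip
          (CArr aMk (cell (EVar vL) (EVar vF)) (ENum 1) ;;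
           CArr aMk (cell (EVar vL) (EVar vI)) (ENum 1))) ;;
     CArr aF (EVar vI) (EVar vG)).

Definition prog_classes :=
  CSet vI (EArr aNs (ENum 1)) ;;
  CWhile (eLt (EVar vI) (EVar vN1))
    (prog_class ;; CSet vI (EArr aNs (eAdd (EVar vI) (ENum 1)))).

Definition prog_link :=
  CArr aEP (cell (EVar vE) (EArr aEC (EVar vE))) (EVar vQ) ;;
  CArr aEC (EVar vE) (eAdd (EArr aEC (EVar vE)) (ENum 1)) ;;
  CArr aPE (cell (EVar vQ) (EArr aPC (EVar vQ))) (EVar vE) ;;
  CArr aPC (EVar vQ) (eAdd (EArr aPC (EVar vQ)) (ENum 1)) ;;
  CArr aCN (EVar vQ) (EArr aPC (EVar vQ)).

Definition prog_element :=
  CSet vF (EArr aF (EVar vI)) ;;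
  CSet vE (cell (EVar vL) (EVar vF)) ;;
  CIf (eEq (EVar vF) (ENum 0)) CSkip
    (CIf (eEq (EArr aMk (EVar vE)) (ENum 0)) CSkip
       (CSet vQ (EVar vI) ;;
        CIf (eLt (EVar vI) (EArr aRR (EVar vE)))
          (CSet vQ (EArr aRR (EVar vE))) CSkip ;;
        CSet vQ (EArr aNx (EVar vQ)) ;;
        CWhile (eLt (EVar vQ) (eAdd (EVar vI) (EVar vL)))
          (prog_link ;; CSet vQ (EArr aNx (eAdd (EVar vQ) (ENum 1)))) ;;
        CArr aRR (EVar vE) (eAdd (EVar vI) (EVar vL)))).

Definition prog_incidence :=
  CSet vI (EArr aNs (ENum 1)) ;;
  CWhile (eLt (EVar vI) (EVar vN1))
    (prog_element ;; CSet vI (EArr aNs (eAdd (EVar vI) (ENum 1)))).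

Definition prog_levels :=
  CSet vL (ENum 1) ;;
  CWhile (eLt (EVar vL) (eAdd (EVar vK) (ENum 1)))
    (prog_classes ;; prog_incidence ;; incr vL).

Definition prog_cover :=
  CArr aCV (EVar vE) (ENum 1) ;;
  CSet vH (ENum 0) ;;
  CWhile (eLt (EVar vH) (EArr aEC (EVar vE)))
    (CSet vQ (EArr aEP (cell (EVar vE) (EVar vH))) ;;
     CArr aCN (EVar vQ) (eSub (EArr aCN (EVar vQ)) (ENum 1)) ;;
     incr vH).

Definition prog_pick :=
  incr vO ;;
  CLow (EVar vO) (EVar vP) ;;
  CSet vJ (ENum 0) ;;
  CWhile (eLt (EVar vJ) (EArr aPC (EVar vP)))
    (CSet vE (EArr aPE (cell (EVar vP) (EVar vJ))) ;;
     CIf (eEq (EArr aCV (EVar vE)) (ENum 0)) prog_cover CSkip ;;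
     incr vJ).

(** The first threshold [min (K * K) (2 * n)] dominates both [K(K+1)/2] and the number of elements,
    hence all degrees. *)
Definition prog_greedy :=
  CSet vD (eMul (EVar vK) (EVar vK)) ;;
  CIf (eLt (eAdd (EVar vN) (EVar vN)) (EVar vD))
    (CSet vD (eAdd (EVar vN) (EVar vN))) CSkip ;;
  CSet vO (ENum 0) ;;
  CWhile (eLt (ENum 0) (EVar vD))
    (CSet vP (EArr aNx (ENum 1)) ;;
     CWhile (eLt (EVar vP) (EVar vN1))
       (CIf (eEq (EArr aCN (EVar vP)) (EVar vD)) prog_pick CSkip ;;
        CSet vP (EArr aNx (eAdd (EVar vP) (ENum 1)))) ;;
     CSet vD (eSub (EVar vD) (ENum 1))) ;;
  CLow (ENum 0) (EVar vO).

Definition prog_main :=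
  prog_init ;;
  CIf (eEq (EVar vSg) (ENum 1))
    (CLow (ENum 0) (ENum 1) ;; CLow (ENum 1) (ENum 1))
    (prog_cands ;; prog_next ;; prog_names ;; prog_levels ;; prog_greedy).

Ltac simp_state :=
  cbn [vr ar lo tm setv seta setl tick eval op_val eqn incr cell] in *;
  repeat match goal with
  | H : vr ?s ?x = _ |- context [vr ?s ?x] => rewrite H
  end.

Ltac simp_ok :=
  cbn [expr_ok op_ok vr ar lo tm setv seta setl tick eval op_val eqn incr cell];
  repeat match goal with
  | H : vr ?s ?x = _ |- context [vr ?s ?x] => rewrite H
  end.

Ltac conj :=
  repeat match goal with
  | |- and3 _ _ _ => split
  | |- and4 _ _ _ _ => split
  | |- and5 _ _ _ _ _ => split
  | |- _ /\ _ => split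
  end; try done.

(** * Correctness and loop counts of the program *)

Section Correctness.

Variables (R : realType) (w n sigma k : nat) (S : seq nat) (lim : nat).
Hypothesis sizeS : size S = n.
Hypothesis n_gt0 : 0 < n.
Hypothesis k_gt0 : 0 < k.
Hypothesis S_in : forall a, a \in S -> 1 <= a <= sigma.
Hypothesis sigma_lt : sigma < 2 ^ w.
Hypothesis k_lt : k < 2 ^ w.

Local Notation K := (minn k n).
Local Notation M := (n + n + 4).
Local Notation off := (n + 3).
Local Notation wp := (wp w off lim).
Local Notation ok := (expr_ok w off lim).

Hypothesis lim_cube : M * M * M <= lim.
Hypothesis lim_names : w.+1 * M * M <= lim.
Hypothesis lim_lt : lim < 2 ^ w.

Definition globals s :=
  [/\ vr s vN = n, vr s vN1 = n.+1, vr s vM = M & vr s vK = K].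

(** Arrays are numbered by the phase that first uses them; this records which of them are still in
    their initial state. *)
Definition zero_from a s := forall r i, a <= r -> ar s r i = 0.

Lemma zero_from_seta a s r i v : r < a -> zero_from a s ->
  zero_from a (seta s r i v).
Proof.
move=> ra z r' i' ar'; rewrite /seta /=; have -> : eqn r' r = false.
  by apply/negbTE; rewrite -[eqn _ _]/(r' == r); lia.
exact: z.
Qed.

Lemma K_bounds : 0 < K <= n.
Proof. by lia. Qed.

Lemma M_lim : M < lim.
Proof.
apply: leq_trans lim_cube; have : 1 < M by lia.
by move: M => m; nia.
Qed.

Lemma M2_lim a b : a < M -> b < M -> a * M + b < M * M.
Proof. by nia. Qed.

Definition input s :=
  [/\ lo s 0 = n, lo s 1 = sigma, lo s 2 = k
    & forall i, 0 < i <= n -> lo s (i + 2) = nth 0 S i.-1].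

Definition after_init s :=
  [/\ globals s, vr s vSg = sigma, input s, zero_from 0 s & tm s = 0].

Lemma init_correct s : input s -> zero_from 0 s -> tm s = 0 ->
  wp prog_init after_init s.
Proof.
move=> inp z t; have [l0 l1 l2 _] := inp.
have ML := M_lim.
rewrite /prog_init.
do 5! (apply: wp_seq; apply: wp_set; first by simp_ok; repeat split; lia).
apply: wp_if_lt => // [h|h]; apply: wp_set => //;
  (split=> //; split=> //; rewrite /=; move: h; simp_ok; rewrite ?l0 ?l2; lia).
Qed.

Lemma sigma_gt0 : 0 < sigma.
Proof.
have h : 0 < size S by rewrite sizeS.
by have /andP[h1 h2] := S_in (mem_nth 0 h); exact: leq_trans h1 h2.
Qed.

Lemma n2_lim : n * n < lim.
Proof.
apply: leq_trans lim_cube; have : n < M by lia.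
by move: M => m; nia.
Qed.

Definition after_power s :=
  [/\ globals s, vr s vSg = sigma, input s, zero_from 0 s &
  [/\ vr s vT = K + K - 1, vr s vX <= n -> vr s vX = sigma ^ (K + K - 1),
      n < vr s vX -> n < sigma ^ (K + K - 1) & tm s <= n + n]].

Lemma power_correct s : sigma <= n -> after_init s ->
  wp prog_power after_power s.
Proof.
move=> sn [g vs inp z t]; have [g1 g2 g3 g4] := g.
have ML := M_lim; have NL := n2_lim; have s0 := sigma_gt0.
apply: wp_seq; apply: wp_set; first by simp_ok; lia.
apply: wp_seq; apply: wp_set; first by simp_ok; lia.
apply: wp_seq; apply: wp_set; first by simp_ok; repeat split; lia.
pose I j s := [/\ globals s, vr s vSg = sigma, input s, zero_from 0 s &
  [/\ vr s vT = K + K - 1, vr s vJ = j, j <= K + K - 1, 0 < vr s vX &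
  [/\ vr s vX <= n * n, vr s vX <= n -> vr s vX = sigma ^ j,
      n < vr s vX -> n < sigma ^ j & tm s = j]]].
apply: (wp_while_lt (I := I) (x := 0) (mu := fun j => K + K - 1 - j)).
  split=> //; split=> //; first by simp_state.
  by split=> //; simp_state; nia.
move=> {g g1 g2 g3 g4 vs inp z t s} j s.
move=> [g vs inp z [hT hJ jT x0 [xn hx1 hx2 t]]].
have [g1 g2 g3 g4] := g.
split=> // [h|h].
- apply: wp_seq; apply: wp_if_lt => // [lt|ge].
  + have xn' : vr s vX <= n by move: lt; simp_state; lia.
    have prod : vr s vX * sigma <= n * n by apply: leq_mul.
    apply: wp_set; first by simp_ok; repeat split; lia.
    apply: wp_set; first by simp_ok; repeat split; lia.
    move: h; simp_state => h.
    exists j.+1; last by lia.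
    rewrite /I; conj; simp_state; try lia; rewrite ?vs ?(hx1 xn') -?expnSr; try lia.
  + apply: wp_skip; apply: wp_set; first by simp_ok; repeat split; lia.
    move: h ge; simp_state => h ge; exists j.+1; last by lia.
    rewrite /I; conj; simp_state; try lia.
    move=> nx; apply: leq_trans (hx2 nx) _; rewrite expnS.
    by rewrite -[X in X <= _]mul1n leq_mul2r s0 orbT.
- move: h; simp_state => h.
  have e : j = K + K - 1 by lia.
  by rewrite e in hx1 hx2; split=> //; split=> //; lia.
Qed.

Definition after_cands (cand : pred nat) s :=
  [/\ globals s, vr s vSg = sigma, input s, zero_from 2 s &
    (forall p, 0 < p <= n -> (ar s aRem p == 0) = cand p) /\
     tm s <= 3 * n].

Lemma prefix_code_step x i :
  (prefix_code sigma S i %% x * sigma + (nth 0 S i - 1)) %% x =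
  prefix_code sigma S i.+1 %% x.
Proof. by rewrite /= subn1 -modnDml modnMml modnDml. Qed.

Lemma windows_correct s : after_power s -> vr s vX <= n ->
  wp prog_windows (after_cands (window_cand n K sigma S)) s.
Proof.
move=> [g vs inp z [hT hx _ t]] xn; have [g1 g2 g3 g4] := g.
have ML := M_lim; have NL := n2_lim; have s0 := sigma_gt0.
have Kn := K_bounds.
have {}hx := hx xn; rewrite hx in xn.
have x0 : 0 < sigma ^ (K + K - 1) by rewrite expn_gt0 s0.
apply: wp_seq; apply: wp_set; first by simp_ok; lia.
apply: wp_seq; apply: wp_set; first by simp_ok; lia.
pose I i s := [/\ globals s, vr s vSg = sigma, input s, zero_from 2 s &
  [/\ vr s vT = K + K - 1, vr s vX = sigma ^ (K + K - 1), vr s vI = i.+1,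
      i <= n &
  [/\ vr s vC = prefix_code sigma S i %% sigma ^ (K + K - 1),
      tm s <= n + n + i,
   (forall c, ar s aTab c = has (fun j => prefix_code sigma S j
          %% sigma ^ (K + K - 1) == c) (iota (K + K - 1) (i.+1 - (K + K - 1))))
   & (forall p, ar s aRem p = redundant n K sigma S p && (window_end K p <= i))]]].
apply: (wp_while_lt (I := I) (x := 0) (mu := fun i => n - i)).
  split=> //; first by move=> r i _; exact: z.
  split=> //; split=> [||c|p]; simp_state; [by rewrite mod0n|by lia| |].
    have -> : 1 - (K + K - 1) = 0 by lia.
    by rewrite z.
  rewrite z // /redundant; case: leqP => //= Kp; case: leqP => //= wn.
  by case: has => //=; rewrite /window_end in wn *; lia.
move=> {g g1 g2 g3 g4 vs inp z t hT hx s} i s.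
move=> [g vs inp z [hT hX hI ni [hC t tab rem]]].
have [g1 g2 g3 g4] := g; have [_ _ _ inpS] := inp.
split=> // [h|h]; last first.
  move: h; simp_state => h; have e : i = n by lia.
  rewrite e in rem; split=> //; split; last by lia.
  move=> p pn; rewrite rem /window_cand; case/andP: (pn) => -> -> /=.
  rewrite eqb0; case rd: (redundant _ _ _ _ _) => //=.
  by case/and3P: rd => _ -> _.
have {}h : i < n by move: h; simp_state; lia.
have Si : 1 <= nth 0 S i <= sigma by apply: S_in; rewrite mem_nth // sizeS.
have li : lo s (i.+1 + 2) = nth 0 S i by rewrite inpS //; lia.
have sn : sigma <= n.
  apply: leq_trans xn; rewrite -{1}(expn1 sigma); case: (ltnP 1 sigma) => s1.
    by rewrite leq_exp2l //; lia.
  have -> : sigma = 1 by lia.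
  by rewrite !exp1n.
have pcx := ltn_pmod (prefix_code sigma S i) x0.
have prod : prefix_code sigma S i %% sigma ^ (K + K - 1) * sigma + sigma <= n * n.
  by rewrite -mulSnr leq_mul // (leq_trans pcx).
apply: wp_seq; apply: wp_set.
  simp_ok; rewrite li; move: prod; move: (_ %% _) => c prod.
  by clear -prod Si n_gt0 NL lim_lt ML sigma_lt h; repeat split; lia.
simp_state; rewrite li prefix_code_step.
(* The fate of [p] is decided when the last character of its window is read, by comparison with the
   codes of the windows ending earlier. *)
have red_old p : window_end K p = i.+1 ->
    redundant n K sigma S p = (K + K - 1 <= i.+1) &&
      has (fun j => prefix_code sigma S j %% sigma ^ (K + K - 1) ==
        prefix_code sigma S i.+1 %% sigma ^ (K + K - 1))
      (iota (K + K - 1) (i.+1 - (K + K - 1))).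
  by rewrite /redundant => e; rewrite e h -e /window_end; congr (_ && _); lia.
have red_case p : (redundant n K sigma S p && (window_end K p <= i.+1)) =
   (redundant n K sigma S p && (window_end K p <= i)) ||
   ((window_end K p == i.+1) && (redundant n K sigma S p)).
  by case: redundant; rewrite ?andbF //= andbT; lia.
have iota_end : K + K - 1 <= i.+1 -> iota (K + K - 1) (i.+2 - (K + K - 1)) =
    rcons (iota (K + K - 1) (i.+1 - (K + K - 1))) i.+1.
  move=> Ti; rewrite subSn // -[(i.+1 - _).+1]addn1 iotaD -cats1 /=.
  by rewrite subnKC.
have pcx' := ltn_pmod (prefix_code sigma S i.+1) x0.
have close s' : globals s' -> vr s' vSg = sigma -> input s' -> zero_from 2 s' ->
   vr s' vT = K + K - 1 -> vr s' vX = sigma ^ (K + K - 1) -> vr s' vI = i.+1 ->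
   vr s' vC = prefix_code sigma S i.+1 %% sigma ^ (K + K - 1) ->
   tm s' <= n + n + i.+1 ->
   (forall c, ar s' aTab c = has (fun j => prefix_code sigma S j
     %% sigma ^ (K + K - 1) == c) (iota (K + K - 1) (i.+2 - (K + K - 1)))) ->
   (forall p, ar s' aRem p =
      redundant n K sigma S p && (window_end K p <= i.+1)) ->
   wp (incr vI) (fun s2 => exists2 z0, I z0 s2 & n - z0 < n - i) s'.
  move=> c1 c2 c3 c4 c5 c6 c7 c8 c9 c10 c11.
  apply: wp_set; first by simp_ok; repeat split; lia.
  exists i.+1; last by lia.
  by rewrite /I; conj; simp_state; lia.
apply: wp_seq; apply: wp_if_lt => // [lt|ge].
  move: lt; simp_state => lt; apply: wp_skip; apply: close => //=.
  - by lia.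
  - move=> c; rewrite tab.
    have -> : i.+1 - (K + K - 1) = 0 by lia.
    by have -> : i.+2 - (K + K - 1) = 0 by lia.
  - move=> p; rewrite red_case rem; case: eqP => //= e.
      by rewrite red_old // [K + K - 1 <= _]leqNgt lt.
    by rewrite orbF.
move: ge; simp_state => Ti.
apply: wp_if_eq => // [||eq0|ne0].
- simp_ok; repeat split=> //; lia.
- simp_ok; lia.
- apply: wp_arr => //; [simp_ok; lia|simp_ok; lia|].
  move: eq0; simp_state => eq0; apply: close => //=.
  + exact: zero_from_seta.
  + by lia.
  + move=> c; simp_state; rewrite iota_end // has_rcons tab eq_sym.
    case: (eqVneq c) => [->|ne] //=.
  + move=> p; simp_state; rewrite red_case rem; case: eqP => //= e.
      rewrite red_old // Ti /=.
      by move: eq0; rewrite tab => /eqP; rewrite eqb0 => /negbTE ->.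
    by rewrite orbF.
- apply: wp_arr => //; [simp_ok; clear -Ti h Kn ML lim_lt; repeat split; lia|simp_ok; clear -lim_lt ML; lia|simp_ok; clear -h ML; lia|].
  move: ne0; simp_state => ne0.
  have hs : has (fun j => prefix_code sigma S j %% sigma ^ (K + K - 1) ==
        prefix_code sigma S i.+1 %% sigma ^ (K + K - 1))
      (iota (K + K - 1) (i.+1 - (K + K - 1))).
    by move: ne0; rewrite tab; case: has.
  apply: close => //=.
  + exact: zero_from_seta.
  + by lia.
  + move=> c; simp_state; rewrite iota_end // has_rcons tab.
    case: (eqVneq (prefix_code sigma S i.+1 %% _) c) => [<-|ne] //=.
    by rewrite hs.
  + move=> p; simp_state; rewrite red_case rem.
    have -> : (p == i.+1 + 1 - K) = (window_end K p == i.+1).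
      by rewrite /window_end; clear -Ti h Kn; lia.
    case: eqP => //= e; last by rewrite orbF.
    by rewrite red_old // Ti hs orbT.
Qed.

(** The count is claimed only for a power of at most [n]; beyond that, [n] itself is below the bound
    aimed at. *)
Definition good_cands (cand : pred nat) :=
  [/\ same_context n K S cand, forall p, cand p -> 0 < p <= n
    & sigma ^ (K + K - 1) <= n ->
      count cand (iota 1 n) <= 3 * sigma ^ (K + K - 1)].

Lemma cands_correct s : 1 < sigma -> after_init s ->
  wp prog_cands (fun s' => exists2 cand, good_cands cand & after_cands cand s') s.
Proof.
move=> s1 hs.
have Kn := K_bounds.
have all_good s' : n < sigma ^ (K + K - 1) -> globals s' -> vr s' vSg = sigma ->
    input s' -> zero_from 0 s' -> tm s' <= 3 * n ->
    exists2 cand, good_cands cand & after_cands cand s'.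
  move=> big g vs inp z t; exists (fun p => 0 < p <= n).
    split=> //; last by rewrite leqNgt big.
    by move=> q qn; exists q => // i l i0 il lK iq; exists i.
  split=> //; first by move=> r i _; exact: z.
  by split=> // p pn; rewrite z ?pn ?eqxx.
case: (hs) => g vs inp z t; have [g1 g2 g3 g4] := g.
apply: wp_if_lt => // [lt|ge]; last first.
  apply: wp_skip; apply: all_good => //; last by rewrite t.
  move: ge; simp_state => ge; apply: (leq_trans ge); rewrite -{1}(expn1 sigma).
  by rewrite leq_exp2l //; clear -Kn; lia.
have sn : sigma <= n by move: lt; simp_state.
apply: wp_seq; apply: (wp_imp (power_correct sn hs)) => {hs g vs inp z t g1 g2 g3 g4 lt} s hs.
case: (hs) => g vs inp z [hT hx1 hx2 t]; have [g1 g2 g3 g4] := g.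
apply: wp_if_lt => // [lt|ge].
  have xn : vr s vX <= n by move: lt; simp_state.
  apply: (wp_imp (windows_correct hs xn)) => s' hs'.
  exists (window_cand n K sigma S) => //; split.
  - by apply: window_cand_context => //; case/andP: Kn.
  - by move=> p /and3P[-> ->].
  - move=> _; apply: leq_trans (window_cand_count sizeS _ S_in) _.
      by case/andP: Kn.
    (* Here [sigma > 1] matters: the [2(K - 1)] positions near the ends cost at most two more
       powers, which explains the factor 3. *)
    have : K - 1 < sigma ^ (K + K - 1).
      apply: leq_ltn_trans (ltn_expl _ s1); clear -Kn; lia.
    by move: (sigma ^ _) => x; clear -Kn; lia.
apply: wp_skip; apply: all_good => //; last by clear -t n_gt0; lia.
by apply: hx2; move: ge; simp_state.
Qed.

(** * Pointers to the next candidate and the next start *)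

Section Tables.

Variable cand : pred nat.

Definition after_next s :=
  [/\ globals s, vr s vSg = sigma, input s, zero_from 5 s &
  [/\ forall i, 0 < i <= n.+1 -> ar s aNx i = next_in cand n i,
      forall i, 0 < i <= n.+1 -> ar s aNs i = next_in (start n K cand) n i,
      forall i, 0 < i <= n -> ar s aF i = n.+1 & tm s <= 4 * n]].

Lemma next_correct s : after_cands cand s -> wp prog_next after_next s.
Proof.
move=> [g vs inp z [rem t]]; have [g1 g2 g3 g4] := g.
have ML := M_lim; have Kn := K_bounds.
have nl : n.+1 < lim by clear -ML; lia.
apply: wp_seq; apply: wp_arr => //; first by simp_ok.
apply: wp_seq; apply: wp_arr => //; first by simp_ok.
apply: wp_seq; apply: wp_set => //.
simp_state.
pose I i s := [/\ globals s, vr s vSg = sigma, input s, zero_from 5 s &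
  [/\ vr s vI = i, i <= n, forall p, 0 < p <= n -> (ar s aRem p == 0) = cand p,
      tm s <= 3 * n + (n - i) &
  [/\ forall j, i < j <= n.+1 -> ar s aNx j = next_in cand n j,
      forall j, i < j <= n.+1 -> ar s aNs j = next_in (start n K cand) n j
    & forall j, i < j <= n -> ar s aF j = n.+1]]].
apply: (wp_while_lt (I := I) (x := n) (mu := id)).
  rewrite /I; conj; simp_state; try by clear -t; lia.
  - do 2 (apply: zero_from_seta => //); move=> r i ri; apply: z; clear -ri; lia.
  - move=> j jn; have -> : j = n.+1 by clear -jn; lia.
    by rewrite eqxx next_in_end.
  - move=> j jn; have -> : j = n.+1 by clear -jn; lia.
    by rewrite eqxx next_in_end.
move=> {g g1 g2 g3 g4 vs inp z t rem s} i s.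
move=> [g vs inp z [hI ni rem t [nx ns ff]]]; have [g1 g2 g3 g4] := g.
split=> [|//|h|h]; first by simp_ok; clear -ML lim_lt; lia.
- have {}h : 0 < i by move: h; simp_state.
  have il : i < lim by clear -ni nl; lia.
  have i1l : i + 1 < lim by clear -ni nl; lia.
  have i1w : i + 1 < 2 ^ w by clear -i1l lim_lt; lia.
  have w1 : 1 < 2 ^ w by clear -i1w h; lia.
  have ni1 : i < i.+1 <= n.+1 by rewrite ltnSn ltnS.
  have iK : i + K < 2 ^ w by clear -ni Kn ML lim_lt; lia.
  have iin : 0 < i <= n by rewrite h.
  have nxi : wp (CIf (eEq (EArr aRem (EVar vI)) (ENum 0))
       (CArr aNx (EVar vI) (EVar vI))
       (CArr aNx (EVar vI) (EArr aNx (eAdd (EVar vI) (ENum 1)))))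
       (fun s' => exists2 v, v = next_in cand n i & s' = seta (tick s) aNx i v)
       (tick s).
    apply: wp_if_eq => // [||eq0|ne0]; [by simp_ok|by simp_ok; clear -w1; lia| |].
      apply: wp_arr => //; simp_state => //; exists i => //.
      by move: eq0; simp_state => /eqP; rewrite rem // next_in_step // => ->.
    apply: wp_arr => //; [by simp_ok; rewrite w1 |by simp_ok|].
    simp_state; exists (next_in cand n i) => //.
    rewrite addn1 nx // [in RHS]next_in_step // -rem //.
    by case: eqP => // e; case: ne0; rewrite hI.
  apply: wp_seq; apply: (wp_imp nxi) => s1 [v -> ->] {nxi v}.
  apply: wp_seq; apply: wp_arr => //; first by simp_ok.
  apply: wp_seq; apply: wp_arr => //; [by simp_ok; rewrite w1|by simp_ok|].
  simp_state.
  rewrite ?eqxx addn1 ns //.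
  have fin (v : nat) s' : v = next_in (start n K cand) n i ->
      vr s' vI = i -> globals s' -> vr s' vSg = sigma -> input s' ->
      tm s' <= 3 * n + (n - i).+1 -> zero_from 5 s' ->
      (forall p, ar s' aRem p = ar s aRem p) ->
      (forall p, ar s' aNx p = if p == i then next_in cand n i else ar s aNx p) ->
      (forall p, ar s' aNs p = if p == i then v else ar s aNs p) ->
      (forall p, ar s' aF p = if p == i then n.+1 else ar s aF p) ->
      wp (CSet vI (eSub (EVar vI) (ENum 1)))
        (fun s'' => exists2 z0, I z0 s'' & id z0 < id i) s'.
    move=> ev e1 e2 e3 e4 e5 e6 e7 e8 e9 e10.
    apply: wp_set; first by simp_ok; repeat split; clear -i1w w1 h; lia.
    exists i.-1; last by clear -h; rewrite /id; lia.
    rewrite /I; conj; simp_state; try by clear -e5 h ni; lia.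
    + by move=> p pn; rewrite e7 rem.
    + move=> j jn; rewrite e8; case: eqP => [-> //|ne].
      by apply: nx; clear -jn ne; lia.
    + move=> j jn; rewrite e9; case: eqP => [-> //|ne].
      by apply: ns; clear -jn ne; lia.
    + move=> j jn; rewrite e10; case: eqP => [//|ne].
      by apply: ff; clear -jn ne; lia.
  have st : start n K cand i =
      (next_in cand n i < i + K) && (next_in cand n i < n.+1).
    by rewrite /start h ni.
  have z' u : zero_from 5 (seta (seta (seta (tick s) aNx i (next_in cand n i))
      aF i n.+1) aNs i u).
    by do 3 (apply: zero_from_seta => //).
  apply: wp_seq; apply: wp_if_lt; [by simp_ok|by simp_ok| |].
    simp_state; rewrite eqxx => lt1; apply: wp_if_lt; [by simp_ok|by simp_ok| |].
      simp_state; rewrite eqxx => lt2; apply: wp_arr => //; [by simp_ok|].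
      simp_state; apply: (fin i) => //=; simp_state.
      - by rewrite next_in_step // st lt1 lt2.
      - by clear -t; lia.
      - by apply: zero_from_seta.
      - by move=> p; simp_state; case: eqP => //.
    simp_state; rewrite eqxx => ge2; apply: wp_skip.
    apply: (fin (next_in (start n K cand) n i.+1)) => //=; last first.
    - by clear -t; lia.
    - by rewrite [RHS]next_in_step // st lt1 ltnNge ge2.
  simp_state; rewrite eqxx => ge1; apply: wp_skip.
  apply: (fin (next_in (start n K cand) n i.+1)) => //=; last first.
  - by clear -t; lia.
  - by rewrite [RHS]next_in_step // st ltnNge ge1.
- move: h; simp_state => h; have e : i = 0 by clear -h; lia.
  rewrite e in nx ns ff; split=> //; split=> //; clear -t; lia.
Qed.

End Tables.

(** * Encodings in base [M] and the renaming of characters *)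

Lemma pair_inj a b a' b' : b < M -> b' < M -> a * M + b = a' * M + b' ->
  a = a' /\ b = b'.
Proof.
move=> bM bM' e; have [e1 e2] := @decode M a b bM.
have [e3 e4] := @decode M a' b' bM'.
by rewrite e in e1 e2; split; [rewrite -e1 e3 | rewrite -e2 e4].
Qed.

Definition key r f d := (r * M + f) * M + d.

Lemma key_eq r f d r' f' d' : f < M -> d < M -> f' < M -> d' < M ->
  (key r f d == key r' f' d') = [&& r == r', f == f' & d == d'].
Proof.
move=> fM dM fM' dM'; apply/eqP/and3P => [e|[/eqP -> /eqP -> /eqP ->] //].
have [/(pair_inj fM fM') [-> ->] ->] := pair_inj dM dM' e.
by split.
Qed.

(** The clause on [c] makes [r] the least exponent with [sigma < M ^ r], so the number of rounds is
    at most any [c1] known to suffice. *)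
Definition after_names cand r s :=
  [/\ globals s, zero_from 7 s,
      forall i, 0 < i <= n -> ar s aC i = name n M S r i,
      sigma < M ^ r &
  [/\ forall i, 0 < i <= n.+1 -> ar s aNx i = next_in cand n i,
      forall i, 0 < i <= n.+1 -> ar s aNs i = next_in (start n K cand) n i,
      forall i, 0 < i <= n -> ar s aF i = n.+1,
      forall c, sigma < M ^ c -> r <= c & tm s <= 4 * n + r * n.+1]].

Lemma names_correct cand s : after_next cand s ->
  wp prog_names (fun s' => exists r, after_names cand r s') s.
Proof.
move=> [g vs inp z [nx ns ff t]]; have [g1 g2 g3 g4] := g.
have ML := M_lim; have s0 := sigma_gt0.
have M1 : 1 < M by clear; lia.
have M0 : 0 < M by clear; lia.
have ws : sigma < M ^ w.
  have w0 : 0 < w.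
    case: (posnP w) => // w0; move: lim_lt; rewrite w0 expn0.
    by move: ML; clear; lia.
  by apply: (leq_trans sigma_lt); rewrite leq_exp2r.
have w1 : 1 < 2 ^ w by clear -ML lim_lt; lia.
have w2 : 2 < 2 ^ w by clear -ML lim_lt; lia.
apply: wp_seq; apply: wp_set => //.
apply: wp_seq; apply: wp_set => //; first by simp_ok; clear -w1; lia.
simp_state.
pose J s := [/\ globals s,
      forall i, 0 < i <= n.+1 -> ar s aNx i = next_in cand n i,
      forall i, 0 < i <= n.+1 -> ar s aNs i = next_in (start n K cand) n i,
      forall i, 0 < i <= n -> ar s aF i = n.+1 & zero_from 7 s].
pose I r s := [/\ J s, vr s vR = r, vr s vS = sigma %/ M ^ r,
      tm s <= 4 * n + r * n.+1 &
  [/\ forall i, 0 < i <= n -> lo s (i + 2) = nth 0 S i.-1 %/ M ^ r,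
      forall i, 0 < i <= n -> ar s aC i = name n M S r i,
      forall r' f d, r <= r' -> f < M -> d < M -> ar s aT1 (key r' f d) = 0
    & forall c, sigma < M ^ c -> r <= c]].
apply: (wp_while_lt (I := I) (x := 0) (mu := fun r => sigma %/ M ^ r)).
  rewrite /I /J; conj; simp_state.
  - by move=> r i ri; apply: z; clear -ri; lia.
  - by rewrite expn0 divn1.
  - by clear -t; lia.
  - by move=> i iin; rewrite expn0 divn1; case: inp => _ _ _; exact.
  - by move=> i _; rewrite z.
  - by move=> r f d _ _ _; rewrite z.
move=> {g g1 g2 g3 g4 vs inp z t nx ns ff s} r s.
move=> [j hR hS t [hl hC hT hc]].
have [g nx ns ff z] := j; have [g1 g2 g3 g4] := g.
split=> [|//|h|h]; first by simp_ok; clear -w1; lia.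
- have {}h : M ^ r <= sigma.
    by move: h; simp_state; rewrite divn_gt0 // expn_gt0 M0.
  (* Since [sigma < 2 ^ w <= M ^ w], at most [w] rounds have work to do; [lim_names] reserves table
     rows accordingly. *)
  have rw : r <= w by exact: hc.
  have keyb f d : f < M -> d < M -> key r f d < lim.
    move=> fM dM; apply: leq_trans lim_names; rewrite /key.
    have e1 : r * M + f < w.+1 * M.
      have : r * M <= w * M by rewrite leq_mul2r rw orbT.
      by rewrite mulSn; clear -fM; lia.
    have : (r * M + f).+1 * M <= w.+1 * M * M by rewrite leq_mul2r e1 orbT.
    by rewrite mulSn; clear -dM; move: ((r * M + f) * M) => u; lia.
  apply: wp_seq.
  (* Positions up to [i] already carry the names and quotients of round [r.+1], the others still
     those of round [r]. *)
  pose I2 i s := [/\ J s, vr s vR = r, vr s vS = sigma %/ M ^ r,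
      tm s <= 4 * n + r * n.+1 + i.+1 &
    [/\ vr s vI = i.+1, i <= n,
      forall a, 0 < a <= n ->
        lo s (a + 2) = nth 0 S a.-1 %/ M ^ (if a <= i then r.+1 else r),
      forall a, 0 < a <= n ->
        ar s aC a = name n M S (if a <= i then r.+1 else r) a
    & (forall r' f d, r < r' -> f < M -> d < M -> ar s aT1 (key r' f d) = 0) /\
      (forall f d, f < M -> d < M -> ar s aT1 (key r f d) =
        first_in (fun b => (name n M S r b == f) && (digit M S r b == d)) i)]].
  apply: wp_seq; apply: wp_set; first by simp_ok; clear -w1; lia.
  apply: (wp_while_lt (I := I2) (x := 0) (mu := fun i => n - i)).
    rewrite /I2 /J; conj; simp_state.
    + by clear -t; lia.
    + by move=> a /andP[a0 an]; rewrite leqNgt a0 hl // a0.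
    + by move=> a /andP[a0 an]; rewrite leqNgt a0 hC // a0.
    + by move=> r' f d rr; apply: hT; exact: ltnW.
    + by move=> f d fM dM; rewrite hT.
  move=> {g g1 g2 g3 g4 j z t nx ns ff hR hS hl hC hT s} i s.
  move=> [j hR hS t [hI ni hl hC [hT hT2]]].
  have [g nx ns ff z] := j; have [g1 g2 g3 g4] := g.
  split=> // [lt|ge].
    have {}lt : i < n by move: lt; simp_state.
    have iin : 0 < i.+1 <= n by [].
    have e1 : lo s (i.+1 + 2) = nth 0 S i %/ M ^ r by rewrite hl // ltnn.
    have e2 : ar s aC i.+1 = name n M S r i.+1 by rewrite hC // ltnn.
    have fM : name n M S r i.+1 < M by rewrite (leq_ltn_trans (name_le _ _ _ _ _)) //; clear; lia.
    have dM : digit M S r i.+1 < M by rewrite ltn_mod.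
    have i1l : i.+1 < lim by clear -lt ML; lia.
    have i2w : i.+1 + 2 < 2 ^ w by clear -lt ML lim_lt; lia.
    have i1o : i.+1 + 2 < off by clear -lt; lia.
    have kb := keyb _ _ fM dM.
    have kw : key r (name n M S r i.+1) (digit M S r i.+1) < 2 ^ w.
      exact: ltn_trans kb lim_lt.
    have kw1 : (r * M + name n M S r i.+1) * M < 2 ^ w.
      by apply: leq_ltn_trans kw; exact: leq_addr.
    have kw2 : r * M + name n M S r i.+1 < 2 ^ w.
      by apply: leq_ltn_trans kw1; rewrite leq_pmulr.
    have kw3 : r * M < 2 ^ w by apply: leq_ltn_trans kw2; exact: leq_addr.
    apply: wp_seq; apply: wp_set.
      by simp_ok; rewrite e2 e1; repeat split.
    have ek : (r * M + name n M S r i.+1) * M + (nth 0 S i %/ M ^ r) %% M =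
      key r (name n M S r i.+1) (digit M S r i.+1) by [].
    simp_state; rewrite e2 e1 ek.
    set ky := key _ _ _ in kb kw *.
    set A := fun b => (name n M S r b == name n M S r i.+1) &&
                      (digit M S r b == digit M S r i.+1).
    have Ai : A i.+1 by rewrite /A !eqxx.
    have oldT : ar s aT1 ky = first_in A i by rewrite /ky hT2.
    (* Position [i.+1] satisfies [A] itself, so a search beyond it finds nothing smaller: the table
       entry is final when it is read. *)
    have newT : first_in A i.+1 = name n M S r.+1 i.+1.
      by rewrite -(first_in_stable (b := n) _ Ai).
    have tab : wp (CIf (eEq (EArr aT1 (EVar vKey)) (ENum 0))
         (CArr aT1 (EVar vKey) (EVar vI)) CSkip)
       (fun s' => exists a, [/\ s' = State (vr (setv (tick s) vKey ky)) a (lo s) (tm s).+1,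
          forall r' i', r' != aT1 -> a r' i' = ar s r' i'
          & forall i', a aT1 i' = if i' == ky then name n M S r.+1 i.+1
                                   else ar s aT1 i']) (setv (tick s) vKey ky).
      apply: wp_if_eq => [||eq0|ne0]; [by simp_ok|by simp_ok; clear -w1; lia| |].
        apply: wp_arr => //.
        eexists; split; first by rewrite /seta; reflexivity.
          by move=> r' i' nr; simp_state; rewrite -[eqn r' 5]/(r' == 5) (negbTE nr).
        move=> i'; simp_state; case: eqP => // _.
        by rewrite -newT /= -oldT; move: eq0; simp_state => ->; rewrite /= Ai.
      apply: wp_skip; exists (ar s); split=> // i'; case: eqP => [->|//].
      rewrite -newT /= -oldT; move: ne0; simp_state => /eqP.
      by rewrite oldT => ne0; rewrite ne0.
    apply: wp_seq; apply: (wp_imp tab) => s1 [a [-> ha1 ha2]] {tab s1}.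
    apply: wp_seq; apply: wp_arr => //; first by simp_ok; repeat split.
    simp_state; rewrite ha2 eqxx.
    apply: wp_seq; apply: wp_low; [by simp_ok; repeat split|by simp_ok; repeat split|by simp_ok|].
    simp_state; rewrite e1.
    apply: wp_set; first by simp_ok; repeat split; clear -i2w w1; lia.
    simp_state; exists i.+1; last by clear -lt; lia.
    rewrite /I2 /J; conj; simp_state; rewrite ?ha1 //.
    + by move=> b bn; rewrite ha1 // nx.
    + by move=> b bn; rewrite ha1 // ns.
    + by move=> b bn; rewrite ha1 // ff.
    + move=> r' i' r7; rewrite /= -[eqn r' 6]/(r' == 6).
      have -> : (r' == 6) = false by clear -r7; lia.
      rewrite ha1; last by clear -r7; lia.
      exact: z.
    + by clear -t; lia.
    + by clear; lia.
    + move=> b bn; have -> : (b + 2 == i.+1 + 2) = (b == i.+1) by clear; lia.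
      case: eqP => [->|ne]; first by rewrite leqnn expnSr divnMA.
      rewrite hl //; have -> // : (b <= i.+1) = (b <= i) by clear -ne; lia.
    + move=> b bn; case: eqP => [->|ne]; first by rewrite leqnn.
      rewrite ha1 // hC //; have -> // : (b <= i.+1) = (b <= i) by clear -ne; lia.
    + move=> r' f d rr fM' dM'; rewrite ha2 /ky key_eq //.
      by rewrite gtn_eqF //= hT.
    + move=> f d fM' dM'; rewrite ha2 /ky key_eq // eqxx.
      case: (eqVneq f (name n M S r i.+1)) => [->|nf].
        case: (eqVneq d (digit M S r i.+1)) => [->|nd].
          by rewrite -newT.
        by rewrite hT2 // first_in_skip //= [_ == d]eq_sym (negbTE nd) andbF.
      by rewrite hT2 // first_in_skip //= [_ == f]eq_sym (negbTE nf).
  have {}ge : i = n by move: ge; simp_state => ge; clear -ge ni; lia.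
  rewrite ge in hl hC hT2 t.
  apply: wp_seq; apply: wp_set => //.
  apply: wp_set; first by simp_ok; repeat split => //; clear -rw lim_lt ML lim_names; nia.
  exists r.+1; last first.
    rewrite expnSr divnMA; apply: ltn_Pdiv => //.
    by rewrite divn_gt0 // expn_gt0 M0.
  rewrite /I /J; conj; simp_state.
  + by clear; lia.
  + by rewrite expnSr divnMA.
  + by clear -t; lia.
  + by move=> a /andP[a0 an]; rewrite hl ?a0 // an.
  + by move=> a /andP[a0 an]; rewrite hC ?a0 // an.
  + move=> c sc; rewrite ltnNge; apply/negP => cr.
    have : M ^ c <= M ^ r by rewrite leq_exp2l.
    by clear -sc h; lia.
- exists r; split=> //; first by move: h; simp_state; rewrite leqNgt divn_gt0 ?expn_gt0 ?M0 // -ltnNge.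
Qed.

(** * Classes of substrings and incidence lists *)

Section Levels.

Variables (cand : pred nat) (rd : nat).
Hypothesis cands_good : good_cands cand.
Hypothesis names_ok : sigma < M ^ rd.

Local Notation C := (name n M S rd).
Local Notation st := (start n K cand).
Local Notation Fl := (F n K cand C).
Local Notation ev := (event n K cand C).
Local Notation mk := (marked n K cand C).
Local Notation incd := (inc n K cand C M).

Let cand_in : forall p, cand p -> 0 < p <= n.
Proof. by case: cands_good. Qed.

Let cand_ctx : same_context n K S cand.
Proof. by case: cands_good. Qed.

Let M_gt : n.+1 < M.
Proof. by clear; lia. Qed.

Let M_gt0 : 0 < M.
Proof. by clear; lia. Qed.

Let C_char : forall i j, 0 < i <= n -> 0 < j <= n ->
  (C i == C j) = (nth 0 S i.-1 == nth 0 S j.-1).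
Proof.
move=> i j iin jin; rewrite nameP //.
have small a : 0 < a <= n -> nth 0 S a.-1 < M ^ rd.
  move=> ain; apply: leq_ltn_trans names_ok.
  have /S_in /andP[] // : nth 0 S a.-1 \in S.
  by rewrite mem_nth // sizeS; clear -ain; lia.
by rewrite !modn_small ?small.
Qed.

Let st_in i : st i -> 0 < i <= n.
Proof. exact: start_in. Qed.

Let Fl_lt l i : Fl l i < M.
Proof.
have : Fl l i < n.+2 by exact: (F_lt _ sizeS cand_in C_char).
by move=> h; apply: (leq_trans h); clear; lia.
Qed.

Let Fl_neq0 l i : 0 < l -> (Fl l i != 0) = valid n K cand l i.
Proof. exact: (F_neq0 _ sizeS cand_in C_char). Qed.

(** The loops jump along pointers. The predicates in their invariants fail on the skipped positions,
    and the gap lemmas carry the invariants across. *)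
Lemma iota_gap i j : 0 < i <= j -> iota 1 j.-1 = iota 1 i.-1 ++ iota i (j - i).
Proof.
move=> ij; have -> : j.-1 = i.-1 + (j - i) by clear -ij; lia.
by rewrite iotaD; congr (_ ++ iota _ _); clear -ij; lia.
Qed.

Lemma has_gap (P : pred nat) i j : 0 < i <= j ->
  (forall b, i <= b < j -> ~~ P b) -> has P (iota 1 j.-1) = has P (iota 1 i.-1).
Proof.
move=> ij h; rewrite (iota_gap ij) has_cat orbC (_ : has P (iota i _) = false) //.
apply/negbTE/hasPn => b; rewrite mem_iota => bi; apply: h.
by clear -bi ij; lia.
Qed.

Lemma count_gap (P : pred nat) i j : 0 < i <= j ->
  (forall b, i <= b < j -> ~~ P b) ->
  count P (iota 1 j.-1) = count P (iota 1 i.-1).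
Proof.
move=> ij h; rewrite (iota_gap ij) count_cat -[RHS]addn0; congr addn.
apply/eqP; rewrite -leqn0 leqNgt -has_count.
apply/hasPn => b; rewrite mem_iota => bi; apply: h.
by clear -bi ij; lia.
Qed.

Lemma first_in_gap (P : pred nat) i j : 0 < i <= j ->
  (forall b, i <= b < j -> ~~ P b) -> first_in P j.-1 = first_in P i.-1.
Proof.
move=> /andP[i0]; elim: j => [|j IH]; first by clear -i0; lia.
rewrite leq_eqVlt => /orP[/eqP -> //|]; rewrite ltnS => ij h.
rewrite -IH //; last by move=> b /andP[ib bj]; apply: h; rewrite ib ltnW.
case: j ij h {IH} => [|j] ij h; first by clear -ij i0; lia.
by apply: first_in_skip; apply: h; rewrite ij ltnSn.
Qed.

Lemma first_in_step (P : pred nat) i : 0 < i ->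
  first_in P i = if first_in P i.-1 != 0 then first_in P i.-1
                 else if P i then i else 0.
Proof. by case: i. Qed.

Lemma first_in_pred (P : pred nat) i : 0 < i -> ~~ P i ->
  first_in P i = first_in P i.-1.
Proof. by case: i => // i _; exact: first_in_skip. Qed.

Lemma has_iotaS (P : pred nat) i : 0 < i ->
  has P (iota 1 i) = has P (iota 1 i.-1) || P i.
Proof.
case: i => // i _; rewrite -{1}[i.+1]addn1 iotaD has_cat /= orbF add1n.
by [].
Qed.

Lemma count_iotaS (P : pred nat) i : 0 < i ->
  count P (iota 1 i) = count P (iota 1 i.-1) + P i.
Proof.
case: i => // i _; rewrite -{1}[i.+1]addn1 iotaD count_cat /= addn0 add1n.
by [].
Qed.

Definition static s :=
  [/\ globals s,
      forall i, 0 < i <= n.+1 -> ar s aNx i = next_in cand n i,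
      forall i, 0 < i <= n.+1 -> ar s aNs i = next_in st n i
    & forall i, 0 < i <= n -> ar s aC i = C i].

Definition plist s e := [seq ar s aEP (e * M + j) | j <- iota 0 (ar s aEC e)].
Definition elist s p := [seq ar s aPE (p * M + j) | j <- iota 0 (ar s aPC p)].

(** Both families of lists represent the same relation without repetition; [aCN] equals the degree
    because nothing is covered yet. *)
Definition adjacency s (I : nat -> nat -> bool) :=
  [/\ forall e, uniq (plist s e), forall p, uniq (elist s p),
      forall e p, (p \in plist s e) = I e p,
      forall e p, (e \in elist s p) = I e p & forall p, ar s aCN p = ar s aPC p].

Lemma adjacency_ext s s' (I I' : nat -> nat -> bool) :
  (forall r j, r \in [:: aEP; aEC; aPE; aPC; aCN] -> ar s' r j = ar s r j) ->
  (forall e p, I e p = I' e p) -> adjacency s I -> adjacency s' I'.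
Proof.
move=> fr ii [h1 h2 h3 h4 h5].
have pe e : plist s' e = plist s e.
  by rewrite /plist fr //; apply: eq_map => j; rewrite fr.
have ep p : elist s' p = elist s p.
  by rewrite /elist fr //; apply: eq_map => j; rewrite fr.
split=> [e|p|e p|e p|p]; rewrite ?pe ?ep ?h3 ?h4 //.
by rewrite !fr.
Qed.

Lemma adjacency_sizes s I : adjacency s I -> (forall e p, I e p -> incd e p) ->
  (forall e, ar s aEC e <= n) /\ (forall p, ar s aPC p <= n + n).
Proof.
move=> [h1 h2 h3 h4 _] sub; split=> [e|p].
  have <- : size (plist s e) = ar s aEC e by rewrite size_map size_iota.
  rewrite -[X in _ <= X](size_iota 1); apply: uniq_leq_size => // p.
  rewrite h3 => /sub /inc_cand /cand_in; by rewrite mem_iota add1n ltnS.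
have <- : size (elist s p) = ar s aPC p by rewrite size_map size_iota.
apply: (elements_bound (K := K) sizeS cand_in C_char (M := M)) => // e.
by rewrite h4 => /sub; exists p.
Qed.

(** [~~ I e q] keeps the lists free of repetition; containment of [I] in the true incidence keeps
    their lengths below [M], so list cells do not collide. *)
Lemma link_correct s I e q (Q : state -> Prop) :
  vr s vM = M -> vr s vE = e -> vr s vQ = q -> e < M * M -> q < M ->
  adjacency s I -> (forall e p, I e p -> incd e p) -> ~~ I e q ->
  (forall a, (forall r j, r \notin [:: aEP; aEC; aPE; aPC; aCN] ->
        a r j = ar s r j) ->
     (forall p, a aPC p = ar s aPC p + (p == q)) ->
     adjacency (State (vr s) a (lo s) (tm s))
       (fun e' p' => I e' p' || ((e' == e) && (p' == q))) ->
     Q (State (vr s) a (lo s) (tm s))) ->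
  wp prog_link Q s.
Proof.
move=> g3 hE hQ eM qM adj sub nI post; have ML := M_lim.
have [sz1 sz2] := adjacency_sizes adj sub.
have w1 : 1 < 2 ^ w by clear -ML lim_lt n_gt0; lia.
have ec1 := sz1 e; have pc1 := sz2 q.
have ecM e' : ar s aEC e' < M by apply: leq_ltn_trans (sz1 e') _; clear; lia.
have pcM p' : ar s aPC p' < M by apply: leq_ltn_trans (sz2 p') _; clear; lia.
have MM : M * M <= lim by apply: leq_trans lim_cube; rewrite leq_pmulr.
have b1 : e * M + ar s aEC e < lim.
  apply: leq_trans lim_cube.
  have : e.+1 * M <= M * M * M by rewrite leq_mul2r eM orbT.
  by have := ecM e; rewrite mulSn; clear; move: (e * M) => u; lia.
have b2 : q * M + ar s aPC q < lim by apply: leq_trans MM; apply: M2_lim.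
have b3 : e < lim by apply: leq_trans MM.
have b4 : q < lim by apply: ltn_trans qM ML.
have b1w : e * M + ar s aEC e < 2 ^ w by apply: ltn_trans lim_lt.
have b2w : q * M + ar s aPC q < 2 ^ w by apply: ltn_trans lim_lt.
have b5 : e * M < 2 ^ w by apply: leq_ltn_trans b1w; exact: leq_addr.
have b6 : q * M < 2 ^ w by apply: leq_ltn_trans b2w; exact: leq_addr.
have b7 : ar s aEC e + 1 < 2 ^ w by clear -ec1 ML lim_lt; lia.
have b8 : ar s aPC q + 1 < 2 ^ w by clear -pc1 ML lim_lt; lia.
apply: wp_seq; apply: wp_arr; [by simp_ok; repeat split|by []|by []|by simp_ok|].
simp_state; apply: wp_seq; apply: wp_arr;
  [by []|by simp_ok; repeat split|by []|by simp_ok|].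
simp_state; apply: wp_seq; apply: wp_arr;
  [by simp_ok; repeat split|by []|by []|by simp_ok|].
simp_state; apply: wp_seq; apply: wp_arr;
  [by []|by simp_ok; repeat split|by []|by simp_ok|].
simp_state; apply: wp_arr; [by []|by simp_ok; repeat split|by []|by simp_ok|].
simp_state; rewrite eqxx.
have [h1 h2 h3 h4 h5] := adj.
rewrite /seta; cbn [vr ar lo tm]; apply: post.
- move=> r j; rewrite !inE !negb_or => /and5P[n1 n2 n3 n4 n5].
  rewrite -[eqn r 10]/(r == 10) -[eqn r 11]/(r == 11) -[eqn r 12]/(r == 12).
  rewrite -[eqn r 13]/(r == 13) -[eqn r 14]/(r == 14).
  by rewrite (negbTE n1) (negbTE n2) (negbTE n3) (negbTE n4) (negbTE n5).
- by move=> p; simp_state; case: eqP => [->|_]; rewrite ?addn0.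
set s' := State _ _ _ _.
have pl e' : plist s' e' = if e' == e then rcons (plist s e) q else plist s e'.
  rewrite /plist /s'; simp_state; case: (eqVneq e' e) => [->|ne].
    rewrite iotaD map_cat cats1 /= add0n eqxx; congr rcons.
    apply/eq_in_map => j; rewrite mem_iota /= add0n => je.
    by rewrite eqn_add2l ltn_eqF.
  apply/eq_in_map => j; rewrite mem_iota /= add0n => je; rewrite ifF //.
  have jM : j < M by exact: ltn_trans je (ecM _).
  apply/eqP => /(pair_inj jM (ecM _)) [e1 _].
  by rewrite e1 eqxx in ne.
have el p' : elist s' p' = if p' == q then rcons (elist s q) e else elist s p'.
  rewrite /elist /s'; simp_state; case: (eqVneq p' q) => [->|ne].
    rewrite iotaD map_cat cats1 /= add0n eqxx; congr rcons.
    apply/eq_in_map => j; rewrite mem_iota /= add0n => je.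
    by rewrite eqn_add2l ltn_eqF.
  apply/eq_in_map => j; rewrite mem_iota /= add0n => je; rewrite ifF //.
  have jM : j < M by exact: ltn_trans je (pcM _).
  apply/eqP => /(pair_inj jM (pcM _)) [e1 _].
  by rewrite e1 eqxx in ne.
split=> [e'|p'|e' p'|e' p'|p'].
- by rewrite pl; case: ifP => // _; rewrite rcons_uniq h3 nI h1.
- by rewrite el; case: ifP => // _; rewrite rcons_uniq h4 nI h2.
- rewrite pl; case: (eqVneq e' e) => [->|ne]; rewrite ?mem_rcons ?inE h3 ?orbF //.
  by rewrite orbC.
- rewrite el; case: (eqVneq p' q) => [->|ne].
    by rewrite mem_rcons inE h4 andbT orbC.
  by rewrite h4 andbF orbF.
- by rewrite /s'; simp_state; case: eqP => // _; rewrite h5.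
Qed.

Local Notation Qs := [seq p <- iota 1 n | cand p].

(** The number of incidences recorded so far. Every iteration of the linking loop adds one, so this
    quantity pays for its ticks. *)
Definition links s := \sum_(p <- Qs) ar s aPC p.

Lemma links_step s s' q : cand q ->
  (forall p, ar s' aPC p = ar s aPC p + (p == q)) -> links s' = (links s).+1.
Proof.
move=> cq h; rewrite /links (eq_bigr (fun p => ar s aPC p + (p == q))) //.
rewrite big_split /= -[RHS]addn1; congr (_ + _).
rewrite (bigD1_seq q) /= ?eqxx ?filter_uniq ?iota_uniq //; last first.
  by rewrite mem_filter cq mem_iota add1n ltnS cand_in.
by rewrite big1 ?addn0 // => p /negbTE ->.
Qed.

Section Level.

Variable l : nat.
Hypothesis l_in : 0 < l <= K.

Definition table_key f c b :=
  [&& valid n K cand l b, Fl l.-1 b == f & C (b + l.-1) == c].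

Definition table_fact (a : nat -> nat -> nat) b :=
  (forall l' f c, l < l' -> f < M -> c < M -> a aT2 (key l' f c) = 0) /\
  (forall f c, f < M -> c < M -> a aT2 (key l f c) = first_in (table_key f c) b).

Definition mark_pred f b := ev l b && ((f == Fl l.-1 b) || (f == b)).

Definition mark_fact (a : nat -> nat -> nat) b :=
  (forall l' f, l < l' -> f < M -> a aMk (l' * M + f) = 0) /\
  (forall f, f < M -> a aMk (l * M + f) = has (mark_pred f) (iota 1 b)).

(** In the middle of a scan, starts below [i] have their class at length [l] and the others still at
    [l.-1]. Ticks are counted per start, not per position. *)
Definition class_inv s0 i s :=
  [/\ static s, vr s vL = l, 0 < i <= n.+1,
      tm s <= tm s0 + count st (iota 1 i.-1) &
  [/\ forall r j, r \notin [:: aF; aT2; aMk] -> ar s r j = ar s0 r j,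
      forall a, st a -> ar s aF a = Fl (if a < i then l else l.-1) a,
      table_fact (ar s) i.-1 & mark_fact (ar s) i.-1]].

Lemma class_inv_gap s0 i j s : class_inv s0 i s -> i <= j <= n.+1 ->
  (forall b, i <= b < j -> ~~ st b) -> class_inv s0 j s.
Proof.
move=> [h1 h2 /andP[i0 i1] h4 [h5 h6 [h7 h7'] [h8 h8']]] /andP[ij jn] gap.
have i0j : 0 < i <= j by rewrite i0.
split=> //; [by clear -i0j jn; lia|by rewrite (count_gap i0j gap)|].
split=> //.
- move=> a sa; rewrite h6 //; congr (Fl _ _).
  case: (ltnP a i) => ai; first by rewrite (leq_trans ai ij).
  by case: (ltnP a j) => // aj; have := gap a; rewrite ai aj sa => /(_ isT).
- split=> // f c fM cM; rewrite h7' // (first_in_gap i0j) // => b /gap.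
  by apply: contra => /and3P[/andP[]].
- split=> // f fM; rewrite h8' // (has_gap i0j) // => b /gap.
  by apply: contra => /andP[/and4P[]].
Qed.

Lemma table_key_self i : valid n K cand l i ->
  first_in (table_key (Fl l.-1 i) (C (i + l.-1))) i = Fl l i.
Proof.
move=> vi; have iin : 0 < i <= n by case/andP: vi => /st_in.
rewrite -(first_in_stable iin); last by rewrite /table_key vi !eqxx.
by rewrite /table_key; move: l_in vi; case: (l) => // m _ vi; rewrite /= vi.
Qed.

Lemma class_step s0 i s : class_inv s0 i s -> vr s vI = i -> st i ->
  wp prog_class
   (fun s' => class_inv s0 i.+1 s' /\ vr s' vI = i) (tick s).
Proof.
move=> [sta vl _ t [fr hF hT hM]] hI si.
have [g nx ns hC] := sta; have [g1 g2 g3 g4] := g.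
have ML := M_lim; have Kn := K_bounds.
have /andP[i0 iN] := st_in si.
have w1 : 2 < 2 ^ w by clear -ML lim_lt n_gt0; lia.
have w0 : 0 < 2 ^ w by clear -w1; lia.
have il : i < lim by clear -iN ML; lia.
have lM : l < M by clear -l_in Kn; lia.
have lK : l <= n by clear -l_in Kn; lia.
have [l0 _] := andP l_in.
have MM : M * M <= lim.
  by apply: leq_trans lim_cube; rewrite leq_pmulr.
have cellb f : f < M -> l * M + f < lim.
  by move=> fM; apply: leq_trans MM; apply: M2_lim.
have keyb f c : f < M -> c < M -> key l f c < lim.
  move=> fM cM; apply: leq_trans lim_cube; rewrite /key.
  have e1 := M2_lim lM fM.
  have : (l * M + f).+1 * M <= M * M * M by rewrite leq_mul2r e1 orbT.
  by rewrite mulSn; clear -cM; move: ((l * M + f) * M) => u; lia.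
have fi : ar s aF i = Fl l.-1 i by rewrite hF // ltnn.
have fM := Fl_lt l.-1 i.
apply: wp_seq; apply: wp_set; first by simp_ok.
simp_state; rewrite fi.
have stepF a s' : (forall b, ar s' aF b = if b == i then Fl l i else ar s aF b) ->
   st a -> ar s' aF a = Fl (if a < i.+1 then l else l.-1) a.
  move=> e sa; rewrite e; case: eqP => [->|ne]; first by rewrite ltnSn.
  by rewrite hF //; congr (Fl _ _); have -> : (a < i.+1) = (a < i) by clear -ne; lia.
have tstep : (tm s).+1 <= tm s0 + count st (iota 1 i).
  by rewrite count_iotaS // si addnA addn1 ltnS.
have skipT a : ~~ valid n K cand l i -> table_fact a i.-1 -> table_fact a i.
  move=> nv [h1 h2]; split=> // f c fM' cM; rewrite h2 //.
  by rewrite [RHS]first_in_pred // /table_key (negbTE nv).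
have skipM a : ~~ ev l i -> mark_fact a i.-1 -> mark_fact a i.
  move=> nv [h1 h2]; split=> // f fM'; rewrite h2 // [in RHS]has_iotaS //.
  by rewrite [X in _ || X]/mark_pred (negbTE nv) orbF.
apply: wp_if_eq => [||f0|fn0]; [by []|by simp_ok| |].
  apply: wp_skip; move: f0; simp_state => f0.
  have nv : ~~ valid n K cand l i.
    apply/negP => vi; move: f0.
    case: (l) l0 vi => // [[|m]] _ vi /=; first by rewrite si.
    apply/eqP; rewrite -/(Fl m.+1 i) Fl_neq0 //.
    by case/andP: vi => sv v; rewrite /valid sv /=; clear -v; lia.
  split=> //; split=> //; split=> //.
  - move=> a sa; apply: stepF => // b; case: eqP => [->|//].
    rewrite fi f0; apply/esym/eqP; apply: contraNT nv; by rewrite Fl_neq0.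
  - exact: skipT.
  - by apply: skipM => //; rewrite /event f0 eqxx andbF.
move: fn0; simp_state => fn0.
have A1 : wp (CIf (eLt (eAdd (EVar vI) (EVar vL)) (eAdd (EVar vN1) (ENum 1)))
          (CSet vKey (cell (cell (EVar vL) (EVar vF))
             (EArr aC (eSub (eAdd (EVar vI) (EVar vL)) (ENum 1)))) ;;
           CIf (eEq (EArr aT2 (EVar vKey)) (ENum 0))
             (CArr aT2 (EVar vKey) (EVar vI)) CSkip ;;
           CSet vG (EArr aT2 (EVar vKey)))
          (CSet vG (ENum 0)))
   (fun s1 => exists v a, [/\ s1 = State v a (lo s) (tm s).+1,
      v vG = Fl l i, forall x, x \notin [:: vKey; vG] ->
        v x = vr (setv (tick s) vF (Fl l.-1 i)) x,
      forall r' j, r' != aT2 -> a r' j = ar s r' j & table_fact a i])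
   (setv (tick s) vF (Fl l.-1 i)).
  have b1 : i + l < 2 ^ w by clear -iN lK ML lim_lt; lia.
  have b2 : n.+1 + 1 < 2 ^ w by clear -ML lim_lt; lia.
  apply: wp_if_lt; [by simp_ok; repeat split|
    by simp_ok; repeat split; clear -w1 b2; lia| |]; simp_state => hv.
  - have vi : valid n K cand l i by rewrite /valid si /=; clear -hv; lia.
    have cin : 0 < i + l - 1 <= n by clear -hv i0 l0; lia.
    have el : i + l - 1 = i + l.-1 by clear -l0; lia.
    have ec : ar s aC (i + l - 1) = C (i + l.-1) by rewrite hC // el.
    have cM : C (i + l.-1) < M.
      by rewrite (leq_ltn_trans (name_le _ _ _ _ _)) //; clear; lia.
    have kb := keyb _ _ fM cM.
    have kw : key l (Fl l.-1 i) (C (i + l.-1)) < 2 ^ w by exact: ltn_trans kb lim_lt.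
    have kw1 : (l * M + Fl l.-1 i) * M < 2 ^ w.
      by apply: leq_ltn_trans kw; exact: leq_addr.
    have kw2 : l * M + Fl l.-1 i < 2 ^ w.
      by apply: leq_ltn_trans kw1; rewrite leq_pmulr.
    have kw3 : l * M < 2 ^ w by apply: leq_ltn_trans kw2; exact: leq_addr.
    have cl : i + l - 1 < lim by clear -cin ML; lia.
    have b3 : 0 < i + l < 2 ^ w by rewrite b1 andbT; clear -i0; lia.
    apply: wp_seq; apply: wp_set.
      by simp_ok; rewrite ec; repeat split => //; clear -w1; lia.
    simp_state; rewrite ec -/(key l _ _).
    set f := Fl l.-1 i in fM kb kw *; set c := C (i + l.-1) in cM kb kw *.
    have [T1 T2] := hT.
    have oldT := T2 f c fM cM.
    have newT := table_key_self vi; rewrite -/f -/c in newT.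
    have self : table_key f c i by rewrite /table_key vi !eqxx.
    have upd a : (forall j, a aT2 j = if j == key l f c then Fl l i else ar s aT2 j) ->
        table_fact a i.
      move=> ha; split=> [l' f' c' ll fM' cM'|f' c' fM' cM'].
        by rewrite ha key_eq // (gtn_eqF ll) /= T1.
      rewrite ha key_eq // eqxx /=.
      case: (eqVneq f' f) => [->|nf] /=.
        case: (eqVneq c' c) => [->|nc] /=; first by rewrite newT.
        by rewrite T2 // [RHS]first_in_pred // /table_key -/c [c == _]eq_sym (negbTE nc) !andbF.
      by rewrite T2 // [RHS]first_in_pred // /table_key -/f [f == _]eq_sym (negbTE nf) !andbF.
    apply: wp_seq; apply: wp_if_eq => [||eq0|ne0]; [by simp_ok|by simp_ok| |].
      move: eq0; simp_state => eq0.
      apply: wp_arr => //; apply: wp_set; first by simp_ok.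
      simp_state; rewrite eqxx.
      have eg : i = Fl l i.
        by rewrite -newT first_in_step // -oldT eq0 /= self.
      eexists _, _; split; first by rewrite /setv /seta /=; reflexivity.
      - by simp_state.
      - move=> x; rewrite !inE negb_or => /andP[x1 x2]; simp_state.
        by rewrite -[eqn x 16]/(x == 16) -[eqn x 13]/(x == 13) (negbTE x1) (negbTE x2).
      - by move=> r' j nr; simp_state; rewrite -[eqn r' 7]/(r' == 7) (negbTE nr).
      - by apply: upd => j; simp_state; rewrite -eg.
    move: ne0; simp_state => ne0; apply: wp_skip; apply: wp_set; first by simp_ok.
    have eg : ar s aT2 (key l f c) = Fl l i.
      by rewrite -newT [RHS]first_in_step // -oldT; case: eqP.
    simp_state; eexists _, _; split; first by rewrite /setv /=; reflexivity.
    - by simp_state.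
    - move=> x; rewrite !inE negb_or => /andP[x1 x2]; simp_state.
      by rewrite -[eqn x 16]/(x == 16) -[eqn x 13]/(x == 13) (negbTE x1) (negbTE x2).
    - by [].
    - by apply: upd => j; case: eqP => // ->.
  - have nv : ~~ valid n K cand l i by rewrite /valid si /=; clear -hv; lia.
    apply: wp_set; first by simp_ok.
    simp_state; eexists _, _; split; first by rewrite /setv /=; reflexivity.
    - simp_state; apply/esym/eqP; apply: contraNT nv; by rewrite Fl_neq0.
    - move=> x; rewrite !inE negb_or => /andP[x1 x2]; simp_state.
      by rewrite -[eqn x 16]/(x == 16) (negbTE x2).
    - by [].
    - exact: skipT.
apply: wp_seq; apply: (wp_imp A1) => s1 [v [a [-> hg hv ha ht]]] {A1 s1}.
have v0 : v vN = n by rewrite hv.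
have v3 : v vN1 = n.+1 by rewrite hv.
have v4 : v vM = M by rewrite hv.
have v5 : v vK = K by rewrite hv.
have v10 : v vI = i by rewrite hv.
have v14 : v vL = l by rewrite hv.
have v15 : v vF = Fl l.-1 i by rewrite hv.
apply: wp_seq; apply: wp_set.
  by simp_ok; repeat split => //; case: eqP; case: eqP => _ _ /=; clear -w1; lia.
simp_state; rewrite hg v10.
set e := (_ == 0) + _.
(* [e] adds the tests for class 0 and class [i], so it is nonzero exactly when the last disjunction
   of [event] holds. *)
have evE : ev l i = (Fl l.-1 i != i) && (e != 0).
  rewrite /event si /=; move/eqP: (fn0) => ->; rewrite /= /e.
  by case: (Fl l i == 0) => //=; case: (Fl l i == i).
have mi : i < M by clear -iN; lia.
set s1 := setv _ _ _.
have u4 : vr s1 vM = M by [].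
have u10 : vr s1 vI = i by [].
have u14 : vr s1 vL = l by [].
have u15 : vr s1 vF = Fl l.-1 i by [].
have u17 : vr s1 vE = e by [].
have A2 : wp (CIf (eEq (EVar vF) (EVar vI)) CSkip
          (CIf (eEq (EVar vE) (ENum 0)) CSkip
             (CArr aMk (cell (EVar vL) (EVar vF)) (ENum 1) ;;
              CArr aMk (cell (EVar vL) (EVar vI)) (ENum 1))))
   (fun s2 => exists a', [/\ s2 = State (vr s1) a' (lo s) (tm s).+1,
      forall r' j, r' != aMk -> a' r' j = a r' j & mark_fact a' i]) s1.
  have hMa : mark_fact a i.-1.
    by case: hM => h1 h2; split=> *; rewrite ha //; [apply: h1 | apply: h2].
  apply: wp_if_eq => // [fe|fne].
    apply: wp_skip; exists a; split=> //; apply: skipM => //.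
    by move: fe; simp_state; rewrite evE => ->; rewrite eqxx.
  move: fne; simp_state => fne.
  apply: wp_if_eq => [||ee|ene]; [by []|by simp_ok| |].
    apply: wp_skip; exists a; split=> //; apply: skipM => //.
    by rewrite evE; move: ee; simp_state => ->; rewrite eqxx andbF.
  move: ene; simp_state => ene.
  have evi : ev l i by rewrite evE; apply/andP; split; apply/eqP.
  have cw f : f < M -> l * M + f < 2 ^ w.
    by move=> /cellb h; exact: ltn_trans h lim_lt.
  have cw0 : l * M < 2 ^ w by rewrite -[l * M]addn0; exact: cw.
  have kf := cellb _ fM; have kfw := cw _ fM.
  have ki := cellb _ mi; have kiw := cw _ mi.
  have w2 : 1 < 2 ^ w by clear -w1; lia.
  apply: wp_seq; apply: wp_arr; [by simp_ok|by simp_ok|by []|by simp_ok|].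
  apply: wp_arr; [by simp_ok|by simp_ok|by []|by simp_ok|].
  simp_state.
  eexists; split; first by rewrite /seta /=; reflexivity.
    by move=> r' j nr; simp_state; rewrite -[eqn r' 8]/(r' == 8) (negbTE nr).
  have dec l' f f' : f < M -> f' < M ->
      (l' * M + f == l * M + f') = (l' == l) && (f == f').
    move=> fM1 fM2; apply/eqP/andP => [/(pair_inj fM1 fM2)[-> ->] //|].
    by move=> [/eqP -> /eqP ->].
  case: hMa => h1 h2; split=> [l' f ll fM'|f fM']; simp_state.
    by rewrite !dec // gtn_eqF //= h1.
  rewrite !dec // eqxx h2 // [in RHS]has_iotaS // [X in _ || X]/mark_pred evi /=.
  by case: (f == i) => //=; rewrite ?orbT //; case: (f == _) => //=; rewrite ?orbT ?orbF.
apply: wp_seq; apply: (wp_imp A2) => s2 [a' [-> ha' hm]] {A2 s2}.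
have u16 : vr s1 vG = Fl l i by [].
apply: wp_arr; [by []|by []|by []|by simp_ok|].
simp_state; split=> //; split=> //.
- split=> //; simp_state.
  + by move=> j jn; rewrite ha' // ha // nx.
  + by move=> j jn; rewrite ha' // ha // ns.
  + by move=> j jn; rewrite ha' // ha // hC.
split.
- move=> r' j nr; simp_state; move: (nr); rewrite !inE !negb_or.
  case/and3P=> n1 n2 n3; rewrite -[eqn r' 4]/(r' == 4) (negbTE n1).
  by rewrite ha' // ha // fr.
- move=> b sb; apply: (stepF b) => // d; simp_state; case: eqP => // _.
  by rewrite ha' // ha.
- by case: ht => h1 h2; split=> *; simp_state; rewrite ha' //; [apply: h1 | apply: h2].
- by case: hm.
Qed.

Lemma classes_correct s :
  static s -> vr s vL = l ->
  (forall a, st a -> ar s aF a = Fl l.-1 a) ->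
  (forall l' f c, l <= l' -> f < M -> c < M -> ar s aT2 (key l' f c) = 0) ->
  (forall l' f, l <= l' -> f < M -> ar s aMk (l' * M + f) = 0) ->
  wp prog_classes (class_inv s n.+1) s.
Proof.
move=> sta vl hF hT hM; have [g nx ns hC] := sta; have [g1 g2 g3 g4] := g.
have ML := M_lim.
have w1 : 1 < 2 ^ w by clear -ML lim_lt n_gt0; lia.
have n1 : 1 <= n.+1 by [].
apply: wp_seq; apply: wp_set.
  by simp_ok; repeat split => //; clear -w1 ML; lia.
simp_state; rewrite ns //.
pose I i s' := [/\ class_inv s i s', vr s' vI = i & i <= n -> st i].
apply: (wp_while_lt (I := I) (x := next_in st n 1) (mu := fun i => n.+1 - i)).
  split=> //; last exact: next_in_mem.
  have -> : 1 = 1.-1.+1 by [].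
  apply: (@class_inv_gap _ 1).
  - split=> //; first by rewrite /= addn0.
    split=> //.
    + by move=> a sa; rewrite /= hF //; case: a sa => // sa; have := st_in sa.
    + split=> [l' f c ll fM cM|f c fM cM]; first by apply: hT => //; exact: ltnW.
      by rewrite /= hT.
    + split=> [l' f ll fM|f fM]; first by apply: hM => //; exact: ltnW.
      by rewrite /= hM.
  - by rewrite next_in_ge next_in_le.
  - by move=> b /andP[b1 b2]; exact: next_in_min b2.
move=> {g g1 g2 g3 g4 nx ns hC sta vl hF hT hM} i s' [inv hI hst].
have [sta vl iN t _] := inv; have [g nx ns hC] := sta; have [g1 g2 g3 g4] := g.
split=> // [lt|ge].
  have {}lt : i <= n by move: lt; simp_state.
  have step := class_step inv hI (hst lt).
  apply: wp_seq; apply: (wp_imp step) => {step} s1 [inv1 hI1].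
  have [sta1 vl1 _ t1 _] := inv1; have [[h1 h2 h3 h4] nx1 ns1 hC1] := sta1.
  have i1n : 0 < i.+1 <= n.+1 by [].
  apply: wp_set.
    simp_ok; rewrite ?hI1; repeat split => //; clear -w1 lt ML lim_lt; lia.
  simp_state; rewrite addn1 ns1 //; exists (next_in st n i.+1).
    split=> //; last exact: next_in_mem.
    apply: (@class_inv_gap _ i.+1).
    - by case: inv1 => *; split.
    - by rewrite next_in_ge next_in_le.
    - by move=> b /andP[b1 b2]; exact: next_in_min b2.
  by have := next_in_ge st n i.+1; clear -lt; lia.
move: ge; simp_state => ge; have <- : i = n.+1 by clear -ge iN; lia.
by [].
Qed.

(** * Incidences between elements and candidates *)

Definition occ_before b e p :=
  has (fun a => [&& st a, Fl l a == e %% M, a <= p & p < a + l]) (iota 1 b).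

Definition inc_before b e p :=
  incd e p && ((e %/ M < l) || ((e %/ M == l) && occ_before b e p)).

(** All occurrences at this level have length [l], so the latest one scanned reaches furthest. Hence
    a candidate from [i] on has been listed exactly when it lies before the entry of [aRR]. Ticks of
    the inner loop are balanced by new [links]. *)
Definition element_inv s0 i s :=
  [/\ static s, vr s vL = l, 0 < i <= n.+1,
      tm s + links s0 <= tm s0 + count st (iota 1 i.-1) + links s &
  [/\ forall r j, r \in [:: aF; aT2; aMk; aCV] -> ar s r j = ar s0 r j,
      adjacency s (inc_before i.-1),
      forall l' f, l < l' -> f < M -> ar s aRR (l' * M + f) = 0,
      forall f, f < M -> ar s aRR (l * M + f) <= n.+1 /\ ar s aRR (l * M + f) < i + l
    & forall f p, f < M -> f != 0 -> mk l f -> cand p -> i <= p ->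
        occ_before i.-1 (l * M + f) p = (p < ar s aRR (l * M + f))]].

Lemma occ_gap i j e p : 0 < i <= j -> (forall b, i <= b < j -> ~~ st b) ->
  occ_before j.-1 e p = occ_before i.-1 e p.
Proof. by move=> ij gap; apply: has_gap => // b /gap; apply: contra => /and4P[]. Qed.

Lemma element_inv_gap s0 i j s : element_inv s0 i s -> i <= j <= n.+1 ->
  (forall b, i <= b < j -> ~~ st b) -> element_inv s0 j s.
Proof.
move=> [h1 h2 /andP[i0 i1] h4 [h5 h6 h7 h8 h9]] /andP[ij jn] gap.
have i0j : 0 < i <= j by rewrite i0.
split=> //; [by clear -i0j jn; lia|by rewrite (count_gap i0j gap)|].
split=> //.
- apply: adjacency_ext h6 => // e p; rewrite /inc_before.
  by rewrite (occ_gap _ _ i0j gap).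
- by move=> f fM; have [? r2] := h8 f fM; split=> //; clear -r2 ij; lia.
- move=> f p fM f0 mf cp jp; rewrite (occ_gap _ _ i0j gap) h9 //.
  exact: leq_trans ij jp.
Qed.

Lemma element_step s0 i s : element_inv s0 i s -> vr s vI = i -> st i ->
  (forall a, st a -> ar s0 aF a = Fl l a) ->
  (forall f, f < M -> ar s0 aMk (l * M + f) = mk l f) ->
  wp prog_element
   (fun s' => element_inv s0 i.+1 s' /\ vr s' vI = i) (tick s).
Proof.
move=> [sta vl _ t [fr adj rr1 rr2 rr3]] hI si hF hM.
have [g nx ns hC] := sta; have [g1 g2 g3 g4] := g.
have ML := M_lim; have Kn := K_bounds.
have /andP[i0 iN] := st_in si.
have w1 : 2 < 2 ^ w by clear -ML lim_lt n_gt0; lia.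
have w0 : 0 < 2 ^ w by clear -w1; lia.
have w2 : 1 < 2 ^ w by clear -w1; lia.
have il : i < lim by clear -iN ML; lia.
have lM : l < M by clear -l_in Kn; lia.
have lK : l <= n by clear -l_in Kn; lia.
have [l0 lK'] := andP l_in.
have MM : M * M <= lim by apply: leq_trans lim_cube; rewrite leq_pmulr.
have fi : ar s aF i = Fl l i by rewrite fr // hF.
have fM := Fl_lt l i.
have eMM := M2_lim lM fM.
have el : l * M + Fl l i < lim by apply: leq_trans MM.
have ew : l * M + Fl l i < 2 ^ w by apply: ltn_trans lim_lt.
have ew0 : l * M < 2 ^ w by apply: leq_ltn_trans ew; exact: leq_addr.
have lw : i + l < 2 ^ w by clear -iN lK ML lim_lt; lia.
have cstep : count st (iota 1 i) = (count st (iota 1 i.-1)).+1.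
  by rewrite count_iotaS // si addn1.
apply: wp_seq; apply: wp_set; first by simp_ok.
simp_state; rewrite fi.
apply: wp_seq; apply: wp_set; first by simp_ok; repeat split.
simp_state.
have [de1 de2] := decode l fM.
set e := l * M + Fl l i in eMM el ew de1 de2 *.
have occS e' p : occ_before i e' p = occ_before i.-1 e' p ||
    [&& Fl l i == e' %% M, i <= p & p < i + l].
  by rewrite /occ_before has_iotaS // si.
have skip : ~~ ((Fl l i != 0) && mk l (Fl l i)) ->
    element_inv s0 i.+1 (setv (setv (tick s) vF (Fl l i)) vE e).
  move=> nm; split=> //; simp_state.
    by rewrite cstep; clear -t; rewrite /links /= in t *; lia.
  split=> //.
  - apply: adjacency_ext adj => // e' p; rewrite /inc_before /= occS.
    case ie: (incd e' p) => //=; case: (e' %/ M =P l) => [el'|] //=; rewrite ?orbF //.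
    case: eqP => [ef|]; rewrite ?orbF //=; exfalso; move: nm; rewrite ef -{1}el'.
    by case/and3P: ie => /and4P[_ _ -> ->].
  - by move=> f fM'; have [r1 r2] := rr2 f fM'; split=> //; clear -r2; lia.
  - move=> f p fM' f0 mf cp ip; rewrite /= occS rr3 //; last exact: ltnW.
    have [_ ->] := decode l fM'; case: eqP => [ef|]; rewrite ?orbF //.
    by move: nm; rewrite ef f0 mf.
apply: wp_if_eq => [||f0|fn0]; [by []|by simp_ok| |].
  apply: wp_skip; split=> //; apply: skip.
  by move: f0; simp_state => ->.
move: fn0; simp_state => /eqP fn0.
apply: wp_if_eq => [||m0|mn0]; [by simp_ok|by simp_ok| |].
  apply: wp_skip; split=> //; apply: skip.
  by move: m0; simp_state; rewrite fr // hM // fn0 /=; case: mk.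
move: mn0; simp_state; rewrite fr // hM // => mn0.
have mf : mk l (Fl l i) by case: mk mn0.
have vi : valid n K cand l i by rewrite -Fl_neq0.
have iln : i + l <= n.+1 by case/andP: vi.
have [r1 r2] := rr2 _ fM; rewrite -/e in r1 r2.
have rr3e p : cand p -> i <= p -> occ_before i.-1 e p = (p < ar s aRR e).
  by move=> cp ip; apply: rr3.
(* Of the occurrence at [i], the part before [aRR] was listed for an earlier occurrence; listing
   resumes after it. *)
pose mx := if i < ar s aRR e then ar s aRR e else i.
have mxr : 0 < mx <= n.+1 by rewrite /mx; case: ifP => h; clear -h i0 iN r1; lia.
have mxl : mx < lim by clear -mxr ML; lia.
have qpre : wp (CIf (eLt (EVar vI) (EArr aRR (EVar vE)))
       (CSet vQ (EArr aRR (EVar vE))) CSkip)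
     (fun s' => exists2 v, s' = State v (ar s) (lo s) (tm s).+1 &
        v vQ = mx /\ forall x, x != vQ ->
          v x = vr (setv (setv (tick s) vF (Fl l i)) vE e) x)
     (setv (setv (setv (tick s) vF (Fl l i)) vE e) vQ i).
  rewrite /mx; apply: wp_if_lt; [by []|by simp_ok| |]; simp_state => h.
    apply: wp_set; first by simp_ok.
    simp_state; eexists; first by rewrite /setv /=; reflexivity.
    split=> [|x nx']; simp_state; first by rewrite h.
    by rewrite -[eqn x 18]/(x == 18) (negbTE nx').
  apply: wp_skip; simp_state; eexists; first by rewrite /setv /=; reflexivity.
  split=> [|x nx']; simp_state; first by rewrite ltnNge h.
  by rewrite -[eqn x 18]/(x == 18) (negbTE nx').
apply: wp_seq; apply: wp_set; first by [].
simp_state; apply: wp_seq; apply: (wp_imp qpre) => s1 [v -> [vq vx]] {qpre s1}.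
have mx1 := next_in_ge cand n mx.
have mx2 := next_in_le cand (n := n) (i := mx).
apply: wp_seq; apply: wp_set; first by simp_ok; rewrite vq.
simp_state; rewrite vq nx //.
pose J q e' p' := inc_before i.-1 e' p' ||
  [&& e' == e, cand p', i <= p', p' < q & p' < i + l].
have inc_e q : cand q -> i <= q -> q < i + l -> incd e q.
  move=> cq iq ql; rewrite /inc de1 de2 /incident /element l0 lK' fn0 mf cq /=.
  by apply/occurs_acrossP => //; exists i.
pose I2 q s' := [/\ static s', vr s' vL = l, vr s' vI = i, vr s' vE = e &
  [/\ vr s' vQ = q, [/\ 0 < q <= n.+1, q <= n -> cand q & mx <= q],
      tm s' + links s0 <= tm s0 + count st (iota 1 i) + links s',
      forall r j, r \in [:: aF; aT2; aMk; aRR; aCV] -> ar s' r j = ar s r j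
    & adjacency s' (J q)]].
have Jsub q e' p' : J q e' p' -> incd e' p'.
  case/orP=> [/andP[] //|/and5P[/eqP -> cp ip _ pl]]; exact: inc_e.
apply: wp_seq.
apply: (wp_while_lt (I := I2) (x := next_in cand n mx) (mu := fun q => n.+1 - q)).
  split=> //; try by rewrite /= vx.
    by split=> //; rewrite /globals /= !vx.
  split=> //.
  - split=> //; last exact: next_in_mem.
    by clear -mx1 mx2 mxr; lia.
  - by rewrite cstep; clear -t; rewrite /links /= in t *; lia.
  - apply: adjacency_ext adj => // e' p; rewrite /J.
    apply/esym; case: (boolP [&& _, _, _, _ & _]) => //; rewrite ?orbF //.
    case/and5P => /eqP -> cp ip pq pl.
    rewrite orbT /inc_before inc_e //= de1 eqxx rr3e //=.
    rewrite ltnn /=; apply/esym; apply: contraLR cp => h.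
    apply: (@next_in_min _ n mx) => //; rewrite /mx; case: ifP => // h2.
    by rewrite leqNgt.
move=> {v vq vx} q s2 [sta2 u14 u10 u17 [u18 [q1 q2 q3] t2 fr2 adj2]].
have [[h1 h2 h3 h4] nx2 ns2 hC2] := sta2.
split=> // [|lt|ge]; first by simp_ok; repeat split.
  move: lt; simp_state => lt.
  have qn : q <= n by clear -lt iln; lia.
  have cq := q2 qn.
  have iq : i <= q.
    by apply: leq_trans q3; rewrite /mx; case: ifP => // h; exact: ltnW.
  have qM : q < M by clear -qn; lia.
  have nJ : ~~ J q e q.
    rewrite /J ltnn !andbF orbF /inc_before de1 ltnn eqxx /= rr3e //.
    rewrite negb_and -leqNgt; apply/orP; right; apply: leq_trans q3.
    by rewrite /mx; case: ifP => // h; rewrite leqNgt h.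
  apply: wp_seq; apply: (link_correct (e := e) (q := q) (I := J q)) => //.
    exact: Jsub.
  move=> a ha1 ha2 adj3; simp_state.
  apply: wp_set.
    by simp_ok; repeat split => //; clear -qn ML lim_lt; lia.
  have q1n : 0 < q.+1 <= n.+1 by [].
  simp_state; rewrite ha1 // addn1 nx2 //.
  exists (next_in cand n q.+1); last first.
    by have := next_in_ge cand n q.+1; clear -qn; lia.
  have nq1 := next_in_ge cand n q.+1.
  have nq2 := next_in_le cand (n := n) (i := q.+1).
  split=> //.
    split=> //; simp_state.
    - by move=> j jn; rewrite ha1 // nx2.
    - by move=> j jn; rewrite ha1 // ns2.
    - by move=> j jn; rewrite ha1 // hC2.
  split=> //.
  - split; [by clear -nq1 nq2 qn; lia|exact: next_in_mem|].
    by clear -nq1 q3; lia.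
  - set s3 := setv _ _ _.
    have -> : links s3 = (links s2).+1 by exact: (links_step (q := q)).
    by clear -t2; rewrite /s3 /=; lia.
  - by move=> r j rin; rewrite /= ha1 ?fr2 //; move: rin;
      rewrite !inE => /or4P[/eqP ->|/eqP ->|/eqP ->|/orP[] /eqP ->].
  - apply: adjacency_ext adj3 => // e' p; rewrite /J -orbA; congr (_ || _).
    case: eqP => //= _; case: (ltngtP p q) => pq /=.
    + by rewrite orbF (leq_trans pq (leq_trans (leqnSn _) nq1)).
    + rewrite !andbF /=; apply/esym/negbTE/negP => /and4P[cp _ h _].
      by have := next_in_min pq h; rewrite cp.
    + by rewrite orbT pq cq iq nq1 lt.
move: ge; simp_state => ge.
have qr1 : e < lim by [].
apply: wp_arr; [by []|by simp_ok; repeat split|by []|by simp_ok|].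
simp_state; split=> //; split=> //.
split=> //.
- move=> r j; rewrite !inE => rin; simp_state.
  have -> : eqn r 9 = false by case/or4P: rin => /eqP ->.
  rewrite fr2 ?fr //; rewrite !inE; first by [].
  by case/or4P: rin => ->; rewrite ?orbT.
- apply: adjacency_ext adj2 => [r j|e' p].
    by rewrite !inE => /or4P[/eqP ->|/eqP ->|/eqP ->|/orP[] /eqP ->].
  rewrite /J /inc_before /= occS.
  case: (eqVneq e' e) => [->|ne] /=.
    rewrite de1 de2 eqxx ltnn /= eqxx /=.
    case ip: (i <= p) => /=; last by rewrite !andbF !orbF.
    case pl: (p < i + l); last by rewrite !andbF !orbF.
    rewrite (leq_trans pl ge) !andbT orbT andbT.
    case cp: (cand p); first by rewrite orbT inc_e.
    by rewrite orbF; case ie: (incd e p) => //; move/inc_cand: ie; rewrite cp.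
  rewrite orbF; case: (e' %/ M =P l) => [el'|] //=; rewrite ?orbF //.
  case: eqP => [ef|]; rewrite ?orbF //=.
  by move: ne; rewrite (divn_eq e' M) el' -ef eqxx.
- move=> l' f ll fM'; simp_state; rewrite ifF; last first.
    by apply/eqP => /(pair_inj fM' fM) [e1 _]; move: ll; rewrite e1 ltnn.
  by rewrite fr2 // rr1.
- move=> f fM'; simp_state; case: ifP => [_|_]; first by clear -iln; lia.
  by rewrite fr2 //; have [x1 x2] := rr2 f fM'; split=> //; clear -x2; lia.
- move=> f p fM' f0 mf' cp ip; simp_state; rewrite occS.
  have [_ ->] := decode l fM'.
  case: (eqVneq f (Fl l i)) => [->|ne].
    (* The old end is less than [i + l], so being before either end amounts to being before the new
       one. *)
    rewrite -/e eqxx rr3e ?(ltnW ip) //=.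
    by clear -r2; lia.
  rewrite ifF; last by apply/eqP => /(pair_inj fM' fM) [_ e1]; rewrite e1 eqxx in ne.
  by rewrite fr2 // rr3 ?(ltnW ip) //= orbF.
Qed.

Lemma incidence_correct s :
  static s -> vr s vL = l ->
  (forall a, st a -> ar s aF a = Fl l a) ->
  (forall f, f < M -> ar s aMk (l * M + f) = mk l f) ->
  (forall l' f, l <= l' -> f < M -> ar s aRR (l' * M + f) = 0) ->
  adjacency s (fun e p => incd e p && (e %/ M < l)) ->
  wp prog_incidence (element_inv s n.+1) s.
Proof.
move=> sta vl hF hM hR adj.
have [g nx ns hC] := sta; have [g1 g2 g3 g4] := g.
have ML := M_lim.
have w1 : 1 < 2 ^ w by clear -ML lim_lt n_gt0; lia.
have n1 : 1 <= n.+1 by [].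
apply: wp_seq; apply: wp_set.
  by simp_ok; repeat split => //; clear -w1 ML; lia.
simp_state; rewrite ns //.
pose I i s' := [/\ element_inv s i s', vr s' vI = i & i <= n -> st i].
apply: (wp_while_lt (I := I) (x := next_in st n 1) (mu := fun i => n.+1 - i)).
  split=> //; last exact: next_in_mem.
  apply: (@element_inv_gap _ 1).
  - split=> //; first by rewrite /= addn0.
    split=> //.
    + by apply: adjacency_ext adj => // e p; rewrite /inc_before /= andbF orbF.
    + by move=> l' f ll fM; apply: hR => //; exact: ltnW.
    + by move=> f fM; rewrite /= hR.
    + by move=> f p fM f0 mf cp ip; rewrite /= hR.
  - by rewrite next_in_ge next_in_le.
  - by move=> b /andP[b1 b2]; exact: next_in_min b2.
move=> {g g1 g2 g3 g4 nx ns hC sta vl hR adj} i s' [inv hI hst].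
have [sta vl iN t _] := inv; have [g nx ns hC] := sta; have [g1 g2 g3 g4] := g.
split=> // [lt|ge].
  have {}lt : i <= n by move: lt; simp_state.
  have step := element_step inv hI (hst lt) hF hM.
  apply: wp_seq; apply: (wp_imp step) => {step} s1 [inv1 hI1].
  have [sta1 vl1 _ t1 _] := inv1; have [[h1 h2 h3 h4] nx1 ns1 hC1] := sta1.
  have i1n : 0 < i.+1 <= n.+1 by [].
  apply: wp_set.
    simp_ok; rewrite ?hI1; repeat split => //; clear -w1 lt ML lim_lt; lia.
  simp_state; rewrite addn1 ns1 //; exists (next_in st n i.+1).
    split=> //; last exact: next_in_mem.
    apply: (@element_inv_gap _ i.+1).
    - by case: inv1 => *; split.
    - by rewrite next_in_ge next_in_le.
    - by move=> b /andP[b1 b2]; exact: next_in_min b2.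
  by have := next_in_ge st n i.+1; clear -lt; lia.
move: ge; simp_state => ge; have <- : i = n.+1 by clear -ge iN; lia.
by [].
Qed.

End Level.

Local Notation nstarts := (count st (iota 1 n)).

(** Each of the [K] lengths costs one tick and two scans of the starts; everything else is
    linking. *)
Definition after_levels (t0 : nat) s :=
  [/\ static s, adjacency s incd, forall j, ar s aCV j = 0
    & tm s <= t0 + K * (nstarts + nstarts).+1 + links s].

Lemma levels_correct s : after_names cand rd s ->
  wp prog_levels (after_levels (tm s)) s.
Proof.
move=> [g z hC _ [nx ns hF _ _]]; have [g1 g2 g3 g4] := g.
have ML := M_lim; have Kn := K_bounds.
have w1 : 1 < 2 ^ w by clear -ML lim_lt n_gt0; lia.
have Kw : K + 1 < 2 ^ w by clear -ML lim_lt Kn; lia.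
apply: wp_seq; apply: wp_set; first by simp_ok.
simp_state.
pose t0 := tm s; rewrite -/t0.
pose L l s := [/\ static s, vr s vL = l, 0 < l <= K.+1,
     forall a, st a -> ar s aF a = Fl l.-1 a &
  [/\ forall l' f c, l <= l' -> f < M -> c < M -> ar s aT2 (key l' f c) = 0,
      forall l' f, l <= l' -> f < M -> ar s aMk (l' * M + f) = 0 /\
                                     ar s aRR (l' * M + f) = 0,
      adjacency s (fun e p => incd e p && (e %/ M < l)),
      forall j, ar s aCV j = 0
    & tm s <= t0 + l.-1 * (nstarts + nstarts).+1 + links s]].
apply: (wp_while_lt (I := L) (x := 1) (mu := fun l => K.+1 - l)).
  split=> //.
    by move=> a sa; simp_state; rewrite hF ?st_in //= sa.
  split=> //; simp_state.
  - by move=> l' f c _ _ _; rewrite z.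
  - by move=> l' f _ _; rewrite !z.
  - have zero e p : incd e p && (e %/ M < 1) = false.
      by apply/negP => /andP[/and3P[/and4P[+ _ _ _] _ _]]; rewrite ltnS; case: (_ %/ _).
    split=> [e|p|e p|e p|p]; rewrite /plist /elist /= ?zero z ?z //=.
  - by move=> j; rewrite z.
  - by rewrite /t0; clear; lia.
move=> {g g1 g2 g3 g4 z hC nx ns hF} l s2.
move=> [sta vl lK hF [hT hMR adj cv t]].
have [g nx ns hC] := sta; have [g1 g2 g3 g4] := g.
split=> // [|lt|ge]; first by simp_ok; repeat split.
  have {}lt : 0 < l <= K by move: lt; simp_state; clear -lK; lia.
  apply: wp_seq; apply: wp_imp (classes_correct lt (s := tick s2) sta vl hF hT _) _.
    by move=> l' f ll fM; case: (hMR l' f ll fM).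
  move=> s3 [sta3 vl3 _ t3 [fr3 hF3 hT3 hM3]].
  have hF3' a : st a -> ar s3 aF a = Fl l a.
    by move=> sa; rewrite hF3 // ltnS; case/andP: (st_in sa) => _ ->.
  have adj3 : adjacency s3 (fun e p => incd e p && (e %/ M < l)).
    apply: adjacency_ext adj => // r j.
    by rewrite !inE => rin; rewrite fr3 //; case/or4P: rin => [/eqP ->|/eqP ->|/eqP ->|/orP[] /eqP ->].
  have rr3 l' f : l <= l' -> f < M -> ar s3 aRR (l' * M + f) = 0.
    by move=> ll fM; rewrite fr3 //; case: (hMR l' f ll fM).
  apply: wp_seq; apply: wp_imp (incidence_correct lt sta3 vl3 hF3' _ rr3 adj3) _.
    by move=> f fM; case: hM3 => _ ->.
  move=> s4 [sta4 vl4 _ t4 [fr4 adj4 rr4 _ _]].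
  have [[k1 k2 k3 k4] _ _ _] := sta4.
  apply: wp_set; first by simp_ok; repeat split => //; clear -lt Kw; lia.
  exists l.+1; last by clear -lt; lia.
  split=> //; simp_state.
  - by rewrite addn1.
  - by clear -lt; lia.
  - by move=> a sa; rewrite fr4 // hF3'.
  split=> //; simp_state.
  - by move=> l' f c ll fM cM; rewrite fr4 //; case: hT3 => h _; apply: h.
  - by move=> l' f ll fM; split; [rewrite fr4 //; case: hM3 => h _; apply: h | exact: rr4].
  - apply: adjacency_ext adj4 => // e p; rewrite /inc_before.
    case ie: (incd e p) => //=; rewrite [in RHS]ltnS [in RHS]leq_eqVlt orbC.
    congr (_ || _); case: (e %/ M =P l) => //= el.
    by rewrite /occ_before -el; case/and3P: ie => _ _.
  - by move=> j; rewrite fr4 // fr3.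
  - have lk : links s3 = links s2.
      by rewrite /links; apply: eq_bigr => p _; rewrite fr3.
    have -> : links (setv s4 vL (l + 1)) = links s4 by [].
    rewrite /= lk in t3 t4 *.
    have -> : l * (nstarts + nstarts).+1 =
        l.-1 * (nstarts + nstarts).+1 + (nstarts + nstarts).+1.
      by rewrite -[in LHS](prednK (n := l)) ?mulSnr //; case/andP: lt.
    by move: (l.-1 * _) t => u t; clear -t t3 t4; lia.
move: ge; simp_state => ge; have e : l = K.+1 by clear -ge lK; lia.
rewrite e in adj t; split=> //; apply: adjacency_ext adj => // e' p.
by rewrite ltnS andbC andb_idl // => /and3P[/and4P[]].
Qed.

(** * The greedy loop *)

Section GreedyLoop.

Variable s0 : state.
Hypothesis adj0 : adjacency s0 incd.

Local Notation el := (elist s0).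
Local Notation pl := (plist s0).
Local Notation H := (harmonic_number R).
Local Notation nQ := (size Qs).
Local Notation Dk := (minn (K * K) (n + n)).

Let el_uniq p : uniq (el p).
Proof. by case: adj0. Qed.

Let pl_uniq e : uniq (pl e).
Proof. by case: adj0. Qed.

Let mem_pl e p : (p \in pl e) = incd e p.
Proof. by case: adj0. Qed.

Let mem_el e p : (e \in el p) = incd e p.
Proof. by case: adj0. Qed.

Let size_el p : size (el p) = ar s0 aPC p.
Proof. by rewrite size_map size_iota. Qed.

Let size_pl e : size (pl e) = ar s0 aEC e.
Proof. by rewrite size_map size_iota. Qed.

Lemma el_half p : size (el p) <= (K * K.+1) %/ 2.
Proof.
apply: (degree_bound sizeS cand_in M_gt (C := C) (p := p)) => // e.
by rewrite mem_el.
Qed.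

Lemma el_degree p : size (el p) <= (k * k.+1) %/ 2.
Proof.
apply: leq_trans (el_half p) _.
by apply: leq_div2r; apply: leq_mul; rewrite ?ltnS geq_minl.
Qed.

Lemma el_Dk p : size (el p) <= Dk.
Proof.
rewrite leq_min; apply/andP; split; last first.
  by rewrite size_el; have [_] := adjacency_sizes adj0 (fun e p h => h); exact.
apply: leq_trans (el_half p) _; have := K_bounds.
move: (K) => m mn; apply: (@leq_trans ((m * m * 2) %/ 2)); last by rewrite mulnK.
by apply: leq_div2r; rewrite -mulnA leq_mul2l muln2 -addnn; apply/orP; right; clear -mn; lia.
Qed.

Lemma sizes0 : (forall e, ar s0 aEC e <= n) /\ (forall p, ar s0 aPC p <= n + n).
Proof. exact: adjacency_sizes adj0 (fun e p h => h). Qed.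

Lemma nth_pl e h : h < ar s0 aEC e -> ar s0 aEP (e * M + h) = nth 0 (pl e) h.
Proof.
by move=> he; rewrite (nth_map 0) ?size_iota // nth_iota // add0n.
Qed.

Lemma nth_el p j : j < ar s0 aPC p -> ar s0 aPE (p * M + j) = nth 0 (el p) j.
Proof.
by move=> he; rewrite (nth_map 0) ?size_iota // nth_iota // add0n.
Qed.

Lemma inc_code e p : incd e p -> e < M * M.
Proof.
move=> /and3P[/and4P[_ lK _ _] _ _].
have eM : e %/ M < M by have := K_bounds; clear -lK; lia.
by rewrite {1}(divn_eq e M); apply: M2_lim => //; rewrite ltn_mod.
Qed.

Definition fixed s :=
  [/\ globals s, forall i, 0 < i <= n.+1 -> ar s aNx i = next_in cand n i
    & forall r j, r \in [:: aEP; aEC; aPE; aPC] -> ar s r j = ar s0 r j].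

Definition cov s : pred nat := fun e => ar s aCV e != 0.
Definition counts s := forall q, ar s aCN q = uncovered el (cov s) q.
Definition pot s := \sum_(q <- Qs) ar s aCN q.

(** There is one tick per position listed for [e], and each of these positions loses one uncovered
    element, so [tm + pot] does not grow. *)
Lemma cover_correct s e : fixed s -> counts s -> vr s vE = e -> e < M * M ->
  ar s aCV e = 0 ->
  wp prog_cover (fun s' =>
    [/\ fixed s', counts s', forall x, x \notin [:: vH; vQ] -> vr s' x = vr s x,
        lo s' = lo s & (forall e', cov s' e' = cov s e' || (e' == e)) /\
        tm s' + pot s' <= tm s + pot s]) s.
Proof.
move=> [g nx fr] cn hE eM cv0; have [g1 g2 g3 g4] := g.
have ML := M_lim; have [sz1 _] := sizes0.
have MM : M * M <= lim by apply: leq_trans lim_cube; rewrite leq_pmulr.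
have w1 : 1 < 2 ^ w by clear -ML lim_lt n_gt0; lia.
have w0 : 0 < 2 ^ w by clear -w1; lia.
have el' : e < lim by apply: leq_trans MM.
have ec := sz1 e.
apply: wp_seq; apply: wp_arr; [by []|by simp_ok|by []|by simp_ok|].
apply: wp_seq; apply: wp_set; first by simp_ok.
simp_state.
pose I h s' := [/\ forall x, x \notin [:: vH; vQ] -> vr s' x = vr s x,
     lo s' = lo s, vr s' vH = h, h <= ar s0 aEC e &
  [/\ forall r j, r \notin [:: aCN; aCV] -> ar s' r j = ar s r j,
      forall j, ar s' aCV j = if j == e then 1 else ar s aCV j,
      forall q, ar s' aCN q + (q \in take h (pl e)) = ar s aCN q
    & tm s' = tm s + h]].
apply: (wp_while_lt (I := I) (x := 0) (mu := fun h => ar s0 aEC e - h)).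
  split=> //; first by move=> x; rewrite !inE negb_or => /andP[x1 x2];
    simp_state; rewrite -[eqn x 22]/(x == 22) (negbTE x1).
  split=> //; simp_state.
  - move=> r j; rewrite !inE negb_or => /andP[x1 x2]; simp_state.
    by rewrite -[eqn r 15]/(r == 15) (negbTE x2).
  - by move=> q; rewrite take0 in_nil addn0.
  - by rewrite addn0.
move=> h s1 [vx hl hH hE' [ax acv acn t]].
have u17 : vr s1 vE = e by rewrite vx.
have u4 : vr s1 vM = M by rewrite vx.
have aec : ar s1 aEC e = ar s0 aEC e by rewrite ax // fr.
split=> // [|lt|ge]; first by simp_ok.
  have {}lt : h < ar s0 aEC e by move: lt; simp_state; rewrite aec.
  have aep : ar s1 aEP (e * M + h) = nth 0 (pl e) h by rewrite ax // fr // nth_pl.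
  set q := nth 0 (pl e) h in aep.
  have hsz : h < size (pl e) by rewrite size_pl.
  have qin : q \in pl e by rewrite mem_nth.
  have incq : incd e q by rewrite -mem_pl.
  have qn : 0 < q <= n by apply: cand_in; apply: inc_cand incq.
  have hM : h < M by clear -lt ec; lia.
  have b1 : e * M + h < lim.
    apply: leq_trans lim_cube.
    have : e.+1 * M <= M * M * M by rewrite leq_mul2r eM orbT.
    by rewrite mulSn; clear -hM; move: (e * M) => u; lia.
  have b1w : e * M + h < 2 ^ w by apply: ltn_trans lim_lt.
  have b5 : e * M < 2 ^ w by apply: leq_ltn_trans b1w; exact: leq_addr.
  have ql : q < lim by clear -qn ML; lia.
  have qnt : q \notin take h (pl e).
    have : uniq (take h (pl e) ++ drop h (pl e)) by rewrite cat_take_drop.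
    rewrite cat_uniq (drop_nth 0 hsz) -/q /= => /and3P[_ + _].
    by rewrite negb_or => /andP[].
  have cq : ar s1 aCN q = ar s aCN q by rewrite -(acn q) (negbTE qnt) addn0.
  have cq1 : 0 < ar s aCN q.
    rewrite cn /uncovered -has_count; apply/hasP; exists e; first by rewrite mem_el.
    by rewrite /= /cov cv0 eqxx.
  have cqw : ar s aCN q < 2 ^ w.
    rewrite cn; apply: leq_ltn_trans (count_size _ _) _.
    apply: leq_ltn_trans (el_Dk q) _; clear -ML lim_lt; lia.
  apply: wp_seq; apply: wp_set; first by simp_ok.
  simp_state; rewrite aep.
  apply: wp_seq; apply: wp_arr;
    [by []|simp_ok; rewrite cq; repeat split => //; clear -cq1 cqw; lia|by []|by simp_ok|].
  simp_state; rewrite cq.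
  apply: wp_set; first by simp_ok; repeat split => //; clear -hM ML lim_lt; lia.
  simp_state; exists h.+1; last by clear -lt; lia.
  split=> //; simp_state.
  - move=> x; rewrite !inE negb_or => /andP[x1 x2].
    rewrite -[eqn x 22]/(x == 22) -[eqn x 18]/(x == 18) (negbTE x1) (negbTE x2).
    by apply: vx; rewrite !inE negb_or x1.
  - by rewrite addn1.
  split=> //; simp_state.
  - move=> r j; rewrite !inE negb_or => /andP[x1 x2].
    rewrite -[eqn r 14]/(r == 14) (negbTE x1).
    by apply: ax; rewrite !inE negb_or x1.
  - move=> q'; rewrite (take_nth 0 hsz) -/q mem_rcons inE.
    case: (eqVneq q' q) => [->|_] /=; last exact: acn.
    by clear -cq1; lia.
  - by rewrite t; clear; lia.
have {ge} e1 : h = ar s0 aEC e by move: ge; simp_state; rewrite aec; clear -hE'; lia.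
rewrite e1 -size_pl take_size in acn.
have covE e' : cov s1 e' = cov s e' || (e' == e).
  by rewrite /cov acv; case: (eqVneq e' e) => _; rewrite ?orbT ?orbF.
have cnE q : ar s1 aCN q = uncovered el (cov s1) q.
  have := acn q; rewrite cn (uncovered_add (el_uniq q) _ covE); last first.
    by rewrite /cov cv0.
  rewrite mem_pl mem_el; clear; lia.
split=> //.
  split=> //; first by rewrite /globals !vx.
    by move=> i iin; rewrite ax // nx.
  move=> r j rin; rewrite ax ?fr //; move: rin; rewrite !inE.
  by case/or4P=> /eqP ->.
split=> //.
have -> : pot s = pot s1 + \sum_(q <- Qs) (q \in pl e).
  by rewrite /pot -big_split /=; apply: eq_bigr => q _; rewrite acn.
have : ar s0 aEC e <= \sum_(q <- Qs) (q \in pl e).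
  have -> : \sum_(q <- Qs) (q \in pl e) = count (mem (pl e)) Qs.
    by elim: (Qs) => [|a qs IH]; rewrite ?big_nil ?big_cons //= IH.
  rewrite -size_pl -size_filter; apply: uniq_leq_size => // q qe.
  have cq : cand q by move: (qe); rewrite mem_pl => /inc_cand.
  by rewrite !mem_filter /= qe cq mem_iota add1n ltnS cand_in.
by rewrite t e1; clear; lia.
Qed.

Definition outs m s := [seq lo s a | a <- iota 1 m].

Definition hitting (G : seq nat) :=
  forall e p, incd e p -> exists2 q, q \in G & incd e q.

(** It holds initially by the degree bound, each pick preserves it by [greedy_potential], and
    dropping the nonnegative sum at the end leaves the approximation factor. *)
Definition ratio m s := forall G, all cand G -> hitting G ->
  (m%:R + \sum_(q <- G) H (ar s aCN q) <=
   H ((k * k.+1) %/ 2) * (size G)%:R :> R)%R.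

Definition greedy_inv m s :=
  [/\ fixed s, counts s, vr s vO = m, ratio m s &
  [/\ uniq (outs m s), all cand (outs m s),
      forall p e, p \in outs m s -> e \in el p -> cov s e
    & forall e, cov s e -> exists2 p, p \in outs m s & e \in el p]].

Lemma outs_size m s : uniq (outs m s) -> all cand (outs m s) -> m <= nQ.
Proof.
move=> u c; have <- : size (outs m s) = m by rewrite size_map size_iota.
apply: uniq_leq_size => // p /(allP c) cp.
by rewrite mem_filter cp mem_iota add1n ltnS cand_in.
Qed.

Lemma nQ_le : nQ <= n.
Proof. by rewrite size_filter (leq_trans (count_size _ _)) // size_iota. Qed.

(** The covering loops are paid by [pot]; only the scan of the element list of [p] is added, hence
    [Dk]. *)
Lemma pick_correct m s p t : greedy_inv m s -> vr s vP = p -> cand p ->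
  0 < t -> ar s aCN p = t -> (forall q, cand q -> ar s aCN q <= t) ->
  wp prog_pick (fun s' => [/\ greedy_inv m.+1 s', vr s' vP = p,
    vr s' vD = vr s vD, forall q, ar s' aCN q <= ar s aCN q &
    ar s' aCN p = 0 /\ tm s' + pot s' <= tm s + pot s + Dk]) s.
Proof.
move=> [fx cn hO rat [ou oc o1 o2]] hP cp t0 cnp le_t.
have [g nx fr] := fx; have [g1 g2 g3 g4] := g.
have ML := M_lim; have [_ sz2] := sizes0.
have MM : M * M <= lim by apply: leq_trans lim_cube; rewrite leq_pmulr.
have w1 : 1 < 2 ^ w by clear -ML lim_lt n_gt0; lia.
have w0 : 0 < 2 ^ w by clear -w1; lia.
have /andP[p0 pn] := cand_in cp.
have pM : p < M by clear -pn; lia.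
have pl' : p < lim by exact: ltn_trans ML.
(* Positions already output have no uncovered element, so [p] is new. Hence at most [n] outputs
   arise and they fit in the former input cells. *)
have pno : p \notin outs m s.
  apply/negP => po; move: t0; rewrite -cnp cn /uncovered.
  rewrite -has_count => /hasP[e ep] /=; by rewrite (o1 p e).
have mn : m < n.
  have : size (p :: outs m s) <= nQ.
    apply: uniq_leq_size; first by rewrite /= pno.
    move=> q; rewrite inE => /orP[/eqP ->|/(allP oc) cq];
      by rewrite mem_filter ?cp ?cq mem_iota add1n ltnS cand_in.
  by rewrite /= size_map size_iota => h; apply: leq_trans h nQ_le.
have pc := sz2 p.
apply: wp_seq; apply: wp_set.
  by simp_ok; repeat split => //; clear -mn ML lim_lt; lia.
simp_state; apply: wp_seq; apply: wp_low; [by []|by []|by simp_ok; clear -mn; lia|].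
simp_state; apply: wp_seq; apply: wp_set; first by simp_ok.
simp_state; rewrite addn1.
pose lo' := fun i => if i == m.+1 then p else lo s i.
pose I j s' := [/\ fixed s', counts s', vr s' vO = m.+1 /\ vr s' vP = p /\
     vr s' vD = vr s vD, lo s' = lo' &
  [/\ vr s' vJ = j, j <= ar s0 aPC p,
      forall e, cov s' e = cov s e || (e \in take j (el p))
    & tm s' + pot s' <= tm s + pot s + j]].
apply: (wp_while_lt (I := I) (x := 0) (mu := fun j => ar s0 aPC p - j)).
  split=> //; split=> //; simp_state; last by rewrite addn0.
  by move=> e; rewrite take0 in_nil orbF.
move=> j s1 [fx1 cn1 [v20 [v21 v19]] hlo [hJ jp cvE tt]].
have [[h1 h2 h3 h4] nx1 fr1] := fx1.
have pcE : ar s1 aPC p = ar s0 aPC p by rewrite fr1.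
split=> // [|lt|ge]; first by simp_ok.
  have {}lt : j < ar s0 aPC p by move: lt; simp_state; rewrite pcE.
  have ape : ar s1 aPE (p * M + j) = nth 0 (el p) j by rewrite fr1 // nth_el.
  set e := nth 0 (el p) j in ape.
  have jsz : j < size (el p) by rewrite size_el.
  have ein : e \in el p by rewrite mem_nth.
  have ince : incd e p by rewrite -mem_el.
  have eM := inc_code ince.
  have el' : e < lim by exact: leq_trans MM.
  have jM : j < M by clear -lt pc; lia.
  have b1 : p * M + j < lim by apply: leq_trans MM; apply: M2_lim.
  have b1w : p * M + j < 2 ^ w by apply: ltn_trans lim_lt.
  have b5 : p * M < 2 ^ w by apply: leq_ltn_trans b1w; exact: leq_addr.
  have close s2 : fixed s2 -> counts s2 ->
      (forall x, x \in [:: vO; vP; vD; vJ] -> vr s2 x = vr s1 x) -> lo s2 = lo' ->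
      (forall e', cov s2 e' = cov s1 e' || (e' == e)) ->
      tm s2 + pot s2 <= (tm s1).+1 + pot s1 ->
      wp (incr vJ) (fun s' => exists2 z, I z s' &
        ar s0 aPC p - z < ar s0 aPC p - j) s2.
    move=> c1 c2 c3 c4 c5 c6.
    have u7 : vr s2 vJ = j by rewrite c3.
    apply: wp_set; first by simp_ok; repeat split => //; clear -jM ML lim_lt; lia.
    simp_state; exists j.+1; last by clear -lt; lia.
    split=> //; first by rewrite /= !c3.
    split=> //; simp_state; first by rewrite addn1.
      move=> e'; rewrite (take_nth 0 jsz) -/e mem_rcons inE.
      have -> : cov (setv s2 7 (j + 1)) e' = cov s2 e' by [].
      by rewrite c5 cvE -orbA; congr (_ || _); rewrite orbC.
    have -> : pot (setv s2 7 (j + 1)) = pot s2 by [].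
    by clear -c6 tt; lia.
  apply: wp_seq; apply: wp_set; first by simp_ok.
  simp_state; rewrite ape; apply: wp_seq.
  apply: wp_if_eq => [||c0|c1]; [by simp_ok|by simp_ok| |].
    move: c0; simp_state => c0.
    apply: wp_imp (cover_correct (e := e) (s := setv (tick s1) vE e) _ _ _ _ _) _ => //.
    move=> s2 [f2 c2 v2 l2 [cv2 t2]]; apply: close => //.
    - move=> x xin; rewrite v2; last by move: xin; rewrite !inE => /or4P[] /eqP ->.
      by move: xin; rewrite !inE => /or4P[] /eqP ->.
    - by rewrite l2.
  move: c1; simp_state => /eqP c1; apply: wp_skip; apply: close => //.
    by move=> x; rewrite !inE => /or4P[] /eqP ->.
  move=> e'; case: eqP => [->|_]; rewrite ?orbF // orbT.
  exact: c1.
have {ge} ej : j = ar s0 aPC p by move: ge; simp_state; rewrite pcE; clear -jp; lia.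
rewrite ej -size_el take_size in cvE.
have outE : outs m.+1 s1 = rcons (outs m s) p.
  rewrite /outs -[m.+1]addn1 iotaD map_cat cats1 /= hlo /lo' add1n eqxx.
  congr rcons; apply/eq_in_map => a; rewrite mem_iota => am.
  by rewrite ifF //; clear -am; lia.
have cnE q : ar s1 aCN q = uncovered el (fun e => cov s e || (e \in el p)) q.
  by rewrite cn1; apply: eq_count => e; rewrite /= cvE.
have cn_le q : ar s1 aCN q <= ar s aCN q.
  rewrite cnE cn; apply: sub_count => e /=; by rewrite negb_or => /andP[].
split=> //; last first.
  split; last by apply: (leq_trans tt); rewrite leq_add2l ej -size_el el_Dk.
  rewrite cnE; apply/eqP; rewrite -leqn0 leqNgt -has_count.
  by apply/hasPn => e ep; rewrite /= ep orbT.
split=> //.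
- move=> G Gc Gh.
  have := rat G Gc Gh; apply: le_trans.
  rewrite -addn1 natrD -addrA lerD2l.
  rewrite (eq_bigr (fun q => H (uncovered el (fun e => cov s e || (e \in el p)) q)));
    last by move=> q _; rewrite cnE.
  rewrite [X in (_ <= X)%R](eq_bigr (fun q => H (uncovered el (cov s) q)));
    last by move=> q _; rewrite cn.
  apply: (@greedy_potential R _ _ _ p t) => //.
  + move=> e; rewrite mem_el => /Gh [q qG iq]; exists q => //.
    by rewrite mem_el.
  + by rewrite -cn.
  + by move=> q /(allP Gc) cq; rewrite -cn le_t.
rewrite outE; split.
- by rewrite rcons_uniq pno.
- by rewrite all_rcons cp.
- move=> q e; rewrite mem_rcons inE cvE => /orP[/eqP -> ->|qo eq]; first by rewrite orbT.
  by rewrite (o1 q e).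
- move=> e; rewrite cvE => /orP[/o2 [q qo eq]|ep].
    by exists q => //; rewrite mem_rcons inE qo orbT.
  by exists p => //; rewrite mem_rcons inE eqxx.
Qed.

Lemma fixed_pointer s : fixed s -> forall i, i <= n ->
  ar s aNx (i + 1) = next_in cand n i.+1.
Proof. by move=> [_ nx _] i ni; rewrite addn1 nx. Qed.

Definition greedy_post s := exists m,
  [/\ lo s 0 = m, uniq (outs m s), all cand (outs m s), hitting (outs m s) &
    (forall G, all cand G -> hitting G ->
       (m%:R <= H ((k * k.+1) %/ 2) * (size G)%:R :> R)%R) /\
    tm s <= tm s0 + links s0 + Dk * nQ.+1 + Dk * nQ].

Lemma greedy_correct : static s0 -> (forall j, ar s0 aCV j = 0) ->
  wp prog_greedy greedy_post s0.
Proof.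
move=> [g nx _ _] cv0; have [g1 g2 g3 g4] := g.
have ML := M_lim; have Kn := K_bounds; have NL := n2_lim.
have w1 : 1 < 2 ^ w by clear -ML lim_lt n_gt0; lia.
have w0 : 0 < 2 ^ w by clear -w1; lia.
have KK : K * K < 2 ^ w.
  apply: leq_ltn_trans (ltn_trans NL lim_lt).
  by apply: leq_mul; case/andP: Kn.
have nn : n + n < 2 ^ w by clear -ML lim_lt; lia.
have Dw : Dk < 2 ^ w by clear -nn; lia.
have init : wp (CSet vD (eMul (EVar vK) (EVar vK)) ;;
  CIf (eLt (eAdd (EVar vN) (EVar vN)) (EVar vD))
    (CSet vD (eAdd (EVar vN) (EVar vN))) CSkip)
  (fun s => exists2 v, s = State v (ar s0) (lo s0) (tm s0) & v vD = Dk /\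
     forall x, x != vD -> v x = vr s0 x) s0.
  apply: wp_seq; apply: wp_set; first by simp_ok; repeat split.
  simp_state; apply: wp_if_lt; [by simp_ok; repeat split|by []| |]; simp_state => h.
    apply: wp_set; first by simp_ok; repeat split.
    simp_state; eexists; first by rewrite /setv /=; reflexivity.
    split=> [|x nx']; simp_state; first by clear -h; lia.
    by rewrite -[eqn x 19]/(x == 19) (negbTE nx').
  apply: wp_skip; simp_state; eexists; first by rewrite /setv /=; reflexivity.
  split=> [|x nx']; simp_state; first by clear -h; lia.
  by rewrite -[eqn x 19]/(x == 19) (negbTE nx').
case: init => s1 x1 [v es1 [vD' vx]].
(* Sequences nest to the right; inverting the execution of the first two commands splices them in
   front of any continuation. *)
have assoc (c : cmd) Q : wp c Q s1 -> wp (CSet vD (eMul (EVar vK) (EVar vK)) ;;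
  CIf (eLt (eAdd (EVar vN) (EVar vN)) (EVar vD))
    (CSet vD (eAdd (EVar vN) (EVar vN))) CSkip ;; c) Q s0.
  move=> [s2 x2 q2]; exists s2 => //.
  inversion x1 as [| | | |? ? ? s3 ? y1 y2| | |]; subst.
  by apply: exec_seq y1 _; apply: exec_seq y2 _.
apply: assoc => {x1}; rewrite es1 {es1 s1}.
apply: wp_seq; apply: wp_set; first by simp_ok.
simp_state.
have cov0 (s : state) : (forall j, ar s aCV j = 0) -> cov s =1 xpred0.
  by move=> h e; rewrite /cov h.
(* The potential starts at [links s0]; a threshold costs at most [nQ.+1] ticks beyond it, and a pick
   at most [Dk]. *)
pose I t s := exists m, [/\ greedy_inv m s, vr s vD = t, t <= Dk,
   forall q, cand q -> ar s aCN q <= t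
  & tm s + pot s <= tm s0 + links s0 + (Dk - t) * nQ.+1 + Dk * m].
set s1 := setv _ _ _.
have adj5 q : ar s0 aCN q = ar s0 aPC q by case: adj0.
have cn1 : counts s1.
  move=> q; rewrite /s1 /= adj5 -size_el /uncovered -count_predT.
  by apply: eq_count => e; rewrite /= cov0.
have I0 : I Dk s1.
  exists 0; split=> //.
  - split=> //.
    + by split=> //; rewrite /globals /s1 /= !vx.
    + move=> G Gc Gh; rewrite add0r -sum1_size natr_sum mulr_sumr.
      apply: ler_sum => q _; rewrite mulr1; apply: harmonic_mono.
      by rewrite /s1 /= adj5 -size_el el_degree.
    + by split=> // e; rewrite cov0.
  - by move=> q _; rewrite /s1 /= adj5 -size_el el_Dk.
  - rewrite subnn muln0 mul0n !addn0 /= leq_add2l.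
    by apply/eq_leq/eq_bigr => q _; rewrite /s1 /= adj5.
apply: wp_seq; apply: (wp_while_lt (I := I) (x := Dk) (mu := id) I0).
move=> {I0 cn1 s1 cov0} t s [m [inv hD tD le_t tt]].
split=> // [lt|ge].
  have {}lt : 0 < t by move: lt; simp_state.
  have [fx _ _ _ _] := inv; have [[h1 h2 h3 h4] nx1 _] := fx.
  have n1 : 0 < 1 <= n.+1 by [].
  apply: wp_seq; apply: wp_set.
    by simp_ok; repeat split => //; clear -ML; lia.
  simp_state; rewrite nx1 //.
  pose I2 p s' := exists m, [/\ greedy_inv m s', vr s' vD = t /\ vr s' vP = p,
      0 < p <= n.+1 /\ (p <= n -> cand p),
      forall q, cand q -> ar s' aCN q <= t - (q < p)
    & tm s' + pot s' <= tm s0 + links s0 + (Dk - t) * nQ.+1 + 1 + Dk * m +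
        count cand (iota 1 p.-1)].
  have gap1 := next_in_ge cand n 1.
  have gap2 := next_in_le cand (n := n) (i := 1).
  apply: wp_seq.
  apply: (wp_while_lt (I := I2) (x := next_in cand n 1) (mu := fun p => n.+1 - p)).
    exists m; split=> //.
    - by split; [rewrite gap1 gap2 | exact: next_in_mem].
    - move=> q cq; simp_state; case: ltnP => // h; last by rewrite subn0 le_t.
      have /andP[q0 _] := cand_in cq.
      by have := next_in_min q0 h; rewrite cq.
    - rewrite (@count_gap _ 1) //=; last by move=> b /andP[]; exact: next_in_min.
      have -> : pot (setv (tick s) 21 (next_in cand n 1)) = pot s by [].
      by clear -tt; lia.
  move=> {m inv hD tt le_t fx h1 h2 h3 h4 nx1 s} p s [m [inv [hD hP] [pr cp] le_t tt]].
  have [fx cn _ _ _] := inv; have [[h1 h2 h3 h4] nx1 _] := fx.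
  split=> // [lt2|ge2].
    have pn : p <= n by move: lt2; simp_state.
    have {}cp := cp pn; have p0 : 0 < p by case/andP: pr.
    have next s2 m2 : greedy_inv m2 s2 -> vr s2 vD = t -> vr s2 vP = p ->
        (forall q, ar s2 aCN q <= ar s aCN q) -> ar s2 aCN p < t ->
        tm s2 + pot s2 <= tm s0 + links s0 + (Dk - t) * nQ.+1 + 1 + Dk * m2 +
          count cand (iota 1 p) ->
        wp (CSet vP (EArr aNx (eAdd (EVar vP) (ENum 1))))
          (fun s' => exists2 z, I2 z s' & n.+1 - z < n.+1 - p) s2.
      move=> inv2 u19 u21 le2 lt2' t2.
      have [fx2 _ _ _ _] := inv2.
      apply: wp_set.
        by simp_ok; repeat split => //; clear -pn ML lim_lt; lia.
      simp_state; rewrite fixed_pointer //.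
      have nq1 := next_in_ge cand n p.+1.
      have nq2 := next_in_le cand (n := n) (i := p.+1).
      exists (next_in cand n p.+1); last by clear -nq1 pn; lia.
      exists m2; split=> //.
      - by split; [clear -nq1 nq2 pn; lia | exact: next_in_mem].
      - move=> q cq; simp_state; case: (ltngtP q p) => qp.
        + apply: leq_trans (le2 q) _; have := le_t q cq; rewrite qp.
          by rewrite (leq_trans qp (leq_trans (leqnSn _) nq1)).
        + case: (ltnP q (next_in cand n p.+1)) => h.
            by have := next_in_min qp h; rewrite cq.
          by apply: leq_trans (le2 q) _; have := le_t q cq; clear; lia.
        + by rewrite qp nq1; clear -lt2'; lia.
      - rewrite (@count_gap _ p.+1) //=.
          by move=> b /andP[]; exact: next_in_min.
    have cS : count cand (iota 1 p) = (count cand (iota 1 p.-1)).+1.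
      by rewrite count_iotaS // cp addn1.
    have pl' : p < lim by clear -pn ML; lia.
    apply: wp_seq; apply: wp_if_eq => [||e1|ne1]; [by simp_ok|by []| |].
      move: e1; simp_state => e1.
      apply: wp_imp (pick_correct (m := m) (s := tick s) (p := p) (t := t) _ _ _ _ _ _) _ => //.
        by move=> q cq; apply: leq_trans (le_t q cq) _; exact: leq_subr.
      move=> s2 [inv2 u21 u19 le2 [z2 t2]]; apply: (next s2 m.+1) => //.
        by rewrite u19.
        by rewrite z2.
      apply: leq_trans t2 _; rewrite cS mulnS.
      have -> : pot (tick s) = pot s by [].
      by move: tt => /=; clear; lia.
    move: ne1; simp_state => ne1; apply: wp_skip; apply: (next _ m) => //.
      have := le_t p cp; rewrite ltnn subn0 /=; clear -ne1; lia.
    have -> : pot (tick s) = pot s by [].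
    by rewrite cS; move: tt => /=; clear; lia.
  have {ge2} ep : p = n.+1 by move: ge2; simp_state; clear -pr; lia.
  apply: wp_set.
    by simp_ok; repeat split => //; clear -lt w1 tD Dw; lia.
  simp_state; exists t.-1; last by rewrite /id; clear -lt; lia.
  exists m; split=> //; simp_state.
  - by clear -lt; lia.
  - by clear -tD; lia.
  - move=> q cq; have := le_t q cq; have /andP[_ qn] := cand_in cq.
    by rewrite ep ltnS qn; clear -lt; lia.
  - have -> : pot (setv s 19 (t - 1)) = pot s by [].
    have -> : Dk - t.-1 = (Dk - t).+1 by clear -lt tD; lia.
    have eQ : nQ = count cand (iota 1 n) by rewrite size_filter.
    rewrite mulSn; move: tt; rewrite ep /= -eQ.
    by move: ((Dk - t) * _) (Dk * m) => a b; clear; lia.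
have {ge} et : t = 0 by move: ge; simp_state; clear; lia.
have [fx cn hO rat [ou oc o1 o2]] := inv; have [[h1 h2 h3 h4] nx1 _] := fx.
apply: wp_low; [by simp_ok|by []|by simp_ok; clear; lia|].
simp_state; exists m.
have outE s' : (forall a, 0 < a -> lo s' a = lo s a) -> outs m s' = outs m s.
  by move=> h; apply/eq_in_map => a; rewrite mem_iota => /andP[a0 _]; rewrite h.
set s2 := setl _ _ _.
have oe : outs m s2 = outs m s by apply: outE => a; rewrite /s2 /=; case: a.
rewrite oe; split=> //.
- move=> e p ince; have [] := o2 e; last first.
    by move=> q qo; rewrite mem_el; exists q.
  have cp := inc_cand ince.
  have : ar s aCN p = 0 by apply/eqP; rewrite -leqn0; have := le_t p cp; rewrite et.
  rewrite cn /uncovered => /eqP; rewrite -leqn0 leqNgt -has_count => /hasPn /(_ e).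
  by rewrite mem_el ince /= negbK => /(_ isT).
- split.
    move=> G Gc Gh; apply: le_trans (rat G Gc Gh); rewrite lerDl.
    by apply: sumr_ge0 => q _; exact: harmonic_ge0.
  have mQ := outs_size ou oc.
  rewrite et subn0 in tt.
  have : Dk * m <= Dk * nQ by rewrite leq_mul2l mQ orbT.
  rewrite /s2 /=; move: tt; move: (Dk * m) (Dk * nQ) (Dk * nQ.+1) => a b c.
  by clear; lia.
Qed.

End GreedyLoop.

(** * Hitting sets of candidates and attractors *)

Lemma hitting_incident G : hitting G ->
  forall l f p, incident n K cand C l f p ->
  exists2 p', p' \in G & incident n K cand C l f p'.
Proof.
move=> hG l f p ip.
have fM : f < M.
  by case/and3P: ip => _ _ /occurs_acrossP [//|i _ [<- _ _]]; exact: Fl_lt.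
have [e1 e2] := decode l fM.
have [|q qG iq] := hG (l * M + f) p; first by rewrite /inc e1 e2.
by exists q => //; move: iq; rewrite /inc e1 e2.
Qed.

Lemma substr_sub (i l : nat) : 0 < i -> 0 < l -> substr S i (i + l - 1) = sub S l i.
Proof.
by move=> i0 l0; rewrite /substr /sub take_drop; congr (drop _ (take _ _)); lia.
Qed.

(** A substring shorter than [k + 1] has length at most [K] and a copy at a valid start;
    [cover_valid] hits some occurrence in the class of that copy, and equal classes spell equal
    strings. *)
Lemma hitting_attractor (G : seq nat) (A : {fset nat}) :
  A =i G -> all cand G -> hitting G -> attractor k S A.
Proof.
move=> AG Gc hG; split=> [x|i j i0 ij jn jk].
  by rewrite AG sizeS => /(allP Gc) /cand_in.
rewrite sizeS in jn *.
pose l := j - i.-1.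
have el : j = i + l - 1 by rewrite /l; clear -i0 ij; lia.
have lK : 0 < l <= K by rewrite /l; clear -i0 ij jn jk; lia.
have iln : i + l <= n.+1 by rewrite /l; clear -i0 ij jn; lia.
have [i1 [p1 [c1 v1 ip1 e1]]] := context_start sizeS cand_in cand_ctx i0 iln lK.
have [p [i2 [pG s2 e2 ip]]] :=
  cover_valid sizeS cand_in C_char cand_ctx (hitting_incident hG) lK v1.
have l0 : 0 < l by case/andP: lK.
have v2 : valid n K cand l i2.
  by rewrite -Fl_neq0 // e2 Fl_neq0.
have /andP[i20 _] := st_in s2.
have i2l : i2 + l <= n.+1 by case/andP: v2.
exists i2, (i2 + l - 1); split=> //.
- by clear -l0; lia.
- by clear -i2l l0 i20; lia.
- rewrite el !substr_sub // -e1.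
  by apply/eqP; rewrite -(F_sub sizeS cand_in C_char v2 v1) e2.
- by exists p; [rewrite AG | clear -ip; lia].
Qed.

(** A minimum attractor may use positions that are not candidates; this transfers the ratio, proved
    against candidates only, to all attractors. *)
Lemma attractor_hitting (A : {fset nat}) : attractor k S A ->
  exists G, [/\ all cand G, hitting G & size G <= #|` A|].
Proof.
move=> [A1 A2].
have [||G [_ Gc Gs Gh]] :=
    hits_of_cover (D := enum_fset A) sizeS cand_in C_char cand_ctx.
- by move=> x xA; rewrite -sizeS; apply: A1.
- move=> i l i0 il lK.
  have [|||i' [j' [h1 h2 h3 h4 [x xA xi]]]] := A2 i (i + l - 1) i0.
  + by clear -lK; lia.
  + by rewrite sizeS; clear -il i0 lK; lia.
  + by clear -lK i0; lia.
  (* Equal substrings have equal lengths, and both intervals lie inside [S]. *)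
  have e : j' = i' + l - 1.
    have := congr1 size h4; rewrite sizeS in h3.
    rewrite /substr !size_drop !size_takel ?sizeS; clear -h1 h2 h3 i0 il lK; lia.
  have l0 : 0 < l by case/andP: lK.
  exists i', x; split=> //.
  + by rewrite sizeS in h3; clear -e h3 l0 h1; lia.
  + by rewrite -!substr_sub // -e.
  + by clear -xi e l0; lia.
by exists G; split=> // e p; exact: Gh.
Qed.

End Levels.

(** * The result, the unary case and the total cost *)

Definition result (t : nat) s := exists A : {fset nat},
  [/\ perm_eq [seq lo s a | a <- iota 1 (lo s 0)] (enum_fset A), lo s 0 <= n,
      attractor k S A,
      forall A' : {fset nat}, attractor k S A' ->
       (#|` A|%:R <= harmonic_number R ((k * k.+1) %/ 2) * #|` A'|%:R :> R)%R
    & tm s <= t].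

Lemma nonempty_attractor (A : {fset nat}) : attractor k S A -> 0 < #|` A|.
Proof.
move=> [_ /(_ 1 1)]; rewrite sizeS add1n ltnS => /(_ isT isT n_gt0 k_gt0).
move=> [i [j [_ _ _ _ [x xA _]]]]; rewrite cardfs_gt0.
by apply/fset0Pn; exists x.
Qed.

(** In a constant string every substring also occurs at position 1. The ratio holds because
    attractors are nonempty and the harmonic number is at least 1. *)
Lemma unary_result s : sigma = 1 -> tm s = 0 ->
  result 0 (setl (setl s 0 1) 1 1).
Proof.
move=> s1 t0; exists (seq_fset tt [:: 1]).
have Sn : S = nseq n 1.
  rewrite -sizeS; apply/all_pred1P/allP => a /S_in; rewrite s1 /=.
  by clear; lia.
have sz : #|` seq_fset tt [:: 1]| = 1.
  by rewrite (perm_size (seq_fset_perm tt [:: 1])).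
split=> //.
- by rewrite perm_sym; exact: (seq_fset_perm tt [:: 1]).
- split=> [x|i j i0 ij jn jk]; first by rewrite seq_fsetE inE sizeS => /eqP ->.
  rewrite sizeS in jn *; exists 1, (j - i).+1; split=> //; first by clear -i0 ij jn; lia.
    rewrite /substr Sn !take_nseq ?drop_nseq; try by clear -i0 ij jn; lia.
    by congr (nseq _ _); clear -i0 ij; lia.
  by exists 1; rewrite ?seq_fsetE ?inE.
- move=> A' /nonempty_attractor h; rewrite sz.
  have h1 : (1 <= harmonic_number R ((k * k.+1) %/ 2))%R.
    have -> : 1%R = harmonic_number R 1.
      by rewrite /harmonic_number big_nat1 invr1.
    apply: harmonic_mono; rewrite divn_gt0 //.
    by move: k_gt0; clear; case: (k) => // m _; rewrite mulSn; lia.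
  rewrite -[X in (X <= _)%R]mulr1; apply: ler_pM => //.
  by rewrite ler1n.
- by rewrite /= t0.
Qed.

Local Notation TB := (time_bound n sigma k).

Lemma TB_n : n <= TB.
Proof.
rewrite /time_bound !leq_min -mulnn leq_pmulr //=.
by rewrite leq_pmulr ?expn_gt0 ?k_gt0 //= leq_addr.
Qed.

Lemma pow_mono a b : a <= b -> sigma ^ a <= sigma ^ b.
Proof. by move=> ab; apply: leq_pexp2l; [exact: sigma_gt0 | ]. Qed.

(** For the third term: if the power is at most [n], there are at most three times as many
    candidates; otherwise [n] is below the power and the bound by [n * K ^ 2] suffices. *)
Lemma cost_le_TB (cand : pred nat) q : good_cands cand ->
  q <= 2 * (n * n) -> q <= n * K ^ 2 -> q <= count cand (iota 1 n) * K ^ 2 ->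
  q <= 3 * TB.
Proof.
move=> [_ _ gc] q1 q2 q3.
have Kk : K ^ 2 <= k ^ 2 by rewrite leq_exp2r // geq_minl.
have le3 : sigma ^ (K + K - 1) <= sigma ^ (2 * k - 1).
  by apply: pow_mono; clear; lia.
have h2 : q <= n * k ^ 2 by apply: (leq_trans q2); rewrite leq_mul2l Kk orbT.
have h3 : q <= 3 * (sigma ^ (2 * k - 1) * k ^ 2).
  have [le|lt] := leqP (sigma ^ (K + K - 1)) n.
    apply: (leq_trans q3); rewrite mulnA; apply: leq_mul => //.
    by apply: (leq_trans (gc le)); rewrite leq_mul2l.
  apply: (leq_trans q2); rewrite mulnA; apply: leq_mul => //.
  by apply: leq_trans (leq_trans (ltnW lt) le3) _; rewrite leq_pmull.
rewrite /time_bound !minnMr !leq_min -mulnn.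
apply/and3P; split; [by clear -q1; lia|by clear -h2; lia|by clear -h3; lia].
Qed.

Lemma main_correct s c1 : input s -> zero_from 0 s -> tm s = 0 ->
  sigma < M ^ c1 -> wp prog_main (result ((25 + 2 * c1) * TB)) s.
Proof.
move=> inp z t hc1; have ML := M_lim.
have w1 : 1 < 2 ^ w by clear -ML lim_lt n_gt0; lia.
apply: wp_seq; apply: (wp_imp (init_correct inp z t)) => {inp z t s} s hs.
have [g vs inp z t] := hs.
apply: wp_if_eq => [||e1|ne1]; [by []|by simp_ok| |].
  have s1 : sigma = 1 by move: e1; simp_state.
  have w0 : 0 < 2 ^ w by clear -w1; lia.
  apply: wp_seq; apply: wp_low; [by simp_ok|by simp_ok|by simp_ok; clear; lia|].
  apply: wp_low; [by simp_ok|by simp_ok|by simp_ok; clear; lia|].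
  have [A [h1 h2 h3 h4 h5]] := unary_result s1 t.
  by exists A; split=> //; apply: leq_trans h5 _.
have s2 : 1 < sigma by have := sigma_gt0; move: ne1; simp_state; clear; lia.
apply: wp_seq; apply: (wp_imp (cands_correct s2 hs)) => {hs g vs inp z t ne1 s}.
move=> s [cand cg hs].
apply: wp_seq; apply: (wp_imp (next_correct hs)) => {hs s} s hs.
apply: wp_seq; apply: (wp_imp (names_correct hs)) => {hs s} s [rd hs].
have rd_ok : sigma < M ^ rd by case: hs.
have [_ _ _ _ [_ _ _ hrd t3]] := hs.
apply: wp_seq; apply: (wp_imp (levels_correct cg rd_ok hs)) => s4 [sta adj cv t4].
apply: (wp_imp (greedy_correct cg rd_ok adj sta cv)) => s5 [m [m0 ou oc oh [rat t5]]].
have AG : seq_fset tt (outs m s5) =i outs m s5 by move=> x; rewrite seq_fsetE.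
have sz : #|` seq_fset tt (outs m s5)| = m.
  rewrite (perm_size (seq_fset_perm tt _)) undup_id //.
  by rewrite size_map size_iota.
have cand_in : forall p, cand p -> 0 < p <= n by case: cg.
exists (seq_fset tt (outs m s5)); split.
- rewrite m0 -/(outs m s5) perm_sym.
  by rewrite (perm_trans (seq_fset_perm _ _)) // undup_id.
- rewrite m0; apply: leq_trans (outs_size cg ou oc) _.
  by rewrite size_filter (leq_trans (count_size _ _)) // size_iota.
- exact: (hitting_attractor cg rd_ok AG oc oh).
- move=> A' /(attractor_hitting cg rd_ok) [G [Gc Gh Gs]]; rewrite sz.
  apply: le_trans (rat G Gc Gh) _; apply: ler_wpM2l; first exact: harmonic_ge0.
  by rewrite ler_nat.
- have r1 : rd <= c1 by exact: hrd.
  set nQ := size _ in t5; set Dk := minn _ _ in t5; set nst := count _ _ in t4.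
  have nQE : nQ = count cand (iota 1 n) by rewrite /nQ size_filter.
  have Kn := K_bounds.
  have nQn : nQ <= n by rewrite nQE (leq_trans (count_size _ _)) // size_iota.
  have nstn : nst <= n by rewrite /nst (leq_trans (count_size _ _)) // size_iota.
  have nstQ : nst <= nQ * K.
    by rewrite nQE; exact: (starts_bound _ sizeS cand_in).
  have KK : K ^ 2 = K * K by rewrite -mulnn.
  have lk : links cand s4 <= Dk * nQ.
    rewrite /links /nQ -sum1_size big_distrr /=.
    apply: leq_sum => p _; rewrite muln1.
    have -> : ar s4 13 p = size (elist s4 p) by rewrite size_map size_iota.
    exact: (el_Dk cg rd_ok adj).
  have b1 : K * nst <= 3 * TB.
    apply: (cost_le_TB cg).
    - apply: (@leq_trans (n * n)); last by rewrite leq_pmull.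
      by apply: leq_mul => //; case/andP: Kn.
    - rewrite KK [n * _]mulnC -mulnA leq_mul2l; apply/orP; right.
      by apply: leq_trans nstn _; rewrite leq_pmull //; case/andP: Kn.
    - by rewrite KK -nQE mulnA [nQ * K * K]mulnC leq_mul2l nstQ orbT.
  have b2 : Dk * nQ <= 3 * TB.
    apply: (cost_le_TB cg).
    - have : Dk <= n + n by rewrite geq_minr.
      by move=> h; apply: leq_trans (leq_mul h nQn) _; clear; lia.
    - by rewrite KK [n * _]mulnC; apply: leq_mul => //; rewrite geq_minl.
    - by rewrite KK -nQE mulnC leq_mul2l geq_minl orbT.
  have b3 := TB_n.
  have b4 : Dk <= n + n by rewrite geq_minr.
  have b5 : rd * n.+1 <= 2 * (c1 * TB).
    apply: (@leq_trans (c1 * (n + n))); first by apply: leq_mul => //; clear -n_gt0; lia.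
    by rewrite mulnCA leq_mul2l; apply/orP; right; clear -b3; lia.
  apply: leq_trans t5 _; rewrite mulnDl mulnS -mulnA.
  have t4' : tm s4 <= tm s + (K + 2 * (K * nst)) + links cand s4.
    by apply: leq_trans t4 _; rewrite mulnS mulnDr; clear; lia.
  (* In units of [TB]: 4 for candidates and pointers, [2 * c1] for names, 1 for [K], 6 for two scans
     of starts, 6 for [links] taken twice, 2 for [Dk] and 6 for [Dk * nQ] taken twice. *)
  move: b1 b2 b5 lk t3 t4' b4 b3; move: (K * nst) (Dk * nQ) (rd * n.+1) (c1 * TB).
  by move=> x1 x2 x3 x4; clear -Kn; lia.
Qed.

End Correctness.

(** * Start-up code, word size and final constants *)

Definition prologue : program :=
  [:: IConst 1 0; IRead 0 1; IConst 1 3; IOp OAdd 0 0 1].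

(** The four instructions of the prologue load the array offset [n + 3] into register 0, hence the
    base address 4. *)
Definition with_prologue (c : cmd) : program := prologue ++ compile 4 c.

Definition initial_state n sigma k (S : seq nat) : state :=
  State (fun=> 0) (fun _ _ => 0) (nth 0 [:: n, sigma, k & S]) 0.

Lemma prologue_run w n sigma k (S : seq nat) lim c : size S = n ->
  n + 3 < 2 ^ w -> 3 < 2 ^ w ->
  exists2 rm, iter 4 (dstep w (with_prologue c)) (input_config n sigma k S) =
              conf 4 rm & related (n + 3) lim (initial_state n sigma k S) rm.
Proof.
move=> sizeS nw w3.
pose rm0 := (fun=> 0, fun a => nth 0 [:: n, sigma, k & S] a) :
  (nat -> nat) * (nat -> nat).
have cat : code_at (with_prologue c) 0 prologue.
  by move=> j j4; rewrite /with_prologue onth_cat j4.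
have h := iter_straight_conf w rm0 (isT : all straight prologue) cat.
exists (srun w prologue rm0); first exact: h.
rewrite /srun /prologue /=; split=> /=.
- by move=> x; rewrite /upd /rvar.
- rewrite /upd /= mod0n /= (@modn_small 3) // modn_small //.
- by [].
- move=> r i r16 _; apply: nth_default; rewrite /= sizeS; clear; lia.
Qed.

Lemma with_prologue_run w n sigma k (S : seq nat) lim c s' : size S = n ->
  n + 3 < 2 ^ w -> 3 < 2 ^ w -> 0 < w -> (lim + (n + 3)) * 16 < 2 ^ w ->
  exec w (n + 3) lim c (initial_state n sigma k S) s' ->
  exists t rm,
  [/\ iter t (dstep w (with_prologue c)) (input_config n sigma k S) =
        conf (size (with_prologue c)) rm,
      related (n + 3) lim s' rm, all nonrandom (with_prologue c)
    & t <= 4 + size (compile 4 c) * (tm s').+1].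
Proof.
move=> sizeS nw w3 w0 limw ex.
have [rm run0 rel0] := prologue_run sigma k lim c sizeS nw w3.
have cat : code_at (with_prologue c) 4 (compile 4 c).
  exact: (@code_at_catr _ 0 prologue).
have [rm' [t [run1 rel1 le1]]] := compile_run limw w0 ex rel0 cat.
exists (t + 4), rm'; split=> //.
- by rewrite iterD run0 run1 size_cat.
- by rewrite all_cat nonrandom_compile.
- by rewrite addnC leq_add2l; move: le1; rewrite subn0.
Qed.

(** With [b = bitlen n] and [M <= 2 ^ (3b)], the cube needs [9b] bits, and [w.+1 <= 2 ^ (w/2 + 1)]
    leaves about [w/2 + 6b] bits for the second table. Of the five bits given up, four separate the
    sixteen arrays and one absorbs the offset. *)
Lemma address_bounds w n : 0 < n -> 40 * bitlen n <= w ->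
  [/\ (n + n + 4) * (n + n + 4) * (n + n + 4) <= 2 ^ (w - 5),
      w.+1 * (n + n + 4) * (n + n + 4) <= 2 ^ (w - 5), 2 ^ (w - 5) < 2 ^ w &
      (2 ^ (w - 5) + (n + 3)) * 16 < 2 ^ w].
Proof.
move=> n0 bw; set b := bitlen n in bw.
have nb : n < 2 ^ b by exact: trunc_log_ltn.
have b0 : 0 < b by [].
have Mb : n + n + 4 <= 2 ^ (3 * b).
  have h : 2 ^ (b + 2) <= 2 ^ (3 * b) by rewrite leq_exp2l //; clear -b0; lia.
  apply: leq_trans h; rewrite expnD; move: nb; move: (2 ^ b) => x.
  by clear -n0; lia.
have w5 : 5 < w by clear -bw b0; lia.
split.
- apply: (@leq_trans (2 ^ (3 * b) * 2 ^ (3 * b) * 2 ^ (3 * b))).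
    by rewrite !leq_mul.
  by rewrite -!expnD leq_exp2l //; clear -bw b0; lia.
- have hw : w.+1 <= 2 ^ (w %/ 2).+1.
    have := ltn_expl (w %/ 2) (isT : 1 < 2); rewrite expnS.
    by move: (2 ^ _) => x; clear; lia.
  apply: (@leq_trans (2 ^ (w %/ 2).+1 * 2 ^ (3 * b) * 2 ^ (3 * b))).
    by rewrite !leq_mul.
  by rewrite -!expnD leq_exp2l //; clear -bw b0; lia.
- by rewrite ltn_exp2l //; clear -w5; lia.
- have e : 2 ^ w = 2 ^ (w - 5) * 16 * 2.
    by rewrite -[16]/(2 ^ 4) -[X in _ * X]/(2 ^ 1) -!expnD; congr (_ ^ _); clear -w5; lia.
  have h : n + 3 < 2 ^ (w - 5).
    apply: leq_trans (_ : n + n + 4 <= _); first by clear; lia.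
    by apply: (leq_trans Mb); rewrite leq_exp2l //; clear -bw b0; lia.
  by rewrite e; move: h; move: (2 ^ (w - 5)) => x; clear; lia.
Qed.

Theorem theorem33 (R : realType) :
  exists (P : program) (c0 : nat), forall c1 : nat, exists C : nat,
  forall (w n sigma k : nat) (S : n.-tuple nat),
    1 <= n -> 1 <= k ->
    (forall a, a \in (S : seq nat) -> 1 <= a <= sigma) ->
    c0 * bitlen n <= w <= c1 * bitlen n ->
    sigma < 2 ^ w -> k < 2 ^ w ->
    computes_in_expected_time w P (input_config n sigma k S)
      (fun c => exists2 G : {fset nat}, outputs c G &
         attractor k S G /\
         forall Gstar : {fset nat}, min_attractor k S Gstar ->
           (#|` G|%:R <= harmonic_number R ((k * k.+1) %/ 2)
                           * #|` Gstar|%:R)%R)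
      ((C * time_bound n sigma k)%:R : R)%R.
Proof.
exists (with_prologue prog_main), 40 => c1.
(* Four steps for the prologue, then the code length for each tick and once more; that last pass
   raises 25 to 26, as [time_bound] is positive. *)
exists (4 + size (compile 4 prog_main) * (26 + 2 * c1)).
move=> w n sigma k S n0 k0 S_in /andP[w_ge w_le] sigma_lt k_lt.
have sizeS : size S = n by rewrite size_tuple.
have [lim1 lim2 lim3 lim4] := address_bounds n0 w_ge.
have nw : n + 3 < 2 ^ w by move: lim4; clear; lia.
have w3 : 3 < 2 ^ w by move: nw; clear; lia.
have w0 : 0 < w by case: (w) w3.
(* [2 ^ bitlen n <= 2 * n], so the upper bound on [w] makes [c1] digits in base [2n + 4] enough for
   every character. *)
have hc1 : sigma < (n + n + 4) ^ c1.
  apply: (leq_trans sigma_lt).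
  apply: (@leq_trans ((2 ^ bitlen n) ^ c1)).
    by rewrite -expnM leq_exp2l // mulnC.
  have [->|c0] := posnP c1; first by rewrite !expn0.
  rewrite leq_exp2r // /bitlen expnS.
  by have := trunc_logP (isT : 1 < 2) n0; move: (2 ^ _) => x; clear; lia.
have inp : input n sigma k S (initial_state n sigma k S).
  split=> // i /andP[i0 _]; rewrite /= addn2 /=.
  by case: i i0.
have [s' ex [A [h1 h2 h3 h4 h5]]] := main_correct R sizeS n0 k0 S_in sigma_lt
  k_lt lim1 lim2 lim3 inp (fun _ _ _ => erefl) erefl hc1.
have [t [rm [run rel det le_t]]] := with_prologue_run sizeS nw w3 w0 lim4 ex.
move: (size (compile 4 prog_main)) le_t => sz le_t.
move: (with_prologue prog_main) run det => P run det.
apply: (@computes_nonrandom w _ det R _ _ t); rewrite ?run.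
- exact: leqnn.
- have [_ _ rlo _] := rel.
  have mem a : a <= n -> memory (conf (size P) rm) a = lo s' a.
    by move=> an; apply: rlo; clear -an; lia.
  exists A.
    rewrite /outputs mem // (_ : [seq _ | _ <- _] = [seq lo s' a | a <- iota 1 (lo s' 0)]) //.
    apply/eq_in_map => a; rewrite mem_iota => al; apply: mem.
    by clear -al h2; lia.
  by split=> // G [/h4].
- have TB1 : 0 < time_bound n sigma k by apply: (leq_trans n0); apply: TB_n.
  apply: (leq_trans le_t); rewrite mulnDl leq_add ?leq_pmulr //.
  rewrite -mulnA leq_mul2l; apply/orP; right.
  rewrite (_ : 26 = 25 + 1) // addnAC mulnDl mul1n; move: h5 TB1.
  by move: ((25 + 2 * c1) * _) => x; clear; lia.
Qed.
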